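(* Let $\beta\in\mathbb R$. (1) Let $1<p<\infty$ and $\Omega\subset\mathbb R^N$ open; if $\beta+Q<0$ assume also $0\notin\Omega$. Then for every $u\in D^{1,p}_L(\Omega,\|\xi\|_\gamma^{p+\beta})$, $$\Big(\frac{|Q+\beta|}{p}\Big)^p\int_\Omega|u|^p\|\xi\|_\gamma^\beta\frac{|x|^{\gamma p}}{\|\xi\|_\gamma^{\gamma p}}d\xi\le\int_\Omega|\nabla_\gamma u|^p\|\xi\|_\gamma^{p+\beta}d\xi,$$ in particular $\big(\frac{|Q-p|}{p}\big)^p\int_\Omega\frac{|u|^p}{\|\xi\|_\gamma^p}\frac{|x|^{\gamma p}}{\|\xi\|_\gamma^{\gamma p}}d\xi\le\int_\Omega|\nabla_\gamma u|^pd\xi$ for $u\in D^{1,p}_L(\Omega)$. If $\Omega\cup\{0\}$ is a neighbourhood of the origin, the constant $(|Q+\beta|/p)^p$ is sharp. (2) Let $p=Q>1$, $R>0$, $\Omega=\{\xi:\|\xi\|_\gamma<R\}$ and $\beta<-1$. Then for every $u\in D^{1,p}_L(\Omega,(\ln(R/\|\xi\|_\gamma))^{p+\beta})$, $$\Big(\frac{|\beta+1|}{p}\Big)^p\int_\Omega\frac{|u|^p}{\|\xi\|_\gamma^p}\Big(\ln\frac R{\|\xi\|_\gamma}\Big)^\beta\frac{|x|^{\gamma p}}{\|\xi\|_\gamma^{\gamma p}}d\xi\le\int_\Omega|\nabla_\gamma u|^p\Big(\ln\frac R{\|\xi\|_\gamma}\Big)^{p+\beta}d\xi,$$ in particular $\big(\frac{p-1}{p}\big)^p\int_\Omega\frac{|u|^p}{(\|\xi\|_\gamma\ln(R/\|\xi\|_\gamma))^p}\frac{|x|^{\gamma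 p}}{\|\xi\|_\gamma^{\gamma p}}d\xi\le\int_\Omega|\nabla_\gamma u|^pd\xi$ for $u\in D^{1,p}_L(\Omega)$; the constant $(|\beta+1|/p)^p$ is sharp.
   Context: $\mathbb R^N$ is split as $\xi=(x,y)\in\mathbb R^n\times\mathbb R^k$, $\gamma\ge0$, and $\nabla_\gamma=(\nabla_x,|x|^\gamma\nabla_y)$ (the vector field associated to the matrix $\mu=\mathrm{diag}(I_n,|x|^\gamma I_k)$; for $p=2$ the associated operator is the Baouendi–Grushin operator $\Delta_x+|x|^{2\gamma}\Delta_y$). $\|\xi\|_\gamma:=\big(|x|^{2(1+\gamma)}+(1+\gamma)^2|y|^2\big)^{1/(2+2\gamma)}$ and $Q:=n+(1+\gamma)k$. For a weight $w\in L^1_{loc}(\Omega)$, $w>0$ a.e., $D^{1,p}_L(\Omega,w)$ is the closure of $C^\infty_0(\Omega)$ in the norm $(\int_\Omega|\nabla_\gamma u|^pw\,d\xi)^{1/p}$, and $D^{1,p}_L(\Omega)=D^{1,p}_L(\Omega,1)$. ''Sharp'' means the constant cannot be replaced by any larger one. *)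

(* Defs.v *)
From HB Require Import structures.
From mathcomp Require Import all_boot all_order all_algebra.
From mathcomp Require Import all_classical all_reals all_analysis.

Set Implicit Arguments.
Unset Strict Implicit.
Unset Printing Implicit Defensive.

Import Order.TTheory GRing.Theory Num.Theory.
Import numFieldNormedType.Exports.
Local Open Scope classical_set_scope.
Local Open Scope ring_scope.

Section Grushin.
Variables (R : realType) (n k : nat).

Local Notation pt := 'rV[R]_(n + k).

Definition xpart (xi : pt) : 'rV[R]_n := lsubmx xi.
Definition ypart (xi : pt) : 'rV[R]_k := rsubmx xi.

Definition eunorm m (v : 'rV[R]_m) : R := Num.sqrt (\sum_(i < m) v ord0 i ^+ 2).

Definition hnorm (gamma : R) (xi : pt) : R :=
  (eunorm (xpart xi) `^ (2 * (1 + gamma)) + (1 + gamma) ^+ 2 * eunorm (ypart xi) ^+ 2)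
    `^ (1 / (2 + 2 * gamma)).

Definition Qdim (gamma : R) : R := n%:R + (1 + gamma) * k%:R.

Definition partial (i : 'I_(n + k)) (f : pt -> R) : pt -> R :=
  fun xi => 'D_(delta_mx 0 i) f xi.

Fixpoint dpart (s : seq 'I_(n + k)) (f : pt -> R) : pt -> R :=
  match s with [::] => f | i :: s' => partial i (dpart s' f) end.

Definition smooth (f : pt -> R) : Prop :=
  forall s : seq 'I_(n + k), continuous (dpart s f) /\
    forall (i : 'I_(n + k)) (xi : pt), derivable (dpart s f) xi (delta_mx 0 i).

Definition support (f : pt -> R) : set pt := closure [set xi | f xi != 0].

Definition testfun (Omega : set pt) (f : pt -> R) : Prop :=
  smooth f /\ compact (support f) /\ support f `<=` Omega.

(* |nabla_gamma f (xi)|^p, nabla_gamma = (nabla_x, |x|^gamma nabla_y) *)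
Definition grad_gamma_p (gamma p : R) (f : pt -> R) (xi : pt) : R :=
  (\sum_(i < n) (partial (lshift k i) f xi) ^+ 2
   + (eunorm (xpart xi) `^ gamma) ^+ 2 * \sum_(j < k) (partial (rshift n j) f xi) ^+ 2)
  `^ (p / 2).

(* Lebesgue integral of a nonnegative function on R^N, as an iterated
   integral of one-dimensional Lebesgue integrals (Tonelli). *)
Fixpoint iint_seq (m : nat) (F : seq R -> \bar R) : \bar R :=
  match m with
  | 0 => F [::]
  | m'.+1 => (\int[@lebesgue_measure R]_t iint_seq m' (fun s => F (t :: s)))%E
  end.

Definition iint (f : pt -> \bar R) : \bar R :=
  iint_seq (n + k) (fun s => f (\row_(i < n + k) nth 0 s i)).

Definition iint_on (A : set pt) (f : pt -> \bar R) : \bar R :=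
  iint (fun xi => if `[< A xi >] then f xi else 0%E).

Definition null_set (Z : set pt) : Prop :=
  forall e : R, 0 < e -> exists a b : nat -> pt,
    (forall j i, a j ord0 i <= b j ord0 i) /\
    Z `<=` \bigcup_j [set xi | forall i, a j ord0 i <= xi ord0 i <= b j ord0 i] /\
    (\sum_(0 <= j <oo) (\prod_(i < n + k) (b j ord0 i - a j ord0 i))%:E <= e%:E)%E.

Definition energy (gamma p : R) (Omega : set pt) (w : pt -> R) (f : pt -> R) : \bar R :=
  iint_on Omega (fun xi => (grad_gamma_p gamma p f xi * w xi)%:E).

(* [inD gamma p Omega w u phi]: the Cauchy sequence phi of C_0^infty(Omega)
   functions (for the norm (int_Omega |nabla_gamma .|^p w)^(1/p)) represents
   an element of D^{1,p}_L(Omega, w), whose function is u, the a.e. limit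
   of phi on Omega. *)
Definition inD (gamma p : R) (Omega : set pt) (w : pt -> R)
    (u : pt -> R) (phi : nat -> pt -> R) : Prop :=
  (forall j, testfun Omega (phi j)) /\
  (forall e : R, 0 < e -> exists K : nat, forall j l : nat, (K <= j)%N -> (K <= l)%N ->
     (energy gamma p Omega w (fun xi => (phi j xi - phi l xi)%R) < e%:E)%E) /\
  (exists Z : set pt, null_set Z /\
     forall xi, Omega xi -> ~ Z xi -> (fun j => phi j xi) @ \oo --> u xi).

End Grushin.

(* Main.v *)
Require Import Defs.
From HB Require Import structures.
From mathcomp Require Import all_boot all_order all_algebra.
From mathcomp Require Import all_classical all_reals all_analysis.
From mathcomp Require Import measurable_realfun ring lra.
Import Order.TTheory GRing.Theory Num.Theory.
Import numFieldNormedType.Exports.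
Local Open Scope classical_set_scope.
Local Open Scope ring_scope.
Set Implicit Arguments.
Unset Strict Implicit.
Unset Printing Implicit Defensive.

(* Write rho for the homogeneous norm and Z = x.d_x + (1 + gamma) y.d_y for the
   generator of the dilations (x, y) |-> (e^r x, e^((1 + gamma) r) y).  By
   Cauchy-Schwarz, |x|^gamma |Z f| <= |grad_gamma f| rho^(1 + gamma), so in
   coordinates adapted to the dilations both inequalities reduce, orbit by
   orbit, to a weighted Hardy inequality on the line, which follows from
   integrating (g |v|^p)' and Young's inequality.  Fatou's lemma extends them
   from test functions to their limits.
   For sharpness take u = f(ln rho): as |grad_gamma rho| = (|x| / rho)^gamma,
   both sides become one-dimensional integrals times a common positive
   constant, and f is the formal extremal power times a cutoff that varies on
   a scale T -> oo.  To obtain a test function, rho is first replaced by a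
   smooth regularization, which is removed by dominated convergence. *)

(** * Product measure and polar coordinates *)

(** With r = ln rho along the orbits, Lebesgue measure becomes e^(Q r) dr times an angular weight.
    Logarithms and powers of rho have conventional values where rho = 0, so comparisons are made off
    x = 0, which is null because n >= 1. The power weight on an orbit is e^((Q + beta) r): one
    boundary term always has the good sign, and the other, at the end where this weight grows, must
    be killed by the support of the test function. At +oo compactness does this; at -oo the orbit
    tends to the origin, which is where the hypothesis on 0 enters. In the logarithmic case p = Q
    cancels the exponentials and what counts is the gap between the support and rho = Rad. The
    function [u] of an element of the completion is only an a.e. pointwise limit and need not be
    Borel measurable, so its integral is bounded by monotonicity, never rearranged by Tonelli. For
    sharpness the formal extremal makes |f|^p times the weight constant in a suitable variable q; a
    cutoff in q / T then costs a term of order 1/T. Its support recedes to the origin, or to rho =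
    Rad, and so fits into every admissible Omega. *)

Section Tm.
Variable R : realType.
Let dR : measure_display := sigma_display (@ocitv R).
Definition leb : {sigma_finite_measure set (measurableTypeR R) -> \bar R} := @lebesgue_measure R.

Section prodm.
Context d (T : measurableType d) (m : {sigma_finite_measure set T -> \bar R}).

Lemma prodm_sigma_finite : sigma_finite setT (leb \x m)%E.
Proof.
have [F FT Foo] := sigma_finiteT leb.
have [G GT Goo] := sigma_finiteT m.
(* Pairs of indices are coded by one natural number; a number that codes no pair contributes the
   empty set. *)
pose H i := if unpickle i is Some (j, k) then F j `*` G k else set0.
exists H.
  apply/seteqP; split => // -[x y] _.
  have : setT x by []. rewrite FT => -[j _ Fj].
  have : setT y by []. rewrite GT => -[k _ Gk].
  by exists (pickle (j, k)) => //; rewrite /H pickleK.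
move=> i; rewrite /H; case: unpickle => [[j k]|]; last by rewrite measure0; split.
have [? ?] := Foo j; have [? ?] := Goo k.
split; first exact: measurableX.
by rewrite [ltLHS]product_measure1E// lte_mul_pinfty// ge0_fin_numE.
Qed.

Definition prodm := (leb \x m)%E.
HB.instance Definition _ := Measure.on prodm.
HB.instance Definition _ := Measure_isSigmaFinite.Build _ _ _ prodm prodm_sigma_finite.
Definition prodm' : {sigma_finite_measure set (measurableTypeR R * T)%type -> \bar R} := prodm.
End prodm.
Definition dtt : {sigma_finite_measure set unit -> \bar R} := \d_ tt.
(* R^m as a nested binary product R * (R * ... * unit), so that [iint_seq] is a
   Tonelli iteration for [mu m]. *)
Fixpoint disp (m : nat) : measure_display :=
  match m with 0 => default_measure_display | m'.+1 => measure_prod_display (dR, disp m') end.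
Fixpoint Tm (m : nat) : measurableType (disp m) :=
  match m return measurableType (disp m) with
  | 0 => unit : measurableType _
  | m'.+1 => (measurableTypeR R * Tm m')%type : measurableType _ end.
Fixpoint mu (m : nat) : {sigma_finite_measure set (Tm m) -> \bar R} :=
  match m return {sigma_finite_measure set (Tm m) -> \bar R} with
  | 0 => dtt
  | m'.+1 => prodm' (mu m')
  end.
Fixpoint seqof m : Tm m -> seq R :=
  match m return Tm m -> seq R with
  | 0 => fun=> [::]
  | m'.+1 => fun t => t.1 :: seqof t.2
  end.

Lemma iint_seqE m (F : seq R -> \bar R) : measurable_fun setT (F \o @seqof m : Tm m -> \bar R) ->
  (forall s, 0 <= F s)%E -> iint_seq m F = (\int[mu m]_t F (seqof t))%E.
Proof.
elim: m F => [|m IH] F mF F0 /=.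
  rewrite [RHS](_ : _ = \int[dtt]_t cst (F [::]) t)%E //.
  by rewrite integral_cst// /dtt /= diracT mule1.
rewrite [RHS](fubini_tonelli1 (fun t : measurableTypeR R * Tm m => F (t.1 :: seqof t.2))) //.
apply: eq_integral => t _; rewrite /fubini_F /= IH //.
exact: (measurable_fun_pair2 (f := fun t : measurableTypeR R * Tm m => F (t.1 :: seqof t.2)) t mF).
Qed.

(** The integral of a nonnegative function is a supremum over the simple functions below it, so
    monotonicity holds without measurability. This is what makes integrals of an arbitrary limit [u]
    tractable. *)
Lemma ge0_le_integralT d (T : measurableType d) (m : {measure set T -> \bar R}) (f g : T -> \bar R) :
  (forall x, 0 <= f x)%E -> (forall x, f x <= g x)%E -> (\int[m]_x f x <= \int[m]_x g x)%E.
Proof.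
move=> f0 fg; have g0 x : (0 <= g x)%E by exact: le_trans (f0 x) (fg x).
rewrite !ge0_integralTE//; apply: le_ereal_sup => _ [h hf <-].
by exists h => // x; exact: le_trans (hf x) (fg x).
Qed.

Lemma iint_seq_ge0 m (F : seq R -> \bar R) : (forall s, 0 <= F s)%E -> (0 <= iint_seq m F)%E.
Proof.
elim: m F => [|m IH] F F0 //=; apply: integral_ge0 => t _; exact: IH.
Qed.

Lemma iint_seq_le m (F G : seq R -> \bar R) :
  (forall s, 0 <= F s)%E -> (forall s, F s <= G s)%E -> (iint_seq m F <= iint_seq m G)%E.
Proof.
elim: m F G => [|m IH] F G F0 FG //=.
apply: ge0_le_integralT => t; first exact: iint_seq_ge0.
exact: IH.
Qed.

Definition emb m (t : Tm m) : 'rV[R]_m := \row_(i < m) nth 0 (seqof t) i.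

Fixpoint ofseq m (s : seq R) : Tm m :=
  match m return Tm m with
  | 0 => tt
  | m'.+1 => (head 0 s, @ofseq m' (behead s))
  end.

Definition ofrow m (x : 'rV[R]_m) : Tm m := @ofseq m [seq x ord0 i | i <- enum 'I_m].

Lemma size_seqof m (t : Tm m) : size (seqof t) = m.
Proof. by elim: m t => // m IH t /=; rewrite IH. Qed.

Lemma seqofK m (t : Tm m) : ofseq m (seqof t) = t.
Proof. by elim: m t => [[]|m IH [x t]] //=; rewrite IH. Qed.

Lemma ofseqK m (s : seq R) : size s = m -> seqof (ofseq m s) = s.
Proof. by elim: m s => [[]|m IH [|x s]] //= [/IH ->]. Qed.

Lemma ofrowK m (x : 'rV[R]_m) : emb (ofrow x) = x.
Proof.
apply/rowP => i; rewrite mxE ofseqK ?size_map -?enumT ?size_enum_ord//.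
by rewrite (nth_map i) ?size_enum_ord// ?nth_ord_enum.
Qed.

Lemma embK m (t : Tm m) : ofrow (emb t) = t.
Proof.
rewrite -[RHS]seqofK /ofrow; congr (ofseq m _).
apply: (@eq_from_nth _ 0) => [|i]; rewrite size_map size_enum_ord ?size_seqof// => im.
by rewrite (nth_map (Ordinal im)) ?size_enum_ord// mxE nth_enum_ord.
Qed.

Lemma measurable_nth_seqof m i : measurable_fun setT (fun t : Tm m => nth 0 (seqof t) i : R).
Proof.
elim: m i => [|m IH] i; first by rewrite (_ : (fun _ => _) = cst 0)//; apply/funext => t; rewrite nth_default.
case: i => [|i] /=; first exact: measurable_fst.
exact: (measurableT_comp (IH i) measurable_snd).
Qed.

Lemma measurable_coord m (i : 'I_m) : measurable_fun setT (fun t : Tm m => emb t ord0 i : R).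
Proof. by under eq_fun do rewrite mxE; exact: measurable_nth_seqof. Qed.

Lemma iintE (n k : nat) (f : 'rV[R]_(n + k) -> \bar R) :
  measurable_fun setT (f \o @emb (n + k) : Tm (n + k) -> \bar R) ->
  (forall x, 0 <= f x)%E -> iint f = (\int[mu (n + k)]_t f (emb t))%E.
Proof. by move=> mf f0; rewrite /iint iint_seqE. Qed.

Lemma iint_le (n k : nat) (f g : 'rV[R]_(n + k) -> \bar R) :
  (forall x, 0 <= f x)%E -> (forall x, f x <= g x)%E -> (iint f <= iint g)%E.
Proof. by move=> f0 fg; exact: iint_seq_le. Qed.

Lemma mu_box m (a b : nat -> R) : (forall i, a i <= b i) ->
  let B := [set t : Tm m | forall i, (i < m)%N -> a i <= nth 0 (seqof t) i <= b i] in
  measurable B /\ mu m B = (\prod_(i < m) (b i - a i))%:E.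
Proof.
elim: m a b => [|m IH] a b ab /=.
  split=> //; rewrite big_ord0 (_ : [set _ | _] = setT) ?diracT//.
  by apply/seteqP; split.
have [mB BE] := IH (a \o S) (b \o S) (fun i => ab i.+1).
set B' := [set t | _] in mB BE.
rewrite (_ : [set _ | _] = `[a 0%N, b 0%N] `*` B').
  split; first exact: measurableX.
  rewrite [LHS]product_measure1E//= big_ord_recl EFinM BE; congr (_ * _)%E.
  by rewrite lebesgue_measure_itv /= lte_fin EFinB; case: ltgtP (ab 0%N) => // ->; rewrite subee.
apply/seteqP; split => -[x t] /=.
  move=> h; split; first by have := h 0%N isT; rewrite /= in_itv.
  by move=> i im; have := h i.+1 im.
by move=> [+ h] [|i] im /=; [rewrite in_itv|move=> _; exact: h].
Qed.

(** For each j a cover by boxes of total volume at most 1/(j+1) is chosen; the intersection over j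
    of these unions is a measurable null set containing [Z]. *)
Lemma null_setP n k (Z : set 'rV[R]_(n + k)) : Defs.null_set Z ->
  exists N : set (Tm (n + k)), [/\ measurable N, mu (n + k) N = 0%E & forall t, Z (emb t) -> N t].
Proof.
move=> nZ.
pose ok j (ab : (nat -> 'rV[R]_(n + k)) * (nat -> 'rV[R]_(n + k))) :=
    (forall l i, ab.1 l ord0 i <= ab.2 l ord0 i) /\
    Z `<=` \bigcup_l [set xi | forall i, ab.1 l ord0 i <= xi ord0 i <= ab.2 l ord0 i] /\
    (\sum_(0 <= l <oo) (\prod_(i < n + k) (ab.2 l ord0 i - ab.1 l ord0 i))%:E <= (j.+1%:R^-1 : R)%:E)%E.
have /choice [ab abP] j : exists ab, ok j ab.
  have [|a [b h]] := nZ j.+1%:R^-1; first by rewrite invr_gt0.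
  by exists (a, b).
pose B j l := [set t : Tm (n + k) | forall i : 'I_(n + k), (ab j).1 l ord0 i <= emb t ord0 i <= (ab j).2 l ord0 i].
have BP j l : measurable (B j l) /\ mu (n + k) (B j l) = (\prod_(i < n + k) ((ab j).2 l ord0 i - (ab j).1 l ord0 i))%:E.
  (* [mu_box] takes bounds indexed by all naturals, so rows are padded with 0 past their length. *)
  pose ext (v : 'rV[R]_(n + k)) i := if insub i is Some i' then v ord0 i' else 0.
  have [|] := @mu_box (n + k) (ext ((ab j).1 l)) (ext ((ab j).2 l)).
    by move=> i; rewrite /ext; case: insubP => // u _ _; exact: (abP j).1.
  rewrite (_ : [set _ | _] = B j l).
    move=> ? ->; split => //; congr EFin; apply: eq_bigr => i _.
    by rewrite /ext valK.
  apply/seteqP; split => t /= h i.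
    by have := h i (ltn_ord i); rewrite /ext valK mxE.
  move=> im; have := h (Ordinal im); rewrite mxE /=.
  by rewrite /ext insubT.
exists (\bigcap_j \bigcup_l B j l); split.
- apply: bigcapT_measurable => j; apply: bigcupT_measurable => l; exact: (BP j l).1.
- apply/eqP; rewrite eq_le measure_ge0 andbT; apply/lee_addgt0Pr => e e0; rewrite add0e.
  have [j je] : exists j, j.+1%:R^-1 < e.
    have [j _ h] := near_infty_natSinv_lt (PosNum e0); exists j; exact: (h j (leqnn j)).
  apply: (@le_trans _ _ (j.+1%:R^-1)%:E); last by rewrite lee_fin ltW.
  have [_ [_]] := abP j; apply: le_trans.
  apply: (@le_trans _ _ (mu (n + k) (\bigcup_l B j l))).
    apply: le_measure; rewrite ?inE; last by move=> t /(_ j I).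
      by apply: bigcapT_measurable => j'; apply: bigcupT_measurable => l; exact: (BP j' l).1.
    by apply: bigcupT_measurable => l; exact: (BP j l).1.
  apply: le_trans (measure_sigma_subadditive _ _ _ _) _ => [l||//|].
  + exact: (BP j l).1.
  + by apply: bigcupT_measurable => l; exact: (BP j l).1.
  + by [].
  + by rewrite (eq_eseriesr (fun l _ => (BP j l).2)).
- move=> t Zt j _; have [_ [+ _]] := abP j => /(_ _ Zt) [l _ h]; exists l => //.
Qed.

(** [f] may fail to be measurable, so it cannot be altered on a null set under the integral. It is
    dominated everywhere by [g] plus +oo on a measurable null set, a measurable function with the
    same integral as [g]. *)
Lemma iint_le_null n k (Z : set 'rV[R]_(n + k)) (f g : 'rV[R]_(n + k) -> \bar R) :
  Defs.null_set Z -> (forall x, 0 <= f x)%E -> (forall x, 0 <= g x)%E ->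
  measurable_fun setT (g \o @emb (n + k) : Tm (n + k) -> \bar R) ->
  (forall x, ~ Z x -> f x <= g x)%E -> (iint f <= iint g)%E.
Proof.
move=> /null_setP [N [mN N0 ZN]] f0 g0 mg fg.
pose h x := (g x + (\1_N (ofrow x))%:E * +oo)%E.
have h0 x : (0 <= h x)%E by rewrite adde_ge0// mule_ge0// lee_fin.
have mh : measurable_fun setT (h \o @emb (n + k) : Tm (n + k) -> \bar R).
  apply: emeasurable_funD => //=; apply: emeasurable_funM; last exact: measurable_cst.
  under eq_fun do rewrite embK; apply/measurable_EFinP; exact: measurable_indic.
apply: (@le_trans _ _ (iint h)).
  apply: iint_le => // x; have [Nx|Nx] := pselect (N (ofrow x)).
    by rewrite /h indicE mem_set// mul1e addey ?leey// gt_eqF// (lt_le_trans _ (g0 x)).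
  by rewrite /h indicE memNset// mul0e adde0; apply: fg => Zx; apply: Nx; apply: ZN; rewrite ofrowK.
rewrite !iintE//; rewrite le_eqVlt; apply/orP; left; apply/eqP; apply: ae_eq_integral => //.
exists N; split => // t /=; apply: contra_notP => Nt _; rewrite /h embK indicE memNset//.
by rewrite mul0e adde0.
Qed.

Lemma rV_norm_le m (x : 'rV[R]_m) (e : R) :
  0 <= e -> (forall i, `|x ord0 i| <= e) -> `|x| <= e.
Proof.
move=> e0 h; rewrite /Num.norm/= mx_normrE; apply: bigmax_le => // -[i j] _ /=.
by rewrite ord1.
Qed.

Lemma coord_le_norm m (x : 'rV[R]_m) i : `|x ord0 i| <= `|x|.
Proof.
rewrite [leRHS]/Num.norm/= mx_normrE.
by rewrite (le_bigmax _ (fun ij => `|x ij.1 ij.2|) (ord0, i)).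
Qed.

Lemma measurable_continuous m (f : 'rV[R]_m -> R) : continuous f ->
  measurable_fun setT (fun t : Tm m => f (emb t)).
Proof.
move=> cf.
(* f is the limit of its values on the grids of mesh 1 / (j + 1). *)
pose q j (x : 'rV[R]_m) : 'rV[R]_m := \row_i ((Num.floor (j.+1%:R * x ord0 i))%:~R / j.+1%:R).
apply: (measurable_fun_cvg (h := fun j (t : Tm m) => f (q j (emb t)))) => [j|t _].
  move=> _ Y mY; rewrite setTI.
  (* The approximant is constant on each half-open grid cell [C z], and there are countably many
     cells, so every preimage is a countable union of cells. *)
  pose C (z : {ffun 'I_m -> int}) := \bigcap_(i in [set: 'I_m])
    ((fun t : Tm m => emb t ord0 i) @^-1` `[(z i)%:~R / j.+1%:R, (z i + 1)%:~R / j.+1%:R[).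
  pose D l := if @unpickle {ffun 'I_m -> int} l is Some z then
     if `[< Y (f (\row_i ((z i)%:~R / j.+1%:R))) >] then C z else set0 else set0.
  rewrite (_ : _ @^-1` _ = \bigcup_l D l).
    apply: bigcupT_measurable => l; rewrite /D; case: unpickle => [z|//].
    case: ifP => // _; apply: fin_bigcap_measurable => // i _.
    rewrite -[X in measurable X]setTI; apply: measurable_coord => //.
  have j0 : (0 : R) < j.+1%:R by [].
  have CP z t : C z t <-> q j (emb t) = \row_i ((z i)%:~R / j.+1%:R) /\ forall i, Num.floor (j.+1%:R * emb t ord0 i) = z i.
    split.
      move=> h; have {}h i : Num.floor (j.+1%:R * emb t ord0 i) = z i.
        have := h i I; rewrite /= in_itv /= => /andP[h1 h2]; apply: floor_def.
        by rewrite mulrC -ler_pdivrMr// h1 -ltr_pdivlMr.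
      by split => //; apply/rowP => i; rewrite !mxE -(h i) mxE.
    move=> [_ h] i _; rewrite /= in_itv/= -(h i).
    by rewrite ler_pdivrMr// ltr_pdivlMr// mulrC floor_itv.
  apply/seteqP; split => t /=.
    move=> Yt; pose z := [ffun i => Num.floor (j.+1%:R * emb t ord0 i)].
    have Ct : C z t by apply/CP; split => [|i]; [apply/rowP => i; rewrite !mxE ffunE mxE|rewrite ffunE].
    exists (pickle z) => //; rewrite /D pickleK.
    by have [<- _] := (CP z t).1 Ct; rewrite asboolT.
  move=> [l _]; rewrite /D; case: unpickle => [z|//]; case: asboolP => // Yz /CP [-> _] //.
apply: (cvg_comp (fun j => q j (emb t)) f); last exact: cf.
apply/cvgrPdist_le => e e0.
near=> j; apply: rV_norm_le => [|i]; first exact: ltW.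
have j0 : (0 : R) < j.+1%:R by [].
set x := emb t ord0 i.
rewrite (_ : _ ord0 i = x - (Num.floor (j.+1%:R * x))%:~R / j.+1%:R); last by rewrite /x !mxE.
have /andP[h1 h2] := floor_itv (j.+1%:R * x).
apply: (@le_trans _ _ j.+1%:R^-1); last first.
  by apply: ltW; near: j; exact: (near_infty_natSinv_lt (PosNum e0)).
rewrite -(ler_pM2l j0) mulfV ?gt_eqF// -{1}(gtr0_norm j0) -normrM mulrBr mulrCA mulfV ?gt_eqF// mulr1.
rewrite ger0_norm ?subr_ge0// lerBlDl ltW//; by move: h2; rewrite intrD.
Unshelve. all: by end_near. Qed.

(** By uniqueness of Lebesgue measure: [leb] and c times its image under x |-> c x + a agree on
    half-open intervals. *)
Lemma leb_affine (c a : R) (f : R -> \bar R) : 0 < c -> measurable_fun setT f -> (forall x, 0 <= f x)%E ->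
  (\int[leb]_x f x = c%:E * \int[leb]_x f (c * x + a)%R)%E.
Proof.
move=> c0 mf f0.
have mg : measurable_fun setT (fun x : measurableTypeR R => (c * x + a)%R : measurableTypeR R).
  by apply: measurable_funD => //; apply: measurable_funM.
have E A : measurable A -> leb A = mscale (NngNum (ltW c0)) (pushforward leb (fun x : measurableTypeR R => (c * x + a)%R : measurableTypeR R)) A.
  move=> mA; apply: (lebesgue_measure_unique (mu := mscale (NngNum (ltW c0)) (pushforward leb (fun x : measurableTypeR R => (c * x + a)%R : measurableTypeR R)))) => // X /ocitvP [->|[[u v] /= uv ->]].
    by rewrite !measure0.
  rewrite /mscale /= /pushforward (_ : _ @^-1` _ = `](u - a) / c, (v - a) / c]%classic).
    rewrite !lebesgue_measure_itv /= !lte_fin ltr_pM2r ?invr_gt0// ltrD2r.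
    by case: ifP => _; rewrite ?mule0// -EFinB -EFinM; congr EFin; field; rewrite gt_eqF.
  apply/seteqP; split => x /=; rewrite !in_itv /= ltr_pdivrMr// ler_pdivlMr// ltrBlDr lerBrDr (mulrC x) //.
rewrite (eq_measure_integral (mscale (NngNum (ltW c0)) (pushforward leb (fun x : measurableTypeR R => (c * x + a)%R : measurableTypeR R)))); last by move=> A mA _; exact: E.
rewrite ge0_integral_mscale// ge0_integral_pushforward//.
Qed.

Fixpoint dilT m (w : nat -> R) (r : R) : Tm m -> Tm m :=
  match m return Tm m -> Tm m with
  | 0 => id
  | m'.+1 => fun t => (expR (w 0 * r) * t.1, @dilT m' (w \o S) r t.2)
  end.

Lemma nth_dilT m w r (t : Tm m) i : nth 0 (seqof (dilT w r t)) i = expR (w i * r) * nth 0 (seqof t) i.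
Proof.
elim: m w t i => [|m IH] w t i /=; first by rewrite nth_nil mulr0.
by case: i => [|i] //=; rewrite IH.
Qed.

Lemma measurable_dilT m w d (T : measurableType d) (f : T -> R) (g : T -> Tm m) :
  measurable_fun setT f -> measurable_fun setT g ->
  measurable_fun setT (fun z => dilT w (f z) (g z)).
Proof.
elim: m w g => [|m IH] w g mf mg //=.
apply: measurable_fun_pair; last by apply: IH => //; exact: measurableT_comp mg.
apply: measurable_funM; last exact: measurableT_comp mg.
by apply: measurableT_comp => //; exact: measurable_funM.
Qed.

Lemma int_TmS m (G : Tm m.+1 -> \bar R) : measurable_fun setT G -> (forall t, 0 <= G t)%E ->
  (\int[mu m.+1]_t G t = \int[leb]_x \int[mu m]_y G (x, y))%E.
Proof. exact: fubini_tonelli1. Qed.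

Lemma measurable_int_TmS m (G : Tm m.+1 -> \bar R) : measurable_fun setT G -> (forall t, 0 <= G t)%E ->
  measurable_fun setT (fun x : measurableTypeR R => \int[mu m]_y G (x, y))%E.
Proof. exact: measurable_fun_fubini_tonelli_F. Qed.

Lemma int_dilT m (w : nat -> R) r (G : Tm m -> \bar R) : measurable_fun setT G -> (forall t, 0 <= G t)%E ->
  (\int[mu m]_t G t = (expR ((\sum_(i < m) w i) * r))%:E * \int[mu m]_t G (dilT w r t))%E.
Proof.
elim: m w G => [|m IH] w G mG G0.
  by rewrite big_ord0 mul0r expR0 mul1e.
have mGd : measurable_fun setT (fun t => G (dilT w r t)).
  apply: measurableT_comp => //; apply: measurable_dilT => //; exact: measurable_cst.
rewrite int_TmS// int_TmS// big_ord_recl mulrDl expRD EFinM.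
rewrite (@leb_affine (expR (w 0 * r)) 0); last 3 first.
- exact: expR_gt0.
- exact: measurable_int_TmS.
- by move=> x; exact: integral_ge0.
rewrite -muleA; congr (_ * _)%E.
rewrite -ge0_integralZl; last 4 first.
- exact: measurableT.
- exact: (measurable_int_TmS (G := fun t => G (dilT w r t)) mGd).
- by move=> x _; exact: integral_ge0.
- by rewrite lee_fin expR_ge0.
apply: eq_integral => x _; rewrite addr0 (IH (w \o S))//; exact: measurable_fun_pair2.
Qed.

(* The fundamental domain 0 <= L < 1 of the dilation flow plays the role of the sphere. *)
Lemma polar m (w : nat -> R) (L : Tm m -> R) (E : set (Tm m)) (G : Tm m -> \bar R) :
  let Q := \sum_(i < m) w i in
  measurable E -> measurable_fun setT L -> measurable_fun setT G -> (forall t, 0 <= G t)%E ->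
  (forall r t, E (dilT w r t) <-> E t) ->
  (forall r t, E t -> L (dilT w r t) = L t + r) ->
  (\int[mu m]_t ((\1_E t)%:E * G t) =
   \int[mu m]_t ((\1_(E `&` L @^-1` `[0%R, 1%R[%classic) t * expR (- Q * L t))%:E *
     \int[leb]_r ((expR (Q * r))%:E * G (dilT w (r - L t) t))))%E.
Proof.
move=> Q mE mL mG G0 Edil Ldil.
pose I01 : set R := `[0%R, 1%R[%classic.
pose A := E `&` L @^-1` I01.
have mA : measurable A.
  apply: measurableI => //; rewrite -[X in measurable X]setTI; apply: mL => //; exact: measurable_itv.
(* For fixed t the r with 0 <= L t - r < 1 form an interval of length 1, so inserting this indicator
   and integrating over r changes nothing. After Tonelli, the change of variables by [dilT w r]
   turns the moving slab into the fixed domain [A]. *)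
pose H (z : measurableTypeR R * Tm m) := ((\1_E z.2 * \1_I01 (L z.2 - z.1))%:E * G z.2)%E.
have mI : measurable_fun setT (\1_I01 : R -> R) by apply: measurable_indic; exact: measurable_itv.
have mH : measurable_fun setT H.
  apply: emeasurable_funM; last exact: measurableT_comp measurable_snd.
  apply/measurable_EFinP; apply: measurable_funM.
    by apply: measurableT_comp (@measurable_snd _ _ _ _); exact: measurable_indic.
  apply: measurableT_comp => //; apply: measurable_funB; last exact: measurable_fst.
  exact: measurableT_comp measurable_snd.
have H0 z : (0 <= H z)%E by rewrite mule_ge0// lee_fin mulr_ge0.
transitivity (\int[mu m]_t \int[leb]_r H (r, t))%E.
  apply: eq_integral => t _.
  pose J : set R := `](L t - 1), L t]%classic.
  have mJ : measurable J by exact: measurable_itv.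
  transitivity (\int[leb]_r ((\1_J r)%:E * ((\1_E t)%:E * G t)))%E.
    rewrite ge0_integralZr//; last 2 first.
    - by apply/measurable_EFinP; exact: measurable_indic.
    - by rewrite mule_ge0// lee_fin.
    rewrite integral_indic// ?setIT//.
    rewrite /leb /J /= lebesgue_measure_itv /= lte_fin ltrBlDr ltrDl ltr01.
    by rewrite -EFinB opprB addrC subrK mul1e.
  apply: eq_integral => r _; rewrite /H /= EFinM muleA; congr (_ * _)%E.
  rewrite muleC; congr (_ * _)%E; congr EFin; rewrite !indicE; congr (_ %:R); congr nat_of_bool.
  by apply/idP/idP; rewrite !inE /I01 /J /= !in_itv /= => /andP[? ?]; apply/andP; split; lra.
rewrite -(fubini_tonelli (m1 := leb) (m2 := mu m) H)//.
transitivity (\int[leb]_r \int[mu m]_t ((\1_A t)%:E * ((expR (Q * r))%:E * G (dilT w r t))))%E.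
  apply: eq_integral => r _; rewrite (int_dilT w r); last 2 first.
  - exact: measurable_fun_pair2.
  - by move=> t; exact: H0.
  rewrite -ge0_integralZl; last 4 first.
  - exact: measurableT.
  - apply: (measurableT_comp (measurable_fun_pair2 r mH)); apply: measurable_dilT => //.
  - by move=> t _; exact: H0.
  - by rewrite lee_fin expR_ge0.
  apply: eq_integral => t _; rewrite /H /= [RHS]muleCA -/Q; congr (_ * _)%E; congr (_ * _)%E; congr EFin.
  rewrite !indicE; have [Et|Et] := pselect (E t).
    rewrite mem_set ?Edil// mul1r Ldil// addrK; congr (_ %:R); congr nat_of_bool.
    by apply/idP/idP; rewrite !inE => // -[].
  by rewrite memNset ?Edil// mul0r memNset// => -[].
have mK : measurable_fun setT (fun z : measurableTypeR R * Tm m => ((\1_A z.2)%:E * ((expR (Q * z.1))%:E * G (dilT w z.1 z.2)))%E).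
  apply: emeasurable_funM.
    by apply/measurable_EFinP; apply: measurableT_comp (@measurable_snd _ _ _ _); exact: measurable_indic.
  apply: emeasurable_funM.
    apply/measurable_EFinP; apply: measurableT_comp => //; apply: measurable_funM => //; exact: measurable_fst.
  by apply: measurableT_comp => //; apply: measurable_dilT; [exact: measurable_fst|exact: measurable_snd].
rewrite (fubini_tonelli (m1 := leb) (m2 := mu m) (fun z : measurableTypeR R * Tm m => ((\1_A z.2)%:E * ((expR (Q * z.1))%:E * G (dilT w z.1 z.2)))%E))//; last first.
  by move=> z; rewrite !mule_ge0// lee_fin ?expR_ge0.
have mGt t : measurable_fun setT (fun r : measurableTypeR R => G (dilT w r t)).
  by apply: measurableT_comp => //; apply: measurable_dilT => //; exact: measurable_cst.
have mGt' t : measurable_fun setT (fun r : measurableTypeR R => ((expR (Q * r))%:E * G (dilT w r t))%E).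
  apply: emeasurable_funM => //; apply/measurable_EFinP; apply: measurableT_comp => //; exact: measurable_funM.
apply: eq_integral => t _ /=.
have G0' (r : R) : (0 <= (expR (Q * r))%:E * G (dilT w r t))%E by rewrite mule_ge0// lee_fin expR_ge0.
rewrite ge0_integralZl//.
rewrite EFinM -muleA; congr (_ * _)%E.
(* Translating r by - L t starts every orbit at the point where L = 0; this is the origin of the
   factor [expR (- Q * L t)]. *)
apply: (etrans (@leb_affine 1 (- L t) _ ltr01 (mGt' t) G0')); rewrite mul1e.
rewrite -ge0_integralZl//; last 2 first.
- apply: emeasurable_funM.
    apply/measurable_EFinP; apply: measurableT_comp => //; exact: measurable_funM.
  by apply: measurableT_comp => //; apply: measurable_dilT; [exact: measurable_funB|exact: measurable_cst].
- by move=> r _; rewrite mule_ge0// lee_fin expR_ge0.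
apply: eq_integral => r _; rewrite mul1r muleA -EFinM -expRD; congr ((expR _)%:E * _)%E; ring.
Qed.
End Tm.

(** * The homogeneous norm *)

Section Geometry.
Variables (R : realType) (n k : nat) (gamma : R).
Hypothesis (n1 : (1 <= n)%N) (gamma0 : 0 <= gamma).
Local Notation pt := 'rV[R]_(n + k).
Local Notation X xi := (eunorm (@xpart R n k xi)).
Local Notation rho := (@hnorm R n k gamma).

Definition wt (i : nat) : R := if (i < n)%N then 1 else 1 + gamma.
Definition dil (r : R) (xi : pt) : pt := \row_i (expR (wt i * r) * xi ord0 i).

Let g1 : 0 < 1 + gamma. Proof. by rewrite ltr_pwDl. Qed.
Let kap0 : 0 < 2 + 2 * gamma. Proof. by move: gamma0; lra. Qed.

Lemma sum_wt : \sum_(i < n + k) wt i = Qdim n k gamma.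
Proof.
rewrite big_split_ord /= /Qdim; congr (_ + _).
  under eq_bigr do rewrite /wt ltn_ord.
  by rewrite sumr_const card_ord.
under eq_bigr do rewrite /wt ltnNge leq_addr /=.
by rewrite sumr_const card_ord mulr_natr.
Qed.

Lemma emb_dilT r (t : Tm R (n + k)) : emb (dilT wt r t) = dil r (emb t).
Proof. by apply/rowP => i; rewrite !mxE nth_dilT. Qed.

Lemma dilD r s xi : dil r (dil s xi) = dil (r + s) xi.
Proof. by apply/rowP => i; rewrite !mxE mulrA -expRD mulrDr. Qed.

Lemma eunorm_ge0 m (v : 'rV[R]_m) : 0 <= eunorm v.
Proof. exact: sqrtr_ge0. Qed.

Lemma sqr_eunorm m (v : 'rV[R]_m) : eunorm v ^+ 2 = \sum_(i < m) v ord0 i ^+ 2.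
Proof. by rewrite sqr_sqrtr// sumr_ge0// => i _; rewrite sqr_ge0. Qed.

Lemma eunormZ m (c : R) (v : 'rV[R]_m) : 0 <= c -> eunorm (c *: v) = c * eunorm v.
Proof.
move=> c0; rewrite /eunorm; under eq_bigr do rewrite mxE exprMn.
by rewrite -mulr_sumr sqrtrM ?sqr_ge0// sqrtr_sqr ger0_norm.
Qed.

Lemma xpart_dil r xi : xpart (dil r xi) = expR r *: xpart xi.
Proof. by apply/rowP => i; rewrite !mxE /wt /= ltn_ord mul1r. Qed.

Lemma ypart_dil r xi : ypart (dil r xi) = expR ((1 + gamma) * r) *: ypart xi.
Proof. by apply/rowP => i; rewrite !mxE /wt /= ltnNge leq_addr. Qed.

Lemma eunorm_xpart_dil r xi : X (dil r xi) = expR r * X xi.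
Proof. by rewrite xpart_dil eunormZ ?expR_ge0. Qed.

Lemma expR_powR (r a : R) : expR r `^ a = expR (r * a).
Proof. by rewrite -expRM. Qed.

Definition hP (xi : pt) : R :=
  X xi `^ (2 * (1 + gamma)) + (1 + gamma) ^+ 2 * eunorm (ypart xi) ^+ 2.

Lemma hP_ge0 xi : 0 <= hP xi.
Proof. by rewrite addr_ge0 ?powR_ge0// mulr_ge0 ?sqr_ge0. Qed.

Lemma hnormE xi : rho xi = hP xi `^ (1 / (2 + 2 * gamma)).
Proof. by []. Qed.

Lemma hP_dil r xi : hP (dil r xi) = expR ((2 + 2 * gamma) * r) * hP xi.
Proof.
rewrite /hP eunorm_xpart_dil ypart_dil eunormZ ?expR_ge0//.
rewrite powRM ?expR_ge0 ?eunorm_ge0// expR_powR exprMn -expRM_natl [RHS]mulrDr.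
congr (_ + _); first by congr (expR _ * _); ring.
rewrite mulrCA; congr (_ * _); congr expR; ring.
Qed.

Lemma hnorm_dil r xi : rho (dil r xi) = expR r * rho xi.
Proof.
rewrite !hnormE hP_dil powRM ?expR_ge0 ?hP_ge0// expR_powR; congr (expR _ * _).
by field; rewrite gt_eqF.
Qed.

Lemma hnorm_ge0 xi : 0 <= rho xi. Proof. exact: powR_ge0. Qed.

Lemma hnorm_powR_kap xi : rho xi `^ (2 + 2 * gamma) = hP xi.
Proof. by rewrite hnormE -powRrM divfK ?gt_eqF// powRr1// hP_ge0. Qed.

Lemma X_le_hnorm xi : X xi <= rho xi.
Proof.
have -> : X xi = (X xi `^ (2 + 2 * gamma)) `^ (1 / (2 + 2 * gamma)).
  by rewrite -powRrM mulrCA divff ?mulr1 ?powRr1 ?eunorm_ge0// gt_eqF.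
rewrite hnormE; apply: ge0_ler_powR; rewrite ?nnegrE ?powR_ge0 ?hP_ge0//; first exact: divr_ge0 ler01 (ltW kap0).
rewrite /hP (_ : 2 * (1 + gamma) = 2 + 2 * gamma); last by ring.
by rewrite lerDl mulr_ge0 ?sqr_ge0.
Qed.

Lemma hnorm_gt0 xi : X xi != 0 -> 0 < rho xi.
Proof. by move=> h; apply: lt_le_trans (X_le_hnorm xi); rewrite lt_neqAle eq_sym h eunorm_ge0. Qed.

Lemma measurable_eunorm d (T : measurableType d) m (v : T -> 'rV[R]_m) :
  (forall i, measurable_fun setT (fun t => v t ord0 i)) ->
  measurable_fun setT (fun t => eunorm (v t)).
Proof.
move=> mv; have ms : measurable_fun setT (Num.sqrt : R -> R).
  by apply: continuous_measurable_fun; exact: sqrt_continuous.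
apply: (measurableT_comp ms).
rewrite (_ : (fun t => _) = (fun t => \sum_(i < m) (fun i t => v t ord0 i ^+ 2) i t)) //.
by apply: measurable_sum => i; apply: measurable_funX.
Qed.

Lemma measurable_X : measurable_fun setT (fun t : Tm R (n + k) => X (emb t)).
Proof.
apply: measurable_eunorm => i; under eq_fun do rewrite mxE; exact: measurable_coord.
Qed.

Lemma measurable_hnorm : measurable_fun setT (fun t : Tm R (n + k) => rho (emb t)).
Proof.
apply: (measurableT_comp (measurable_powR _)); apply: measurable_funD.
  exact: (measurableT_comp (measurable_powR _) measurable_X).
apply: measurable_funM => //; apply: measurable_funX.
by apply: measurable_eunorm => i; under eq_fun do rewrite mxE; exact: measurable_coord.
Qed.

Lemma measurable_lnrho : measurable_fun setT (fun t : Tm R (n + k) => ln (rho (emb t))).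
Proof. exact: (measurableT_comp (@measurable_ln R) measurable_hnorm). Qed.

Definition Xne0 := [set t : Tm R (n + k) | X (emb t) != 0].

Lemma measurable_Xne0 : measurable Xne0.
Proof.
rewrite (_ : Xne0 = ~` ((fun t => X (emb t)) @^-1` [set 0])); last first.
  by apply/seteqP; split => t /=; [move/eqP|move/eqP].
apply: measurableC; rewrite -[Y in measurable Y]setTI; exact: measurable_X.
Qed.

(** As n >= 1, the set x = 0 lies in the hyperplane where the first coordinate vanishes. Its being
    null makes the conventional values of [ln] and [powR] at rho = 0 harmless. *)
Lemma mu_Xeq0 : mu R (n + k) (~` Xne0) = 0%E.
Proof.
have H m : (0 < m)%N -> mu R m [set t | nth 0 (seqof t) 0 = 0] = 0%E.
  case: m => // m _; rewrite (_ : [set _ | _] = [set 0] `*` setT); last first.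
    by apply/seteqP; split => -[x t] //= [].
  by rewrite [LHS]product_measure1E// [Y in (Y * _)%E]lebesgue_measure_set1 mul0e.
apply/eqP; rewrite eq_le measure_ge0 andbT -(H (n + k)%N); last by rewrite (leq_trans n1)// leq_addr.
apply: le_measure; rewrite ?inE.
- by apply: measurableC; exact: measurable_Xne0.
- rewrite -[Y in measurable Y]setTI (_ : [set t | _] = (fun t => nth 0 (seqof t) 0) @^-1` [set 0])//.
  exact: measurable_nth_seqof.
- move=> t /=/negP; rewrite negbK sqrtr_eq0 => h.
  have n0 : (0 < n)%N by [].
  have : xpart (emb t) ord0 (Ordinal n0) ^+ 2 <= 0.
    apply: le_trans h; rewrite (bigD1 (Ordinal n0))//= lerDl sumr_ge0// => i _; exact: sqr_ge0.
  rewrite le_eqVlt ltNge sqr_ge0 orbF sqrf_eq0 !mxE /= => /eqP //.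
Qed.

Lemma int_Xne0 (G : Tm R (n + k) -> \bar R) : measurable_fun setT G ->
  (\int[mu R (n + k)]_t G t = \int[mu R (n + k)]_t ((\1_Xne0 t)%:E * G t))%E.
Proof.
move=> mG; apply: ae_eq_integral => //.
  apply: emeasurable_funM => //; apply/measurable_EFinP; apply: measurable_indic; exact: measurable_Xne0.
exists (~` Xne0); split; [apply: measurableC; exact: measurable_Xne0|exact: mu_Xeq0|].
by move=> t /=; apply: contra_not => Et _; rewrite indicE mem_set// mul1e.
Qed.

Let Xdil r t : Xne0 (dilT wt r t) <-> Xne0 t.
Proof.
by rewrite /Xne0 /= emb_dilT eunorm_xpart_dil mulf_eq0 expR_eq0.
Qed.

Let lnrho_dil r t : Xne0 t -> ln (rho (emb (dilT wt r t))) = ln (rho (emb t)) + r.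
Proof.
move=> Et; rewrite emb_dilT hnorm_dil lnM ?posrE ?expR_gt0 ?hnorm_gt0//.
by rewrite expRK addrC.
Qed.

(** Density that stands for the surface measure: rho^(-Q) on the shell 1 <= rho < e, off x = 0. *)
Definition polarw (t : Tm R (n + k)) : R :=
  \1_(Xne0 `&` (fun t => ln (rho (emb t))) @^-1` `[0%R, 1%R[%classic) t * expR (- Qdim n k gamma * ln (rho (emb t))).

Lemma measurable_polarw : measurable_fun setT polarw.
Proof.
apply: measurable_funM.
  apply: measurable_indic; apply: measurableI; first exact: measurable_Xne0.
  by rewrite -[Y in measurable Y]setTI; apply: measurable_lnrho => //; exact: measurable_itv.
by apply: measurableT_comp => //; apply: measurable_funM => //; exact: measurable_lnrho.
Qed.

Lemma polarw_ge0 t : 0 <= polarw t.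
Proof. by rewrite mulr_ge0// expR_ge0. Qed.

Definition unitpt (xi : pt) := dil (- ln (rho xi)) xi.

Lemma hnorm_unitpt xi : X xi != 0 -> rho (unitpt xi) = 1.
Proof.
move=> h; have r0 := hnorm_gt0 h.
by rewrite hnorm_dil expRN lnK ?posrE// mulVf// gt_eqF.
Qed.

Lemma polarE (G : pt -> \bar R) : measurable_fun setT (G \o @emb R (n + k) : Tm R (n + k) -> \bar R) ->
  (forall xi, 0 <= G xi)%E ->
  iint G = (\int[mu R (n + k)]_t ((polarw t)%:E *
    \int[leb R]_r ((expR (Qdim n k gamma * r))%:E * G (dil r (unitpt (emb t))))))%E.
Proof.
move=> mG G0; rewrite iintE// int_Xne0//.
have := @polar R (n + k) wt (fun t => ln (rho (emb t))) Xne0 (G \o @emb R (n + k)) measurable_Xne0 measurable_lnrho mG (fun t => G0 _) Xdil lnrho_dil.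
rewrite sum_wt => ->; apply: eq_integral => t _; congr (_ * _)%E.
by apply: eq_integral => r _; rewrite /= emb_dilT /unitpt dilD.
Qed.

Lemma polar_le (F G : pt -> \bar R) :
  measurable_fun setT (F \o @emb R (n + k) : Tm R (n + k) -> \bar R) ->
  measurable_fun setT (G \o @emb R (n + k) : Tm R (n + k) -> \bar R) ->
  (forall xi, 0 <= F xi)%E -> (forall xi, 0 <= G xi)%E ->
  (forall xi, X xi != 0 -> rho xi = 1 ->
    (\int[leb R]_r ((expR (Qdim n k gamma * r))%:E * F (dil r xi)) <=
     \int[leb R]_r ((expR (Qdim n k gamma * r))%:E * G (dil r xi)))%E) ->
  (iint F <= iint G)%E.
Proof.
move=> mF mG F0 G0 FG; rewrite !polarE//.
apply: ge0_le_integralT => t.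
  rewrite mule_ge0 ?lee_fin ?polarw_ge0//; apply: integral_ge0 => r _.
  by rewrite mule_ge0// lee_fin expR_ge0.
have [Et|Et] := pselect (Xne0 t); last first.
  by rewrite /polarw indicE memNset ?mul0r ?mul0e// => -[].
apply: lee_wpmul2l; first by rewrite lee_fin polarw_ge0.
apply: FG; last exact: hnorm_unitpt.
by rewrite /unitpt eunorm_xpart_dil mulf_neq0// gt_eqF// expR_gt0.
Qed.

(* |grad_gamma rho|^p *)
Definition psip (p : R) (xi : pt) : R := X xi `^ (gamma * p) / rho xi `^ (gamma * p).

Lemma psip_ge0 p xi : 0 <= psip p xi.
Proof. by rewrite divr_ge0 ?powR_ge0. Qed.

Lemma psip_dil p r xi : psip p (dil r xi) = psip p xi.
Proof.
rewrite /psip eunorm_xpart_dil hnorm_dil !powRM ?expR_ge0 ?eunorm_ge0 ?hnorm_ge0//.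
by rewrite -mulf_div divff ?mul1r// gt_eqF// powR_gt0 ?expR_gt0.
Qed.

Lemma measurable_psip p : measurable_fun setT (fun t : Tm R (n + k) => psip p (emb t)).
Proof.
apply: measurable_funM; first exact: (measurableT_comp (measurable_powR _) measurable_X).
under eq_fun do rewrite -powRN.
exact: (measurableT_comp (measurable_powR _) measurable_hnorm).
Qed.

(** Angular factor shared by all radial integrals. It cancels between the two sides of an inequality
    once it is known to be positive and finite. *)
Definition Mconst p : \bar R := (\int[mu R (n + k)]_t (polarw t * psip p (emb t))%:E)%E.

Lemma iint_radial p (h : R -> \bar R) : measurable_fun setT h -> (forall r, 0 <= h r)%E ->
  iint (fun xi => (psip p xi)%:E * h (ln (rho xi)))%E =
  (Mconst p * \int[leb R]_r ((expR (Qdim n k gamma * r))%:E * h r))%E.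
Proof.
move=> mh h0.
have mG : measurable_fun setT ((fun xi => (psip p xi)%:E * h (ln (rho xi)))%E \o @emb R (n + k) : Tm R (n + k) -> \bar R).
  apply: emeasurable_funM; first by apply/measurable_EFinP; exact: measurable_psip.
  exact: (measurableT_comp mh measurable_lnrho).
have mQh : measurable_fun setT (fun r : measurableTypeR R => (expR (Qdim n k gamma * r))%:E * h r)%E.
  apply: emeasurable_funM => //; apply/measurable_EFinP; apply: measurableT_comp => //; exact: measurable_funM.
have Qh0 r : (0 <= (expR (Qdim n k gamma * r))%:E * h r)%E by rewrite mule_ge0// lee_fin expR_ge0.
rewrite polarE//; last by move=> xi; rewrite mule_ge0// lee_fin psip_ge0.
rewrite /Mconst -ge0_integralZr//; last 3 first.
- apply/measurable_EFinP; apply: measurable_funM; [exact: measurable_polarw|exact: measurable_psip].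
- by move=> t _; rewrite lee_fin mulr_ge0 ?polarw_ge0 ?psip_ge0.
- exact: integral_ge0.
apply: eq_integral => t _; have [Et|Et] := pselect (Xne0 t); last first.
  by rewrite /polarw indicE memNset ?mul0r ?mul0e// => -[].
rewrite (EFinM (polarw t)) -muleA; congr (_ * _)%E.
transitivity (\int[leb R]_r ((psip p (emb t))%:E * ((expR (Qdim n k gamma * r))%:E * h r)))%E.
  apply: eq_integral => r _.
  have -> : psip p (dil r (unitpt (emb t))) = psip p (emb t) by rewrite psip_dil /unitpt psip_dil.
  have -> : ln (rho (dil r (unitpt (emb t)))) = r by rewrite hnorm_dil hnorm_unitpt// mulr1 expRK.
  by rewrite muleCA.
by rewrite ge0_integralZl// lee_fin psip_ge0.
Qed.
End Geometry.

(** * Hardy inequalities on the line *)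

Section OneDim.
Variable R : realType.

Lemma is_derive_continuous (f : R -> R) (x df : R) : is_derive x 1 f df -> {for x, continuous f}.
Proof. by case=> df' _; apply: differentiable_continuous; apply/derivable1_diffP. Qed.

Lemma continuous_normpow (q : R) : 0 < q -> continuous (fun x : R => `|x| `^ q).
Proof.
move=> q0 x; have [->|x0] := eqVneq x 0.
  rewrite /continuous_at normr0 powR0 ?gt_eqF//; apply/cvgrPdist_lt => e e0.
  have d0 : 0 < e `^ q^-1 by rewrite powR_gt0.
  near=> y; rewrite sub0r normrN ger0_norm ?powR_ge0//.
  have yd : `|y| < e `^ q^-1.
    near: y; apply/nbhs_ballP; exists (e `^ q^-1) => //= y.
    by rewrite /ball /= sub0r normrN.
  rewrite -[ltRHS](powRr1 (ltW e0)) -(mulVf (lt0r_neq0 q0)) powRrM.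
  by rewrite gt0_ltr_powR ?nnegrE ?powR_ge0.
have nx0 : 0 < `|x| by rewrite normr_gt0.
apply: (@continuous_comp _ _ _ (fun y : R => `|y|) (fun y : R => y `^ q)); first exact: norm_continuous.
exact: is_derive_continuous (is_derive1_powR q nx0).
Unshelve. all: by end_near. Qed.

(** This is sign(x) |x|^q. For q = p - 1 it is, up to the factor p, the derivative of |x|^p. *)
Definition spow (q x : R) : R := if 0 <= x then x `^ q else - ((- x) `^ q).

Lemma spow_norm (q x : R) : `|spow q x| = `|x| `^ q.
Proof.
rewrite /spow; case: (leP 0 x) => x0; first by rewrite !ger0_norm ?powR_ge0.
by rewrite normrN (ltr0_norm x0) ger0_norm ?powR_ge0.
Qed.

Lemma continuous_spow (q : R) : 0 < q -> continuous (spow q).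
Proof.
(* Splitting into positive and negative parts reduces continuity, including at 0, to that of
   |x|^q. *)
move=> q0; rewrite (_ : spow q = fun x => `|Num.max x 0| `^ q - `|Num.max (- x) 0| `^ q); last first.
  apply/funext => x; rewrite /spow; case: (leP 0 x) => x0.
    by rewrite (max_r (_ : - x <= 0)) ?oppr_le0// normr0 powR0 ?gt_eqF// subr0 ger0_norm.
  rewrite (max_l (_ : 0 <= - x)) ?oppr_ge0 ?ltW// normr0 powR0 ?gt_eqF// sub0r ger0_norm//.
  by rewrite oppr_ge0 ltW.
move=> x; apply: cvgB.
  apply: (@continuous_comp _ _ _ (fun x : R => Num.max x 0) (fun y : R => `|y| `^ q)); last exact: continuous_normpow.
  by apply: (@continuous_max _ _ (fun x : R => x) (fun=> 0)); [exact: cvg_id|exact: cvg_cst].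
apply: (@continuous_comp _ _ _ (fun x : R => Num.max (- x) 0) (fun y : R => `|y| `^ q)); last exact: continuous_normpow.
by apply: (@continuous_max _ _ (fun x : R => - x) (fun=> 0)); [exact: opp_continuous|exact: cvg_cst].
Qed.

Lemma normpow_spow (p x : R) : 1 < p -> `|x| `^ p = spow (p - 1) x * x.
Proof.
move=> p1; have p0 : 0 < p by exact: lt_trans p1.
rewrite /spow; case: (leP 0 x) => x0.
  by rewrite ger0_norm// mulrC mulr_powRB1.
by rewrite ltr0_norm// mulNr -mulrN mulrC mulr_powRB1// oppr_ge0 ltW.
Qed.

Lemma is_derive_normpow (p x : R) : 1 < p -> is_derive x 1 (fun y : R => `|y| `^ p) (p * spow (p - 1) x).
Proof.
move=> p1; have [x0|x0|->] := ltgtP x 0.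
- apply: (@near_eq_is_derive _ _ _ (fun y => (- y) `^ p)).
    near=> y; rewrite ltr0_norm//; near: y; exact: lt_nbhsl.
  have nx0 : 0 < - x by rewrite oppr_gt0.
  have := is_derive1_comp (is_derive1_powR p nx0) (is_deriveN (is_derive_id x (1 : R))).
  by rewrite /spow leNgt x0 /= mulrN1 mulrN.
- apply: (@near_eq_is_derive _ _ _ (fun y => y `^ p)).
    near=> y; rewrite gtr0_norm//; near: y; exact: lt_nbhsr.
  by rewrite /spow (ltW x0); exact: is_derive1_powR.
- rewrite (_ : p * _ = 0); last by rewrite /spow lexx powR0 ?mulr0// subr_eq0 gt_eqF.
  (* Since |h|^p = spow (p - 1) h * h, the difference quotient at 0 is [spow (p - 1) h], which tends
     to 0 because p > 1. *)
  have H : (fun h : R => h^-1 *: (`|h *: (1 : R) + (0 : R)| `^ p - `|0 : R| `^ p)) @ 0^' --> (0 : R).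
    have : (fun h : R => spow (p - 1) h) @ 0^' --> (0 : R).
      apply: cvg_within_filter.
      have := @continuous_spow (p - 1) _ (0 : R); rewrite subr_gt0 => /(_ p1).
      by rewrite /continuous_at {2}/spow lexx powR0 // subr_eq0 gt_eqF.
    apply: cvg_trans; apply: near_eq_cvg; near=> h.
    have h0 : h != 0 by near: h; exact: nbhs_dnbhs_neq.
    rewrite normr0 powR0 ?subr0; last by rewrite gt_eqF// (lt_trans _ p1).
    rewrite (normpow_spow _ p1) [h *: (1 : R)]mulr1 addr0 /GRing.scale /= mulrCA mulVf ?mulr1//.
  split; first by apply: cvgP H.
  exact: cvg_lim H.
Unshelve. all: by end_near. Qed.

Lemma young_pow (p a b : R) : 1 < p -> 0 <= a -> 0 <= b ->
  p * (a `^ (p - 1) * b) <= (p - 1) * a `^ p + b `^ p.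
Proof.
move=> p1 a0 b0; have p0 : 0 < p by exact: lt_trans p1.
have q0 : 0 < p - 1 by rewrite subr_gt0.
have := @conjugate_powR R (a `^ (p - 1)) b (p / (p - 1)) p.
rewrite powR_ge0 b0 divr_gt0// p0 => /(_ isT isT isT isT).
rewrite -powRrM mulrCA divff ?gt_eqF// mulr1 invf_div => H.
have /H {}H : (p - 1) / p + p^-1 = 1 by field; rewrite gt_eqF.
rewrite -(ler_pM2l p0) in H; apply: le_trans H _; rewrite le_eqVlt; apply/orP; left; apply/eqP.
by field; rewrite !gt_eqF.
Qed.

(** The sign s = 1 or -1 treats increasing and decreasing [g] at once: [s * g] is then a primitive
    of the positive weight [dg]. Integrating the derivative of s g |v|^p leaves a nonpositive
    boundary term, and Young's inequality absorbs the mixed term into the two weighted integrals. *)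
Lemma hardy_interval (p s : R) (v dv g dg : R -> R) (A B : R) :
  1 < p -> A < B -> s ^+ 2 = 1 ->
  (forall r, A <= r <= B -> is_derive r 1 v (dv r)) ->
  (forall r, A <= r <= B -> is_derive r 1 g (s * dg r)) ->
  (forall r, A <= r <= B -> 0 < g r) -> (forall r, A <= r <= B -> 0 < dg r) ->
  (forall r, A <= r <= B -> {for r, continuous dv}) ->
  (forall r, A <= r <= B -> {for r, continuous dg}) ->
  s * (g B * `|v B| `^ p - g A * `|v A| `^ p) <= 0 ->
  (\int[@lebesgue_measure R]_(r in `[A, B]) (`|v r| `^ p * dg r)%:E <=
   \int[@lebesgue_measure R]_(r in `[A, B]) (p `^ p * (`|dv r| `^ p * (g r `^ p / dg r `^ (p - 1))))%:E)%E.
Proof.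
move=> p1 AB s2 Dv Dg g0 dg0 cdv cdg bd.
have p0 : 0 < p by exact: lt_trans p1.
pose D r := s * (g r * `|v r| `^ p).
pose dD r := dg r * `|v r| `^ p + s * (g r * (p * spow (p - 1) (v r) * dv r)).
have DD r : A <= r <= B -> is_derive r 1 D (dD r).
  move=> rAB.
  have Dvp := is_derive1_comp (is_derive_normpow (v r) p1) (Dv r rAB).
  have Dgv := is_deriveM (Dg r rAB) Dvp.
  have := is_deriveZ s Dgv.
  rewrite (_ : s *: _ = dD r) //.
  rewrite /dD /GRing.scale /= mulrDr addrC; congr (_ + _).
  by rewrite [RHS]mulrC -[in RHS](mul1r (dg r)) -s2 /=; ring.
have inI r : (r \in `[A, B]) = (A <= r <= B) by rewrite in_itv.
have cv r : A <= r <= B -> {for r, continuous v}.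
  move=> rAB; exact: is_derive_continuous (Dv r rAB).
have cg r : A <= r <= B -> {for r, continuous g}.
  move=> rAB; exact: is_derive_continuous (Dg r rAB).
have cvp r : A <= r <= B -> {for r, continuous (fun x => `|v x| `^ p)}.
  by move=> rAB; apply: (@continuous_comp _ _ _ v (fun y : R => `|y| `^ p)); [exact: cv|exact: continuous_normpow].
have cI (f : R -> R) : (forall r, A <= r <= B -> {for r, continuous f}) -> {within `[A, B], continuous f}.
  by move=> cf; apply: continuous_in_subspaceT => r; rewrite inE /= in_itv; exact: cf.
have cpw (q : R) (h : R -> R) : (forall r, A <= r <= B -> 0 < h r) -> (forall r, A <= r <= B -> {for r, continuous h}) ->
    forall r, A <= r <= B -> {for r, continuous (fun x => h x `^ q)}.
  move=> h0 ch r rAB; apply: (@continuous_comp _ _ _ h (fun y : R => y `^ q)); first exact: ch.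
  exact: is_derive_continuous (is_derive1_powR q (h0 r rAB)).
pose f1 r := `|v r| `^ p * dg r.
pose f2 r := p `^ p * (`|dv r| `^ p * (g r `^ p / dg r `^ (p - 1))).
have cf1 : {within `[A, B], continuous f1}.
  by apply: cI => r rAB; apply: cvgM; [exact: cvp|exact: cdg].
have cf2 : {within `[A, B], continuous f2}.
  apply: cI => r rAB; apply: cvgM; first exact: cvg_cst.
  apply: cvgM.
    by apply: (@continuous_comp _ _ _ dv (fun y : R => `|y| `^ p)); [exact: cdv|exact: continuous_normpow].
  apply: cvgM; first exact: cpw.
  rewrite /=; apply: cvgV; first by rewrite gt_eqF// powR_gt0// dg0.
  exact: cpw.
have cdD0 r : A <= r <= B -> {for r, continuous dD}.
  move=> rAB; apply: cvgD; first by apply: cvgM; [exact: cdg|exact: cvp].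
  apply: cvgM; first exact: cvg_cst.
  apply: cvgM; first exact: cg.
  apply: cvgM; last exact: cdv.
  apply: cvgM; first exact: cvg_cst.
  by apply: (@continuous_comp _ _ _ v (spow (p - 1))); [exact: cv|apply: continuous_spow; rewrite subr_gt0].
have cdD := cI _ cdD0.
have intI (f : R -> R) : {within `[A, B], continuous f} -> lebesgue_measure.-integrable `[A, B] (EFin \o f).
  by move=> cf; apply: continuous_compact_integrable => //; exact: segment_compact.
have FTC : (\int[lebesgue_measure]_(x in `[A, B]) (dD x)%:E = (D B)%:E - (D A)%:E)%E.
  apply: continuous_FTC2 => //.
    split => [r rAB||].
    + have /DD rD : A <= r <= B by move: rAB; rewrite in_itv /= => /andP[/ltW -> /ltW ->].
      by case: rD.
    + apply: cvg_at_right_filter; have /DD rD : A <= A <= B by rewrite lexx ltW.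
      exact: is_derive_continuous rD.
    + apply: cvg_at_left_filter; have /DD rD : A <= B <= B by rewrite lexx ltW.
      exact: is_derive_continuous rD.
  move=> r rAB; have /DD rD : A <= r <= B by move: rAB; rewrite in_itv /= => /andP[/ltW -> /ltW ->].
  by rewrite derive1E; case: rD.
have key r : A <= r <= B -> f1 r <= f2 r + p * dD r.
  move=> rAB; have gr := g0 r rAB; have dgr := dg0 r rAB.
  (* The powers of [dg] are distributed so that X^p = f1 and Y^p = f2. Young's inequality then reads
     p^2 T <= (p - 1) f1 + f2, with T the absolute mixed term, and p dD >= p f1 - p^2 T gives the
     claim. *)
  pose X := `|v r| * dg r `^ (p^-1).
  pose Y := p * `|dv r| * g r / dg r `^ ((p - 1) / p).
  have X0 : 0 <= X by rewrite mulr_ge0 ?powR_ge0.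
  have Y0 : 0 <= Y by apply: divr_ge0 (powR_ge0 _ _); apply: mulr_ge0 (ltW gr); exact: mulr_ge0 (ltW p0) (normr_ge0 _).
  have XE : X `^ p = f1 r.
    by rewrite /X powRM ?powR_ge0// -powRrM mulVf ?gt_eqF// powRr1// ltW.
  have YE : Y `^ p = f2 r.
    have c1 : 0 <= p * `|dv r| := mulr_ge0 (ltW p0) (normr_ge0 _).
    have c2 : 0 <= p * `|dv r| * g r := mulr_ge0 c1 (ltW gr).
    rewrite /Y /f2 -powRN (powRM _ c2 (powR_ge0 _ _)) (powRM _ c1 (ltW gr)) (powRM _ (ltW p0) (normr_ge0 _)).
    by rewrite -powRrM mulNr divfK ?gt_eqF// powRN !mulrA.
  have XY : p * (X `^ (p - 1) * Y) = p ^+ 2 * (`|v r| `^ (p - 1) * g r * `|dv r|).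
    rewrite /X powRM ?powR_ge0// -powRrM [p^-1 * _]mulrC.
    have dgn : dg r `^ ((p - 1) / p) != 0 by rewrite gt_eqF// powR_gt0.
    by rewrite /Y; field.
  have := young_pow p1 X0 Y0; rewrite XY XE YE.
  set T := `|v r| `^ (p - 1) * g r * `|dv r| => H.
  pose E := s * (g r * (p * spow (p - 1) (v r) * dv r)).
  have HE : - (p * E) <= p ^+ 2 * T.
    rewrite -mulrN expr2 -mulrA ler_pM2l//.
    apply: le_trans (ler_norm _) _; rewrite normrN !normrM spow_norm (gtr0_norm gr) (gtr0_norm p0).
    have -> : `|s| = 1 by apply/eqP; rewrite -sqrp_eq1 ?normr_ge0// real_normK ?num_real// s2.
    by rewrite le_eqVlt /T; apply/orP; left; apply/eqP; ring.
  rewrite /dD -/E mulrDr (mulrC (dg r)) -/(f1 r); lra.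
have ipD : lebesgue_measure.-integrable `[A, B] (EFin \o (fun r => p * dD r)).
  by apply: intI; apply: cI => r rAB; apply: cvgM; [exact: cvg_cst|exact: cdD0].
apply: (@le_trans _ _ (\int[lebesgue_measure]_(r in `[A, B]) ((f2 r)%:E + (p * dD r)%:E))%E).
  apply: le_integral => //; first exact: intI.
    by apply: integrableD => //; exact: intI.
  by move=> r; rewrite inE /= in_itv /= => rAB; rewrite -EFinD lee_fin; exact: key.
rewrite integralD//; last exact: intI.
rewrite -[leRHS]adde0; apply: leeD => //.
rewrite (_ : \int[_]_(x in _) _ = p%:E * \int[lebesgue_measure]_(x in `[A, B]) (dD x)%:E)%E; last first.
  rewrite -integralZl//; last exact: intI.
rewrite FTC -EFinB -EFinM lee_fin /D -mulrBr pmulr_rle0//.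
Qed.

(** Fatou's lemma for the truncations of [f] to [a j, b j]. Points never reached by the intervals
    are allowed where [f] vanishes, so that an endpoint may stay fixed. *)
Lemma exhaust_integral_le (f : R -> \bar R) (a b : nat -> R) (K : \bar R) :
  measurable_fun setT f -> (forall x, 0 <= f x)%E ->
  (forall x, f x = 0%E \/ \forall j \near \oo, a j <= x <= b j) ->
  (\forall j \near \oo, (\int[@lebesgue_measure R]_(x in `[a j, b j]) f x <= K)%E) ->
  (\int[@lebesgue_measure R]_x f x <= K)%E.
Proof.
move=> mf f0 hf hK.
pose g j x := (f x * (\1_(`[a j, b j]%classic) x)%:E)%E.
have mg j : measurable_fun setT (g j).
  apply: emeasurable_funM => //; apply/measurable_EFinP; apply: measurable_indic; exact: measurable_itv.
have g0 j x : (0 <= g j x)%E by rewrite mule_ge0// lee_fin.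
have fl x : limn_einf (g ^~ x) = f x.
  apply: (@cvg_limn_einf_sup _ (g ^~ x) (f x) _).1; apply: cvg_near_cst; have [f00|H] := hf x.
    by near=> j; rewrite /g f00 mul0e.
  near=> j; rewrite /g indicE mem_set ?mule1//= in_itv /=; near: j; exact: H.
have -> : (\int[lebesgue_measure]_x f x = \int[lebesgue_measure]_x limn_einf (g ^~ x))%E.
  by apply: eq_integral => x _; rewrite fl.
apply: (le_trans (@fatou _ (measurableTypeR R) R lebesgue_measure setT measurableT g mg (fun j x _ => g0 j x))).
rewrite limn_einf_lim; apply: lime_le; first exact: is_cvg_einfs.
near=> j; apply: (@le_trans _ _ (\int[lebesgue_measure]_x g j x)%E).
  by apply: ereal_inf_lbound; exists j => //=.
rewrite (_ : \int[_]_x _ = \int[lebesgue_measure]_(x in `[a j, b j]) f x)%E; first by near: j.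
rewrite [RHS]integral_mkcond; apply: eq_integral => x _.
by rewrite /g indicE patchE; case: ifP; rewrite ?mule1 ?mule0.
Unshelve. all: by end_near. Qed.
End OneDim.

(** * First-order expansion, chain rule along curves, Cauchy-Schwarz *)

Section Chain.
Variable R : realType.

Lemma is_derive_line (V : normedModType R) (f : V -> R) (x v : V) (s : R) :
  derivable f (x + s *: v) v -> is_derive s 1 (fun u : R => f (x + u *: v)) ('D_v f (x + s *: v)).
Proof.
have E : (fun h : R => h^-1 *: (f (x + (h *: (1 : R) + s) *: v) - f (x + s *: v))) =
   (fun h : R => h^-1 *: (f (h *: v + (x + s *: v)) - f (x + s *: v))).
  apply/funext => h; congr (_ *: (f _ - _)).
  by rewrite [h *: (1 : R)]mulr1 scalerDl addrCA.
by move=> D; split; rewrite /derivable /derive /= E.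
Qed.

Lemma is_derive_lineP (V : normedModType R) (f : V -> R) (x v : V) (d : R) :
  is_derive x v f d <-> is_derive (0 : R) 1 (fun u : R => f (x + u *: v)) d.
Proof.
have E : (fun h : R => h^-1 *: (f (x + (h *: (1 : R) + 0) *: v) - f (x + (0 : R) *: v))) =
   (fun h : R => h^-1 *: (f (h *: v + x) - f x)).
  apply/funext => h; rewrite scale0r addr0; congr (_ *: (f _ - _)).
    by rewrite [h *: (1 : R)]mulr1 addrC.
  by rewrite addr0.
split => -[D1 D2]; split; move: D1 D2; rewrite /derivable /derive /=.
- by rewrite E.
- by rewrite E.
- by rewrite -E.
- by rewrite -E.
Qed.

Lemma mvt_line (V : normedModType R) (f : V -> R) (x v : V) (c : R) :
  (forall y, derivable f y v) ->
  exists2 th : R, `|th| <= `|c| & f (x + c *: v) - f x = c * 'D_v f (x + th *: v).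
Proof.
move=> Df; pose F (s : R) := f (x + s *: v).
have DF (s : R) : is_derive s 1 F ('D_v f (x + s *: v)) by exact: is_derive_line.
have F0 : F 0 = f x by rewrite /F scale0r addr0.
have cF (a b : R) : {within `[a, b], continuous F}.
  by apply: continuous_subspaceT => y; exact: is_derive_continuous (DF y).
have [c0|c0] := leP 0 c.
  have [th + E] := MVT_segment c0 (fun s _ => DF s) (cF 0 c).
  rewrite in_itv /= => /andP[t0 tc]; exists th; first by rewrite !ger0_norm.
  by rewrite -F0 -/(F c) E subr0 mulrC.
have [th + E] := MVT_segment (ltW c0) (fun s _ => DF s) (cF c 0).
rewrite in_itv /= => /andP[ct t0]; exists th.
  by rewrite (ltr0_norm c0) ler0_norm// lerN2.
by rewrite -F0 -/(F c) -opprB E sub0r mulrN opprK mulrC.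
Qed.

Lemma cvg_sumr (T I : Type) (F : set_system T) {FF : Filter F} (s : seq I) (f : I -> T -> R) (l : I -> R) :
  (forall i, f i @ F --> l i) -> (fun x => \sum_(i <- s) f i x) @ F --> \sum_(i <- s) l i.
Proof.
move=> fl; elim: s => [|i s IH].
  by rewrite big_nil; under eq_fun do rewrite big_nil; exact: cvg_cst.
by rewrite big_cons; under eq_fun do rewrite big_cons; exact: cvgD.
Qed.

(** [smooth] provides only continuous partial derivatives, while the dilation orbits are curves in
    no coordinate direction. Changing one coordinate at a time and applying the mean value theorem
    to each change yields the total expansion that the chain rule needs. *)
Lemma C1_expand m (f : 'rV[R]_m -> R) (x : 'rV[R]_m) (e : R) :
  (forall (i : 'I_m) y, derivable f y (delta_mx 0 i)) ->
  (forall i : 'I_m, {for x, continuous (fun y => 'D_(delta_mx 0 i) f y)}) -> 0 < e ->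
  exists2 d : R, 0 < d & forall h : 'rV[R]_m, `|h| < d ->
    `|f (x + h) - f x - \sum_i h ord0 i * 'D_(delta_mx 0 i) f x| <= e * \sum_i `|h ord0 i|.
Proof.
move=> Df cf e0.
have [d d0 Hd] : exists2 d : R, 0 < d & forall y (i : 'I_m), `|y - x| < d ->
    `|'D_(delta_mx 0 i) f y - 'D_(delta_mx 0 i) f x| <= e.
  have : \forall y \near x, forall i : 'I_m, `|'D_(delta_mx 0 i) f x - 'D_(delta_mx 0 i) f y| <= e.
      by apply: (@filter_forall _ 'I_m (fun i y => _ <= e) (nbhs x)) => i; have /cvgrPdist_le/(_ e e0) := cf i.
  move=> /nbhs_ballP [d /= d0 Hd]; exists d => // y i yx; rewrite distrC; apply: Hd.
  by rewrite -ball_normE /= distrC.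
exists d => // h hd.
(* [hl l] keeps the first l coordinates of [h], so that x + hl l runs through a path of
   axis-parallel segments from x to x + h. *)
pose hl l : 'rV[R]_m := \row_i (if (i < l)%N then h ord0 i else 0).
have step l : (l <= m)%N ->
    `|f (x + hl l) - f x - \sum_(i < m | (i < l)%N) h ord0 i * 'D_(delta_mx 0 i) f x| <= e * \sum_(i < m | (i < l)%N) `|h ord0 i|.
  elim: l => [_|l IH lm].
    have -> : hl 0 = 0 by apply/rowP => i; rewrite !mxE.
    by rewrite addr0 subrr !big1// subrr normr0 mulr0.
  pose o := Ordinal lm.
  have sumS (G : 'I_m -> R) : \sum_(i < m | (i < l.+1)%N) G i = \sum_(i < m | (i < l)%N) G i + G o.
    rewrite (bigD1 o) ?ltnSn//= addrC; congr (_ + _); apply: eq_bigl => i.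
    by rewrite ltnS -val_eqE /= [RHS]ltn_neqAle andbC.
  have hS : hl l.+1 = hl l + h ord0 o *: delta_mx 0 o.
    apply/rowP => i; rewrite !mxE eqxx /= -val_eqE /= ltnS leq_eqVlt.
    by case: eqP => [il|il] /=; rewrite ?il ?ltnn ?mulr1 ?add0r ?mulr0 ?addr0//; congr (h _ _); apply: val_inj.
  have [th th1 thE] := @mvt_line _ f (x + hl l) (delta_mx 0 o) (h ord0 o) (Df o).
  have small : `|'D_(delta_mx 0 o) f (x + hl l + th *: delta_mx 0 o) - 'D_(delta_mx 0 o) f x| <= e.
    apply: Hd; apply: le_lt_trans hd; rewrite -[x + _ + _]addrA [_ - x]addrC addKr.
    apply: rV_norm_le => // i; rewrite !mxE eqxx /= -val_eqE /=.
    case: ltnP => il; first by rewrite ltn_eqF// mulr0 addr0; exact: coord_le_norm.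
    case: eqP => [eil|_]; rewrite ?mulr0 ?add0r ?normr0// mulr1.
    by apply: le_trans th1 _; exact: coord_le_norm.
  rewrite !sumS hS addrA.
  have -> : f (x + hl l + h ord0 o *: delta_mx 0 o) = f (x + hl l) + h ord0 o * 'D_(delta_mx 0 o) f (x + hl l + th *: delta_mx 0 o).
    by rewrite -thE [RHS]addrC subrK.
  set S := \sum_(i < m | _) _ * _; set D1 := 'D_ _ f _; set D0 := 'D_ _ f x.
  rewrite (_ : _ - _ = (f (x + hl l) - f x - S) + h ord0 o * (D1 - D0)); last by ring.
  rewrite [leRHS]mulrDr; apply: le_trans (ler_normD _ _) _; apply: lerD; first exact: IH (ltnW lm).
  by rewrite normrM mulrC ler_wpM2r.
have := step m (leqnn m).
have -> : hl m = h by apply/rowP => i; rewrite mxE ltn_ord.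
have sumT (G : 'I_m -> R) : \sum_(i < m | (i < m)%N) G i = \sum_i G i.
  by apply: eq_bigl => i; rewrite ltn_ord.
by rewrite !sumT.
Qed.

Lemma is_derive_curve m (f : 'rV[R]_m -> R) (c : 'I_m -> R -> R) (dc : 'I_m -> R) (r : R) :
  (forall (i : 'I_m) y, derivable f y (delta_mx 0 i)) ->
  (forall i : 'I_m, continuous (fun y => 'D_(delta_mx 0 i) f y)) ->
  (forall i, is_derive r 1 (c i) (dc i)) ->
  is_derive r 1 (fun s => f (\row_i c i s)) (\sum_i dc i * 'D_(delta_mx 0 i) f (\row_i c i r)).
Proof.
move=> Df cf Dc; set x := \row_i c i r; set S := \sum_i _.
pose q i (h : R) := h^-1 * (c i (h + r) - c i r).
have qE i : (fun h : R => h^-1 *: (c i (h *: (1 : R) + r) - c i r)) = q i.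
  by apply/funext => h; rewrite [h *: (1 : R)]mulr1.
have qc i : q i @ 0^' --> dc i.
  by have [D1 D2] := Dc i; move: D1 D2; rewrite /derivable /derive /= qE => D1 <-.
have cc i : (fun h : R => c i (h + r)) @ 0^' --> c i r.
  apply: cvg_within_filter; apply: (@cvg_comp _ _ _ (fun h : R => h + r) (c i) _ (nbhs r)).
    suff : (fun h : R => h + r) @ nbhs (0 : R) --> 0 + r by rewrite add0r.
    by apply: cvgD; [exact: cvg_id|exact: cvg_cst].
  exact: is_derive_continuous (Dc i).
have H : (fun h : R => h^-1 *: (f (\row_i c i (h *: (1 : R) + r)) - f x)) @ 0^' --> S.
  apply/cvgrPdist_le => e e0.
  pose M := \sum_i `|dc i|.
  have M0 : 0 <= M by rewrite sumr_ge0.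
  have e20 : 0 < e / 2 by rewrite divr_gt0.
  (* The error of the expansion gets multiplied by the sum of the |q i h|, which is eventually below
     M + 1; the other half of e is kept for the convergence of the difference quotients. *)
  have e'0 : 0 < e / 2 / (M + 1) by rewrite divr_gt0// ltr_wpDl.
  have [d d0 Hd] := C1_expand Df (fun i => cf i x) e'0.
  have c1 : (fun h => \sum_i q i h * 'D_(delta_mx 0 i) f x) @ 0^' --> S.
    by apply: cvg_sumr => i; apply: cvgM; [exact: qc|exact: cvg_cst].
  have c2 : (fun h => \sum_i `|q i h|) @ 0^' --> M.
    by apply: cvg_sumr => i; apply: cvg_norm; exact: qc.
  have H3 : \forall h \near 0^', forall j, `|c j r - c j (h + r)| <= d / 2.
    apply: (@filter_forall _ 'I_m (fun i h => _ <= d / 2) 0^') => j.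
    by have /cvgrPdist_le := cc j; apply; lra.
  near=> h.
  have Hj j : `|c j r - c j (h + r)| <= d / 2 by move: j; near: h; exact: H3.
  have h0 : h != 0 by near: h; exact: nbhs_dnbhs_neq.
  have n1 : `|S - \sum_i q i h * 'D_(delta_mx 0 i) f x| <= e / 2.
    by near: h; move/cvgrPdist_le: c1; exact.
  have n2 : \sum_i `|q i h| <= M + 1.
    have : `|M - \sum_i `|q i h| | <= 1 by near: h; move/cvgrPdist_le: c2; exact.
    by rewrite ler_norml => /andP[]; lra.
  pose Hh : 'rV[R]_m := \row_i (c i (h + r) - c i r).
  have n3 : `|Hh| < d.
    apply: (@le_lt_trans _ _ (d / 2)); last by lra.
    apply: rV_norm_le => [|i]; first by lra.
    rewrite mxE distrC; exact: Hj.
  have xE : \row_i c i (h *: (1 : R) + r) = x + Hh.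
    by apply/rowP => i; rewrite !mxE [h *: (1 : R)]mulr1 addrC subrK.
  have HhE i : Hh ord0 i = h * q i h by rewrite mxE /q mulrA divff// mul1r.
  have := Hd Hh n3; rewrite -xE.
  under eq_bigr do rewrite HhE -mulrA.
  rewrite -mulr_sumr; under [X in _ <= _ * X]eq_bigr do rewrite HhE normrM.
  rewrite -mulr_sumr => K.
  set A := f _ - f x in K *; set B := \sum_i _ * _ in K n1.
  have K' : `|h^-1 * A - B| <= e / 2.
    rewrite -(ler_pM2l (_ : 0 < `|h|)) ?normr_gt0// -normrM mulrBr mulrA divff// mul1r.
    apply: le_trans K _; rewrite mulrCA; apply: ler_wpM2l => //.
    rewrite -[leRHS](divfK (lt0r_neq0 (_ : 0 < M + 1))) ?ltr_wpDl//.
    by apply: ler_wpM2l; [exact: ltW|exact: n2].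
  rewrite [h^-1 *: A](_ : _ = h^-1 * A)//.
  rewrite (_ : S - _ = (S - B) - (h^-1 * A - B)); last by ring.
  by apply: le_trans (ler_normB _ _) _; lra.
split; first exact: cvgP H.
exact: cvg_lim H.
Unshelve. all: by end_near. Qed.

Lemma Cauchy_Schwarz_sum (I : finType) (a b : I -> R) :
  (\sum_i a i * b i) ^+ 2 <= (\sum_i a i ^+ 2) * (\sum_i b i ^+ 2).
Proof.
set C := \sum_i a i * b i; set A := \sum_i a i ^+ 2; set B := \sum_i b i ^+ 2.
have A0 : 0 <= A by rewrite sumr_ge0// => i _; rewrite sqr_ge0.
have [/eqP A00|An0] := eqVneq A 0.
  have az i : a i = 0.
    apply/eqP; rewrite -sqrf_eq0; move: A00; rewrite psumr_eq0//.
      by move=> /allP/(_ i); rewrite mem_index_enum => /(_ isT).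
    by move=> j _; rewrite sqr_ge0.
  rewrite /C big1 => [|i _]; last by rewrite az mul0r.
  by rewrite expr0n/= mulr_ge0// sumr_ge0// => i _; rewrite sqr_ge0.
have Ap : 0 < A by rewrite lt_neqAle eq_sym An0.
have : 0 <= \sum_i (A * b i - C * a i) ^+ 2 by rewrite sumr_ge0// => i _; rewrite sqr_ge0.
rewrite (_ : \sum_i _ = A * (A * B - C ^+ 2)).
  by rewrite pmulr_rge0// subr_ge0.
transitivity (\sum_i (A ^+ 2 * b i ^+ 2 - (A * C * 2) * (a i * b i) + C ^+ 2 * a i ^+ 2)).
  by apply: eq_bigr => i _; ring.
rewrite big_split sumrB /= -!mulr_sumr -/A -/B -/C; ring.
Qed.
End Chain.

(** * Hardy inequalities for test functions and their limits *)

Section HardyTest.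
Variables (R : realType) (n k : nat) (gamma : R).
Hypothesis (n1 : (1 <= n)%N) (gamma0 : 0 <= gamma).
Local Notation pt := 'rV[R]_(n + k).
Local Notation X xi := (eunorm (@xpart R n k xi)).
Local Notation rho := (@hnorm R n k gamma).
Local Notation dil := (@dil R n k gamma).
Local Notation wt := (@wt R n gamma).
Local Notation Q := (Qdim n k gamma).

Let g1 : 0 < 1 + gamma. Proof. by rewrite ltr_pwDl. Qed.

Definition Zd (f : pt -> R) (xi : pt) : R := \sum_(i < n + k) wt i * xi ord0 i * partial i f xi.

Definition gradsq (f : pt -> R) (xi : pt) : R :=
  \sum_(i < n) (partial (lshift k i) f xi) ^+ 2
   + (X xi `^ gamma) ^+ 2 * \sum_(j < k) (partial (rshift n j) f xi) ^+ 2.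

Lemma gradsq_ge0 f xi : 0 <= gradsq f xi.
Proof.
rewrite addr_ge0//; first by rewrite sumr_ge0// => i _; rewrite sqr_ge0.
by rewrite mulr_ge0 ?sqr_ge0// sumr_ge0// => i _; rewrite sqr_ge0.
Qed.

Lemma Zd_le (f : pt -> R) (xi : pt) :
  (X xi `^ gamma * Zd f xi) ^+ 2 <= gradsq f xi * hP gamma xi.
Proof.
(* The factor |x|^gamma goes to the coordinates in the x-block and to the derivatives in the
   y-block. Then the squares of [b] sum to |grad_gamma f|^2 and those of [a] to |x|^(2 + 2 gamma) +
   (1 + gamma)^2 |y|^2 = [hP], with no loss. *)
pose a (i : 'I_(n + k)) := match fintype.split i with
  | inl i' => X xi `^ gamma * xi ord0 i | inr j => (1 + gamma) * xi ord0 i end.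
pose b (i : 'I_(n + k)) := match fintype.split i with
  | inl i' => partial i f xi | inr j => X xi `^ gamma * partial i f xi end.
have -> : X xi `^ gamma * Zd f xi = \sum_i a i * b i.
  rewrite /Zd mulr_sumr; apply: eq_bigr => i _; rewrite /a /b.
  case: (splitP i) => j ij; rewrite /wt ij ?ltn_ord; first by ring.
  by rewrite ltnNge leq_addr /=; ring.
apply: le_trans (Cauchy_Schwarz_sum a b) _; rewrite mulrC le_eqVlt; apply/orP; left; apply/eqP.
congr (_ * _).
  rewrite big_split_ord /= /gradsq; congr (_ + _).
    by apply: eq_bigr => i _; rewrite /b (unsplitK (inl i)).
  by rewrite mulr_sumr; apply: eq_bigr => j _; rewrite /b (unsplitK (inr j)) exprMn.
rewrite big_split_ord /= /hP; congr (_ + _).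
  under eq_bigr do rewrite /a (unsplitK (inl _)) exprMn.
  rewrite -mulr_sumr -[LHS]/(_ * _) (_ : \sum_(i < n) _ = X xi ^+ 2); last first.
    by rewrite sqr_eunorm; apply: eq_bigr => i _; rewrite mxE.
  rewrite -(powR_mulrn 2 (eunorm_ge0 _)) -(powR_mulrn 2 (powR_ge0 _ _)) -powRrM -powRD; last first.
    by rewrite (_ : (_ == 0) = false)//; apply/negbTE; rewrite gt_eqF//; move: gamma0; lra.
  by congr (_ `^ _); ring.
under eq_bigr do rewrite /a (unsplitK (inr _)) exprMn.
by rewrite -mulr_sumr sqr_eunorm; congr (_ * _); apply: eq_bigr => i _; rewrite mxE.
Qed.

Lemma sqr_powR (a p : R) : (a ^+ 2) `^ (p / 2) = `|a| `^ p.
Proof.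
rewrite -(real_normK (num_real a)) -(powR_mulrn 2 (normr_ge0 _)) -powRrM.
by congr (_ `^ _); field.
Qed.

Lemma psip_Zd_le p (f : pt -> R) (xi : pt) : 0 < p -> 0 < rho xi ->
  `|Zd f xi| `^ p * psip gamma p xi <= grad_gamma_p gamma p f xi * rho xi `^ p.
Proof.
move=> p0 r0; have rp : 0 < rho xi `^ (gamma * p) by rewrite powR_gt0.
rewrite /psip mulrA ler_pdivrMr//.
have p20 : 0 <= p / 2 by rewrite divr_ge0 ?ltW.
have := ge0_ler_powR p20 _ _ (Zd_le f xi).
rewrite !nnegrE sqr_ge0 mulr_ge0 ?gradsq_ge0 ?hP_ge0// => /(_ isT isT).
rewrite powRM ?gradsq_ge0 ?hP_ge0// -/(grad_gamma_p gamma p f xi) -(hnorm_powR_kap gamma0).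
move: r0 rp; generalize (rho xi) => r r0 rp.
rewrite sqr_powR normrM (ger0_norm (powR_ge0 _ _)) (powRM _ (powR_ge0 _ _) (normr_ge0 _)) -!powRrM.
rewrite mulrC; move=> /le_trans; apply.
rewrite -mulrA -powRD ?(lt0r_neq0 r0) ?implybT//.
by rewrite (_ : (2 + 2 * gamma) * (p / 2) = p + gamma * p)//; field.
Qed.

Lemma smooth_derivable (f : pt -> R) i xi : smooth f -> derivable f xi (delta_mx 0 i).
Proof. by move=> /(_ [::]) [_]; exact. Qed.

Lemma smooth_continuous (f : pt -> R) : smooth f -> continuous f.
Proof. by move=> /(_ [::]) []. Qed.

Lemma smooth_partial_continuous (f : pt -> R) i : smooth f -> continuous (partial i f).
Proof. by move=> /(_ [:: i]) []. Qed.

Lemma is_derive_dil (f : pt -> R) xi (r : R) : smooth f ->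
  is_derive r 1 (fun s : R => f (dil s xi)) (Zd f (dil r xi)).
Proof.
move=> sf.
have Dc (i : 'I_(n + k)) : is_derive r 1 (fun s : R => expR (wt i * s) * xi ord0 i) (wt i * (dil r xi) ord0 i).
  have H : is_derive r 1 (fun s : R => wt i * s) (wt i).
    have := is_deriveZ (wt i) (is_derive_id r (1 : R)).
    by rewrite [wt i *: (1 : R)]mulr1.
  have H2 := is_derive1_comp (is_derive_expR (wt i * r)) H.
  have := is_deriveZ (xi ord0 i) H2.
  rewrite (_ : (fun s : R => expR (wt i * s) * xi ord0 i) = xi ord0 i \*: (expR \o *%R (wt i))); last first.
    by apply/funext => s /=; rewrite [LHS]mulrC.
  by rewrite (_ : _ *: _ = wt i * (dil r xi) ord0 i)// /GRing.scale /= mxE; ring.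
have := is_derive_curve (fun i y => @smooth_derivable f i y sf) (fun i => @smooth_partial_continuous f i sf) Dc.
by [].
Qed.

Lemma continuous_dil xi : continuous (fun r => dil r xi).
Proof.
move=> r; apply/cvgrPdist_le => e e0.
have H : \forall s \near r, forall i : 'I_(n + k), `|expR (wt i * r) * xi ord0 i - expR (wt i * s) * xi ord0 i| <= e.
  apply: (@filter_forall _ 'I_(n + k) (fun i h => _ <= e) (nbhs r)) => i.
  have : {for r, continuous (fun s : R => expR (wt i * s) * xi ord0 i)}.
    apply: cvgM; last exact: cvg_cst.
    apply: (@continuous_comp _ _ _ (fun s : R => wt i * s) expR); last exact: continuous_expR.
    by apply: cvgM; [exact: cvg_cst|exact: cvg_id].
  by move=> /cvgrPdist_le/(_ e e0).
near=> s; apply: rV_norm_le => [|i]; first exact: ltW.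
by rewrite !mxE; move: i; near: s; exact: H.
Unshelve. all: by end_near. Qed.

Lemma continuous_Zd_dil (f : pt -> R) xi : smooth f -> continuous (fun r => Zd f (dil r xi)).
Proof.
move=> sf r; apply: cvg_sumr => i; apply: cvgM.
  apply: cvgM; first exact: cvg_cst.
  apply: (@continuous_comp _ _ _ (fun r => dil r xi) (fun y : pt => y ord0 i)); first exact: continuous_dil.
  exact: coord_continuous.
apply: (@continuous_comp _ _ _ (fun r => dil r xi) (partial i f)); first exact: continuous_dil.
exact: smooth_partial_continuous.
Qed.

Lemma measurable_grad (f : pt -> R) p : smooth f ->
  measurable_fun setT (fun t : Tm R (n + k) => grad_gamma_p gamma p f (emb t)).
Proof.
move=> sf; apply: (measurableT_comp (measurable_powR _)); apply: measurable_funD.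
  rewrite (_ : (fun t => _) = (fun t : Tm R (n + k) => \sum_(i < n) (fun i t => partial (lshift k i) f (emb t) ^+ 2) i t)) //.
  apply: measurable_sum => i; apply: measurable_funX; apply: measurable_continuous.
  exact: smooth_partial_continuous.
apply: measurable_funM.
  apply: measurable_funX; exact: (measurableT_comp (measurable_powR _) (@measurable_X R n k)).
rewrite (_ : (fun t => _) = (fun t : Tm R (n + k) => \sum_(j < k) (fun j t => partial (rshift n j) f (emb t) ^+ 2) j t)) //.
apply: measurable_sum => i; apply: measurable_funX; apply: measurable_continuous.
exact: smooth_partial_continuous.
Qed.

(** [psip] is constant on orbits and factors out. By [psip_Zd_le] the gradient controls |Z f|^p psip
    only after multiplication by rho^p = e^(p r), which accounts for the exponent Q - p on the
    right. *)
Lemma hardy_radial p (f : pt -> R) (W1 W2 : R -> R) : 0 < p -> smooth f ->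
  measurable_fun setT W1 -> measurable_fun setT W2 ->
  (forall r, 0 <= W1 r) -> (forall r, 0 <= W2 r) ->
  (forall xi, X xi != 0 -> rho xi = 1 ->
    (\int[leb R]_r (`|f (dil r xi)| `^ p * (expR (Q * r) * W2 r))%:E <=
     \int[leb R]_r (`|Zd f (dil r xi)| `^ p * (expR ((Q - p) * r) * W1 r))%:E)%E) ->
  (iint (fun xi => (`|f xi| `^ p * psip gamma p xi * W2 (ln (rho xi)))%:E) <=
   iint (fun xi => (grad_gamma_p gamma p f xi * W1 (ln (rho xi)))%:E))%E.
Proof.
move=> p0 sf mW1 mW2 W10 W20 H.
have mf : measurable_fun setT (fun t : Tm R (n + k) => f (emb t)).
  by apply: measurable_continuous; exact: smooth_continuous.
have mpow (T : measurableType default_measure_display) (g : T -> R) : measurable_fun setT g -> measurable_fun setT (fun t => `|g t| `^ p).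
  by move=> mg; apply: (measurableT_comp (measurable_powR _)); exact: measurableT_comp mg.
apply: (polar_le n1 gamma0).
- apply/measurable_EFinP; apply: measurable_funM.
    apply: measurable_funM; last exact: measurable_psip.
    by apply: (measurableT_comp (measurable_powR _)); exact: measurableT_comp mf.
  exact: (measurableT_comp mW2 (@measurable_lnrho R n k gamma)).
- apply/measurable_EFinP; apply: measurable_funM; first exact: measurable_grad.
  exact: (measurableT_comp mW1 (@measurable_lnrho R n k gamma)).
- by move=> xi; rewrite lee_fin; apply: mulr_ge0 => //; apply: mulr_ge0; [exact: powR_ge0|exact: psip_ge0].
- by move=> xi; rewrite lee_fin; apply: mulr_ge0 => //; exact: powR_ge0.
move=> xi X0 r1.
have lr r : ln (rho (dil r xi)) = r by rewrite hnorm_dil// r1 mulr1 expRK.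
have cfd : continuous (fun r => f (dil r xi)).
  by move=> r; apply: (@continuous_comp _ _ _ (fun r => dil r xi) f); [exact: continuous_dil|exact: smooth_continuous].
have mexp (c : R) : measurable_fun setT (fun r : R => expR (c * r)).
  by apply: measurableT_comp => //; exact: measurable_funM.
apply: (@le_trans _ _ ((psip gamma p xi)%:E * \int[leb R]_r (`|f (dil r xi)| `^ p * (expR (Q * r) * W2 r))%:E)%E).
  rewrite -ge0_integralZl; last 4 first.
  - exact: measurableT.
  - apply/measurable_EFinP; apply: measurable_funM; last by apply: measurable_funM; [exact: mexp|].
    apply: (measurableT_comp (measurable_powR _)); apply: measurableT_comp => //.
    exact: continuous_measurable_fun.
  - by move=> r _; rewrite lee_fin !mulr_ge0 ?powR_ge0 ?expR_ge0.
  - by rewrite lee_fin psip_ge0.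
  rewrite le_eqVlt; apply/orP; left; apply/eqP; apply: eq_integral => r _.
  by rewrite lr psip_dil// -!EFinM; congr EFin; ring.
apply: le_trans (lee_wpmul2l _ (H xi X0 r1)) _; first by rewrite lee_fin psip_ge0.
rewrite -ge0_integralZl; last 4 first.
- exact: measurableT.
- apply/measurable_EFinP; apply: measurable_funM; last by apply: measurable_funM; [exact: mexp|].
  apply: (measurableT_comp (measurable_powR _)); apply: measurableT_comp => //.
  by apply: continuous_measurable_fun; exact: continuous_Zd_dil.
- by move=> r _; rewrite lee_fin !mulr_ge0 ?powR_ge0 ?expR_ge0.
- by rewrite lee_fin psip_ge0.
apply: ge0_le_integralT => r.
  rewrite -EFinM lee_fin; apply: mulr_ge0; first exact: psip_ge0.
  by rewrite !mulr_ge0 ?powR_ge0 ?expR_ge0.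
rewrite lr -!EFinM lee_fin.
have r0 : 0 < rho (dil r xi) by rewrite hnorm_dil// r1 mulr1 expR_gt0.
have := psip_Zd_le f p0 r0; rewrite psip_dil// hnorm_dil// r1 mulr1 expR_powR => K.
have := ler_wpM2r (mulr_ge0 (expR_ge0 ((Q - p) * r)) (W10 r)) K.
rewrite (_ : Q * r = r * p + (Q - p) * r); last by ring.
rewrite expRD; set a := `|_| `^ p; set b := psip _ _ _; set e1 := expR ((Q - p) * r).
set g := grad_gamma_p _ _ _ _; set e2 := expR (r * p).
move: a b e1 g e2 (W1 r) => a b e1 g e2 w h.
by apply: le_trans (le_trans _ h) _; rewrite le_eqVlt; apply/orP; left; apply/eqP; ring.
Qed.
End HardyTest.

(** * Exponential and logarithmic weights on the line *)

Section Weights1D.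
Variable R : realType.

Lemma near_nat_ge (B : R) : \forall j \near \oo, B <= j%:R.
Proof.
exists (Num.trunc `|B|).+1 => // j /= hj.
apply: le_trans (ler_norm B) _; apply: ltW; apply: lt_le_trans (truncnS_gt _) _.
by rewrite ler_nat.
Qed.

(** Here g = e^(al r) / |al| and s is the sign of [al]. The function has to vanish at the end where
    the weight blows up; the boundary term at the other end has the favourable sign. For al < 0 that
    end is -oo, the image of the origin. *)
Lemma hardy1D_exp (al p : R) (v dv : R -> R) : 1 < p -> al != 0 ->
  (forall r : R, is_derive r 1 v (dv r)) -> continuous dv ->
  (0 < al -> exists B, forall r, B <= r -> v r = 0) ->
  (al < 0 -> exists B, forall r, r <= B -> v r = 0) ->
  (\int[leb R]_r (`|v r| `^ p * expR (al * r))%:E <=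
   \int[leb R]_r (`|dv r| `^ p * ((p / `|al|) `^ p * expR (al * r)))%:E)%E.
Proof.
move=> p1 al0 Dv cdv hp hn.
have p0 : 0 < p by exact: lt_trans p1.
have na : 0 < `|al| by rewrite normr_gt0.
have cv : continuous v by move=> r; exact: is_derive_continuous (Dv r).
have mexp (c : R) : measurable_fun setT (fun r : R => expR (c * r)).
  by apply: measurableT_comp => //; exact: measurable_funM.
have mpow (g : R -> R) : continuous g -> measurable_fun setT (fun t => `|g t| `^ p).
  move=> mg; apply: (measurableT_comp (measurable_powR _)); apply: measurableT_comp => //.
  exact: continuous_measurable_fun.
have mf1 : measurable_fun setT (fun r : R => (`|v r| `^ p * expR (al * r))%:E).
  by apply/measurable_EFinP; apply: measurable_funM; [exact: mpow|exact: mexp].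
have mf2 : measurable_fun setT (fun r : R => (`|dv r| `^ p * ((p / `|al|) `^ p * expR (al * r)))%:E).
  apply/measurable_EFinP; apply: measurable_funM; first exact: mpow.
  by apply: measurable_funM => //; exact: mexp.
pose s := al / `|al|.
have s2 : s ^+ 2 = 1.
  by rewrite /s expr_div_n real_normK ?num_real// divff// expf_neq0.
pose g r := expR (al * r) / `|al|.
have g0 r : 0 < g r by rewrite divr_gt0 ?expR_gt0.
have Dg (r : R) : is_derive r 1 g (s * expR (al * r)).
  have H : is_derive r 1 (fun s : R => al * s) al.
    have := is_deriveZ al (is_derive_id r (1 : R)).
    by rewrite [al *: (1 : R)]mulr1.
  have H2 := is_derive1_comp (is_derive_expR (al * r)) H.
  have := is_deriveZ (`|al|^-1) H2.
  rewrite (_ : g = `|al|^-1 \*: (expR \o *%R al)); last first.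
    by apply/funext => u; rewrite /g [LHS]mulrC.
  by rewrite (_ : s * _ = `|al|^-1 *: (expR (al * r) * al))// /GRing.scale /= /s; ring.
have main (A B : R) : A < B -> s * (g B * `|v B| `^ p - g A * `|v A| `^ p) <= 0 ->
  (\int[lebesgue_measure]_(r in `[A, B]) (`|v r| `^ p * expR (al * r))%:E <=
   \int[leb R]_r (`|dv r| `^ p * ((p / `|al|) `^ p * expR (al * r)))%:E)%E.
  move=> jj bd.
  have := @hardy_interval R p s v dv g (fun r => expR (al * r)) A B p1 jj s2
    (fun r _ => Dv r) (fun r _ => Dg r) (fun r _ => g0 r) (fun r _ => expR_gt0 _) (fun r _ => cdv r) _ bd.
  move=> H; apply: le_trans (H _) _.
    move=> r _; apply: (@continuous_comp _ _ _ (fun s : R => al * s) expR); last exact: continuous_expR.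
    by apply: cvgM; [exact: cvg_cst|exact: cvg_id].
  rewrite (_ : (fun r => _) = (fun r : R => (`|dv r| `^ p * ((p / `|al|) `^ p * expR (al * r)))%:E)); last first.
    apply/funext => r; congr EFin.
    rewrite /g (powRM _ (expR_ge0 _) (ltW _)) ?invr_gt0// expR_powR.
    rewrite (powRM _ (ltW p0) (ltW _)) ?invr_gt0// expR_powR.
    rewrite (_ : al * r * p = al * r + al * r * (p - 1)); last by ring.
    rewrite expRD; have e0 : expR (al * r * (p - 1)) != 0 by rewrite gt_eqF// expR_gt0.
    by field.
  apply: ge0_subset_integral => // r _; first by rewrite lee_fin !mulr_ge0 ?powR_ge0 ?expR_ge0.
apply: (@exhaust_integral_le R _ (fun j => - j%:R) (fun j => j%:R)) => //.
- move=> r; right; near=> j.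
  have : `|r| <= j%:R by near: j; exact: near_nat_ge.
  by rewrite ler_norml.
have [alp|aln] := ltP 0 al.
  have [B HB] := hp alp; near=> j.
  have jB : B <= j%:R by near: j; exact: near_nat_ge.
  have j1 : 1 <= (j%:R : R) by near: j; exact: near_nat_ge.
  apply: main; first by lra.
  rewrite (HB _ jB) normr0 powR0 ?gt_eqF// mulr0 sub0r mulrN oppr_le0.
  by rewrite /s gtr0_norm// divff// mul1r mulr_ge0 ?powR_ge0// ltW.
have {}aln : al < 0 by rewrite lt_neqAle al0.
have [B HB] := hn aln; near=> j.
have jB : - B <= j%:R by near: j; exact: near_nat_ge.
have j1 : 1 <= (j%:R : R) by near: j; exact: near_nat_ge.
apply: main; first by lra.
rewrite (HB (- j%:R)) ?normr0 ?powR0 ?gt_eqF// ?mulr0 ?subr0; last by lra.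
rewrite /s ltr0_norm// invrN mulrN divff// mulN1r oppr_le0.
by rewrite mulr_ge0 ?powR_ge0// ltW.
Unshelve. all: by end_near. Qed.

(** As be + 1 < 0, g = (T - r)^(be + 1) / |be + 1| is a positive increasing primitive of the weight,
    so only the right boundary term has to vanish. Stopping at B < T keeps the argument away from
    the singularity at T. *)
Lemma hardy1D_log (be T B p : R) (v dv : R -> R) : 1 < p -> be < -1 -> B < T ->
  (forall r : R, is_derive r 1 v (dv r)) -> continuous dv ->
  (forall r, B <= r -> v r = 0) ->
  (\int[leb R]_r (`|v r| `^ p * (T - r) `^ be)%:E <=
   \int[leb R]_r (`|dv r| `^ p * ((p / `|be + 1|) `^ p * (T - r) `^ (p + be)))%:E)%E.
Proof.
move=> p1 be1 BT Dv cdv v0.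
have p0 : 0 < p by exact: lt_trans p1.
have al0 : 0 < `|be + 1| by rewrite normr_gt0 lt_eqF//; lra.
have alE : `|be + 1| = - (be + 1) by rewrite ltr0_norm//; lra.
have cv : continuous v by move=> r; exact: is_derive_continuous (Dv r).
have mT (c : R) : measurable_fun setT (fun r : R => (T - r) `^ c).
  by apply: (measurableT_comp (measurable_powR _)); exact: measurable_funB.
have mpow (g : R -> R) : continuous g -> measurable_fun setT (fun t => `|g t| `^ p).
  move=> mg; apply: (measurableT_comp (measurable_powR _)); apply: measurableT_comp => //.
  exact: continuous_measurable_fun.
have mf1 : measurable_fun setT (fun r : R => (`|v r| `^ p * (T - r) `^ be)%:E).
  by apply/measurable_EFinP; apply: measurable_funM; [exact: mpow|exact: mT].
have mf2 : measurable_fun setT (fun r : R => (`|dv r| `^ p * ((p / `|be + 1|) `^ p * (T - r) `^ (p + be)))%:E).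
  apply/measurable_EFinP; apply: measurable_funM; first exact: mpow.
  by apply: measurable_funM => //; exact: mT.
pose g r := (T - r) `^ (be + 1) / `|be + 1|.
have DT (c r : R) : r < T -> is_derive r 1 (fun s : R => (T - s) `^ c) (- (c * (T - r) `^ (c - 1))).
  move=> rT.
  have H : is_derive r 1 (fun s : R => T - s) (- 1).
    have := is_deriveB (is_derive_cst T r (1 : R)) (is_derive_id r (1 : R)).
    by rewrite sub0r.
  have Tr : 0 < T - r by rewrite subr_gt0.
  have := @is_derive1_comp R (fun y => y `^ c) (fun s => T - s) r _ _ (is_derive1_powR c Tr) H.
  by rewrite mulrN1.
have Dg (r : R) : r < T -> is_derive r 1 g (1 * (T - r) `^ be).
  move=> rT; have := is_deriveZ (`|be + 1|^-1) (DT (be + 1) r rT).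
  rewrite (_ : g = `|be + 1|^-1 \*: (fun s : R => (T - s) `^ (be + 1))); last first.
    by apply/funext => u; rewrite /g [LHS]mulrC.
  rewrite (_ : 1 * _ = `|be + 1|^-1 *: - ((be + 1) * (T - r) `^ (be + 1 - 1)))//.
  by rewrite addrK /GRing.scale /= alE; field; lra.
have main (A : R) : A < B ->
  (\int[lebesgue_measure]_(r in `[A, B]) (`|v r| `^ p * (T - r) `^ be)%:E <=
   \int[leb R]_r (`|dv r| `^ p * ((p / `|be + 1|) `^ p * (T - r) `^ (p + be)))%:E)%E.
  move=> AB.
  have rT (r : R) : A <= r <= B -> r < T by move=> /andP[_]; lra.
  have Tr (r : R) : A <= r <= B -> 0 < T - r by move=> /rT; rewrite subr_gt0.
  have bd : 1 * (g B * `|v B| `^ p - g A * `|v A| `^ p) <= 0.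
    rewrite (v0 B)// normr0 powR0 ?gt_eqF// mulr0 sub0r mul1r oppr_le0.
    by rewrite mulr_ge0 ?powR_ge0// mulr_ge0 ?powR_ge0// invr_ge0 ltW.
  have := @hardy_interval R p 1 v dv g (fun r => (T - r) `^ be) A B p1 AB (expr1n _ 2)
    (fun r _ => Dv r) (fun r h => Dg r (rT r h)) _ _ (fun r _ => cdv r) _ bd.
  move=> H; apply: le_trans (H _ _ _) _.
  - by move=> r h; rewrite divr_gt0// powR_gt0// Tr.
  - by move=> r h; rewrite powR_gt0// Tr.
  - by move=> r h; exact: is_derive_continuous (DT be r (rT r h)).
  apply: (@le_trans _ _ (\int[lebesgue_measure]_(r in `[A, B])
      (`|dv r| `^ p * ((p / `|be + 1|) `^ p * (T - r) `^ (p + be)))%:E)%E); last first.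
    by apply: ge0_subset_integral => // r _; rewrite lee_fin !mulr_ge0 ?powR_ge0.
  rewrite le_eqVlt; apply/orP; left; apply/eqP; apply: eq_integral => r.
  rewrite inE /= in_itv /= => h; congr EFin; have t0 := Tr r h.
  rewrite /g (powRM _ (powR_ge0 _ _) (ltW _)) ?invr_gt0// -!powRrM.
  rewrite (powRM _ (ltW p0) (ltW _)) ?invr_gt0//.
  rewrite (_ : (be + 1) * p = (p + be) + be * (p - 1)); last by ring.
  rewrite powRD ?(lt0r_neq0 t0) ?implybT//.
  have e0 : (T - r) `^ (be * (p - 1)) != 0 by rewrite gt_eqF// powR_gt0.
  by field.
apply: (@exhaust_integral_le R _ (fun j => - j%:R) (fun=> B)) => //.
- by move=> r; rewrite lee_fin mulr_ge0 ?powR_ge0.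
- move=> r; have [Br|rB] := leP B r.
    by left; rewrite v0// normr0 powR0 ?mul0r// gt_eqF.
  right; near=> j; rewrite (ltW rB) andbT.
  have : `|r| <= j%:R by near: j; exact: near_nat_ge.
  by rewrite ler_norml => /andP[].
near=> j; apply: main.
have jB : 1 + `|B| <= j%:R by near: j; exact: near_nat_ge.
have := ler_norm (- B); rewrite normrN; lra.
Unshelve. all: by end_near. Qed.

Lemma lee_pmul_div (c : R) (x y : \bar R) : 0 < c -> (x <= (c^-1)%:E * y)%E -> (c%:E * x <= y)%E.
Proof.
move=> c0 h; have := @lee_wpmul2l R c%:E _ _ _ h; rewrite muleA -EFinM mulfV ?gt_eqF// mul1e; apply.
by rewrite lee_fin ltW.
Qed.
End Weights1D.

(** * Supports along orbits and passage to the completion *)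

Section Energy.
Variables (R : realType) (n k : nat) (gamma : R).
Hypothesis (n1 : (1 <= n)%N) (gamma0 : 0 <= gamma).
Local Notation pt := 'rV[R]_(n + k).
Local Notation X xi := (eunorm (@xpart R n k xi)).
Local Notation rho := (@hnorm R n k gamma).
Local Notation dil := (@dil R n k gamma).
Local Notation wt := (@wt R n gamma).
Local Notation Q := (Qdim n k gamma).

Lemma support_nonzero (f : pt -> R) xi : f xi != 0 -> Defs.support f xi.
Proof. by move=> h; apply: subset_closure. Qed.

Lemma near_notin_support (f : pt -> R) xi : ~ Defs.support f xi -> \forall y \near xi, f y = 0.
Proof.
move=> h; have op : open (~` Defs.support f) by apply: closed_openC; exact: closed_closure.
have : nbhs xi (~` Defs.support f) by exact: open_nbhs_nbhs.
by apply: filterS => y; apply: contra_notP => /eqP; exact: support_nonzero.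
Qed.

Lemma partial_notin_support (f : pt -> R) i xi : ~ Defs.support f xi -> partial i f xi = 0.
Proof.
move=> h; rewrite /partial.
have H : \forall y \near xi, cst (0 : R) y = f y by have := near_notin_support h; apply: filterS.
by have [_ ->] := near_eq_is_derive H (is_derive_cst (0 : R) xi (delta_mx 0 i : pt)).
Qed.

Lemma grad_notin_support p (f : pt -> R) xi : 0 < p -> ~ Defs.support f xi -> grad_gamma_p gamma p f xi = 0.
Proof.
move=> p0 h; rewrite /grad_gamma_p !big1 ?mulr0 ?addr0 ?powR0//.
- by rewrite gt_eqF// divr_gt0.
- by move=> i _; rewrite partial_notin_support// expr0n.
- by move=> i _; rewrite partial_notin_support// expr0n.
Qed.

Lemma energyE p (Omega : set pt) w (f : pt -> R) : 0 < p -> Defs.support f `<=` Omega ->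
  energy gamma p Omega w f = iint (fun xi => (grad_gamma_p gamma p f xi * w xi)%:E).
Proof.
move=> p0 fO; rewrite /energy /iint_on; congr iint; apply/funext => xi.
case: asboolP => // h; rewrite grad_notin_support ?mul0r//; by move=> /fO.
Qed.

Lemma iint_le_X (F G : pt -> \bar R) :
  (forall xi, 0 <= F xi)%E -> (forall xi, 0 <= G xi)%E ->
  measurable_fun setT (F \o @emb R (n + k) : Tm R (n + k) -> \bar R) ->
  measurable_fun setT (G \o @emb R (n + k) : Tm R (n + k) -> \bar R) ->
  (forall xi, X xi != 0%R -> (F xi <= G xi)%E) -> (iint F <= iint G)%E.
Proof.
move=> F0 G0 mF mG FG; rewrite !iintE//.
rewrite (int_Xne0 n1 mF) (int_Xne0 n1 mG).
apply: ge0_le_integralT => t; first by apply: mule_ge0 => //; exact: F0.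
have [Et|Et] := pselect (Xne0 t); last by rewrite !indicE memNset// !mul0e.
by apply: lee_wpmul2l; [rewrite lee_fin|exact: FG].
Qed.

(** A nonzero x-coordinate is multiplied by e^r along the orbit and leaves every bounded set. *)
Lemma dil_vanish_pinfty (f : pt -> R) xi : compact (Defs.support f) -> X xi != 0 ->
  exists B, forall r, B <= r -> f (dil r xi) = 0.
Proof.
move=> cf X0.
have [i xi0] : exists i : 'I_n, xpart xi ord0 i != 0.
  apply: contrapT => h; move: X0; rewrite /eunorm big1 ?sqrtr0 ?eqxx// => i _.
  by apply/eqP; rewrite sqrf_eq0; apply/negPn/negP => h'; apply: h; exists i.
have [M [Mr HM]] := compact_bounded cf.
pose M1 := `|M| + 1.
have {}HM y : Defs.support f y -> `|y| <= M1.
  by apply: HM; apply: le_lt_trans (ler_norm _) _; rewrite ltrDl.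
have x0 : 0 < `|xpart xi ord0 i| by rewrite normr_gt0.
exists (ln ((M1 + 1) / `|xpart xi ord0 i|)) => r hr.
apply/eqP; apply/negPn/negP => /support_nonzero/HM h.
have : M1 + 1 <= expR r * `|xpart xi ord0 i|.
  rewrite -ler_pdivrMr// -ler_ln ?posrE ?expR_gt0 ?expRK// divr_gt0//.
  by rewrite /M1 ltr_wpDl// addr_ge0.
have := le_trans (coord_le_norm (dil r xi) (lshift k i)) h.
rewrite mxE /wt /= ltn_ord mul1r normrM gtr0_norm ?expR_gt0// mxE; lra.
Qed.

Lemma wt_ge1 i : 1 <= wt i.
Proof. by rewrite /wt; case: ifP => // _; rewrite lerDl. Qed.

(** All weights are at least 1, so for r <= 0 each coordinate shrinks at least by e^r and the orbit
    enters the ball around 0 on which [f] vanishes. *)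
Lemma dil_vanish_ninfty (f : pt -> R) xi : ~ Defs.support f 0 ->
  exists B, forall r, r <= B -> f (dil r xi) = 0.
Proof.
move=> /near_notin_support /nbhs_ballP [d /= d0 Hd].
pose M := `|xi| + 1; have M0 : 0 < M by rewrite ltr_wpDl.
exists (Num.min 0 (ln (d / 2 / M))) => r; rewrite le_min => /andP[r0 rd].
apply: Hd; rewrite -ball_normE /= sub0r normrN.
apply: (@le_lt_trans _ _ (d / 2)); last by lra.
have erM : expR r * M <= d / 2.
  rewrite -ler_pdivlMr// -ler_ln ?posrE ?expR_gt0 ?expRK// !divr_gt0//.
apply: rV_norm_le => [|i]; first by lra.
rewrite mxE normrM ger0_norm ?expR_ge0//; apply: le_trans erM.
apply: ler_pM => //.
  rewrite ler_expR; have := wt_ge1 i; nra.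
by apply: le_trans (coord_le_norm _ _) _; rewrite lerDl.
Qed.

(** Off the null set, |u|^p w2 is the lower limit of the [G j]. The integral of that lower limit is
    measurable ground for Fatou's lemma, whereas [u] enters only through a pointwise comparison. The
    value [L] may be infinite. *)
Lemma fatou_iint p (Omega : set pt) (w1 w2 : pt -> R) u phi (L : \bar R) (c : R) :
  0 < p -> 0 < c -> (forall xi, 0 <= w2 xi) ->
  measurable_fun setT (fun t : Tm R (n + k) => w2 (emb t)) ->
  (forall f, testfun Omega f ->
     (c%:E * iint (fun xi => (`|f xi| `^ p * w2 xi)%:E) <= energy gamma p Omega w1 f)%E) ->
  inD gamma p Omega w1 u phi -> (fun j => energy gamma p Omega w1 (phi j)) @ \oo --> L ->
  (c%:E * iint_on Omega (fun xi => (`|u xi| `^ p * w2 xi)%:E) <= L)%E.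
Proof.
move=> p0 c0 w20 mw2 H [tphi [_ [Z [nZ cv]]]] cL.
pose G j xi := (`|phi j xi| `^ p * w2 xi)%:E.
have mG j : measurable_fun setT (fun t : Tm R (n + k) => G j (emb t)).
  apply/measurable_EFinP; apply: measurable_funM => //.
  apply: (measurableT_comp (measurable_powR _)); apply: measurableT_comp => //.
  by apply: measurable_continuous; apply: smooth_continuous; exact: (tphi j).1.
have G0 j xi : (0 <= G j xi)%E by rewrite lee_fin mulr_ge0 ?powR_ge0.
have mI : measurable_fun setT ((fun xi => limn_einf (G ^~ xi)) \o @emb R (n + k) : Tm R (n + k) -> \bar R).
  rewrite (_ : _ \o _ = (fun t => - limn_esup ((fun j => - G j (emb t))))%E); last first.
    by apply/funext => t /=; have := limn_esupN (fun j => G j (emb t)); rewrite /comp => ->; rewrite oppeK.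
  apply: measurableT_comp => //; apply: (measurable_fun_limn_esup (f := fun j t => (- G j (emb t))%E)) => j.
  exact: measurableT_comp.
have I0 xi : (0 <= limn_einf (G ^~ xi))%E.
  rewrite limn_einf_lim; apply: lime_ge; first exact: is_cvg_einfs.
  by near=> j; apply: le_ereal_inf_tmp => _ [l _ <-].
have le1 : (iint_on Omega (fun xi => (`|u xi| `^ p * w2 xi)%:E) <= iint (fun xi => limn_einf (G ^~ xi)))%E.
  apply: (iint_le_null nZ) => // xi.
    by case: ifP => // _; rewrite lee_fin mulr_ge0 ?powR_ge0.
  move=> Zx; case: asboolP => // Ox.
  have cG : G ^~ xi @ \oo --> (`|u xi| `^ p * w2 xi)%:E.
    apply: cvg_EFin; first by near=> j.
    apply: cvgM; last exact: cvg_cst.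
    apply: (@cvg_comp _ _ _ (fun j => phi j xi) (fun y : R => `|y| `^ p) _ (nbhs (u xi))); first exact: cv.
    exact: continuous_normpow.
  by rewrite (cvg_limn_einf_sup cG).1.
have le2 : (iint (fun xi => limn_einf (G ^~ xi)) <= limn_einf (fun j => iint (G j)))%E.
  rewrite iintE//.
  have := @fatou _ (Tm R (n + k)) R (mu R (n + k)) setT measurableT (fun j t => G j (emb t)) mG (fun j t _ => G0 j _).
  move=> /le_trans; apply; rewrite le_eqVlt; apply/orP; left; apply/eqP.
  by congr limn_einf; apply/funext => j; rewrite iintE//; exact: mG.
apply: lee_pmul_div => //; apply: le_trans le1 _; apply: le_trans le2 _.
have cL' : (fun j => (c^-1)%:E * energy gamma p Omega w1 (phi j))%E @ \oo --> ((c^-1)%:E * L)%E.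
  by apply: cvgeZl.
rewrite -(cvg_limn_einf_sup cL').1 !limn_einf_lim.
apply: lee_lim; [exact: is_cvg_einfs|exact: is_cvg_einfs|].
near=> j; apply: le_ereal_inf_tmp => _ [l /= jl <-].
apply: (@le_trans _ _ (iint (G l))); first by apply: ereal_inf_lbound; exists l.
have := @lee_wpmul2l R (c^-1)%:E _ _ _ (H _ (tphi l)).
rewrite muleA -EFinM mulVf ?gt_eqF// mul1e; apply.
by rewrite lee_fin invr_ge0 ltW.
Unshelve. all: by end_near. Qed.
End Energy.

(** * The two Hardy inequalities for test functions *)

Section HardyPower.
Variables (R : realType) (n k : nat) (gamma : R).
Hypothesis (n1 : (1 <= n)%N) (gamma0 : 0 <= gamma).
Local Notation pt := 'rV[R]_(n + k).
Local Notation X xi := (eunorm (@xpart R n k xi)).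
Local Notation rho := (@hnorm R n k gamma).
Local Notation dil := (@dil R n k gamma).
Local Notation Q := (Qdim n k gamma).

Lemma hnorm_powR c xi : X xi != 0 -> rho xi `^ c = expR (c * ln (rho xi)).
Proof. by move=> /(hnorm_gt0 gamma0) r0; rewrite {1}/powR gt_eqF. Qed.

Lemma measurable_hpow c : measurable_fun setT (fun t : Tm R (n + k) => rho (emb t) `^ c).
Proof. exact: (measurableT_comp (measurable_powR _) (@measurable_hnorm R n k gamma)). Qed.

Lemma invr_powRM (a p : R) : 0 < a -> 0 < p -> ((a / p) `^ p)^-1 = (p / a) `^ p.
Proof.
move=> a0 p0; rewrite -[p / a]invf_div -[(a / p)^-1]powR_inv1 ?divr_ge0 ?ltW//.
by rewrite -powRrM mulN1r powRN.
Qed.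

Lemma measurable_expMr (c : R) : measurable_fun setT (fun r : R => expR (c * r)).
Proof. by apply: measurableT_comp => //; exact: measurable_funM. Qed.

Lemma measurable_testpow p (f : pt -> R) : smooth f ->
  measurable_fun setT (fun t : Tm R (n + k) => `|f (emb t)| `^ p).
Proof.
move=> sf; apply: (measurableT_comp (measurable_powR _)); apply: measurableT_comp => //.
by apply: measurable_continuous; exact: smooth_continuous.
Qed.

Lemma hardy_test1 (be p : R) (Omega : set pt) (f : pt -> R) : 1 < p -> Q + be != 0 ->
  (be + Q < 0 -> ~ Omega 0) -> testfun Omega f ->
  (((`|Q + be| / p) `^ p)%:E * iint (fun xi => (`|f xi| `^ p * (psip gamma p xi * rho xi `^ be))%:E)
   <= energy gamma p Omega (fun xi => rho xi `^ (p + be))%R f)%E.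
Proof.
move=> p1 al0 hO [sf [cf fO]].
have p0 : 0 < p by exact: lt_trans p1.
have na : 0 < `|Q + be| by rewrite normr_gt0.
rewrite energyE//; apply: lee_pmul_div; first by rewrite powR_gt0// divr_gt0.
rewrite invr_powRM//; set c := (p / _) `^ p; have c0 : 0 <= c by exact: powR_ge0.
(* The constant is absorbed into the weight of the gradient, so that the comparison on orbits
   carries no constant. *)
pose W1 (r : R) := c * expR ((p + be) * r).
pose W2 (r : R) := expR (be * r).
have mW1 : measurable_fun setT W1 by apply: measurable_funM => //; exact: measurable_expMr.
have mW2 : measurable_fun setT W2 by exact: measurable_expMr.
have mF1 : measurable_fun setT (fun t : Tm R (n + k) => `|f (emb t)| `^ p * (psip gamma p (emb t) * rho (emb t) `^ be)).
  apply: measurable_funM; first exact: measurable_testpow.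
  by apply: measurable_funM; [exact: measurable_psip|exact: measurable_hpow].
have mF2 : measurable_fun setT (fun t : Tm R (n + k) => `|f (emb t)| `^ p * psip gamma p (emb t) * W2 (ln (rho (emb t)))).
  apply: measurable_funM; last exact: (measurableT_comp mW2 (@measurable_lnrho R n k gamma)).
  by apply: measurable_funM; [exact: measurable_testpow|exact: measurable_psip].
have mG1 : measurable_fun setT (fun t : Tm R (n + k) => grad_gamma_p gamma p f (emb t) * rho (emb t) `^ (p + be)).
  by apply: measurable_funM; [exact: measurable_grad|exact: measurable_hpow].
have mG2 : measurable_fun setT (fun t : Tm R (n + k) => grad_gamma_p gamma p f (emb t) * W1 (ln (rho (emb t)))).
  apply: measurable_funM; first exact: measurable_grad.
  exact: (measurableT_comp mW1 (@measurable_lnrho R n k gamma)).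
have G0 xi : 0 <= grad_gamma_p gamma p f xi by exact: powR_ge0.
(* Powers of rho may be written as e^(c ln rho) only where rho > 0; the two expressions can differ
   at the origin, hence the comparison off x = 0. *)
apply: (@le_trans _ _ (iint (fun xi => (`|f xi| `^ p * psip gamma p xi * W2 (ln (rho xi)))%:E))).
  apply: (iint_le_X n1).
  - by move=> xi; rewrite lee_fin mulr_ge0 ?powR_ge0// mulr_ge0 ?powR_ge0 ?psip_ge0.
  - by move=> xi; rewrite lee_fin mulr_ge0 ?expR_ge0// mulr_ge0 ?powR_ge0 ?psip_ge0.
  - exact/measurable_EFinP.
  - exact/measurable_EFinP.
  - by move=> xi X0; rewrite hnorm_powR// mulrA.
apply: (@le_trans _ _ (iint (fun xi => (grad_gamma_p gamma p f xi * W1 (ln (rho xi)))%:E))); last first.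
  rewrite [leRHS](_ : _ = iint (fun xi => (c * (grad_gamma_p gamma p f xi * rho xi `^ (p + be)))%:E)).
    apply: (iint_le_X n1).
    - by move=> xi; rewrite lee_fin mulr_ge0// mulr_ge0// expR_ge0.
    - by move=> xi; rewrite lee_fin mulr_ge0// mulr_ge0// powR_ge0.
    - exact/measurable_EFinP.
    - by apply/measurable_EFinP; exact: measurable_funM.
    - by move=> xi X0; rewrite hnorm_powR// /W1 lee_fin mulrCA.
  rewrite !iintE//.
  + rewrite -ge0_integralZl//; [exact/measurable_EFinP|by move=> t _; rewrite lee_fin mulr_ge0// powR_ge0].
  + by apply/measurable_EFinP; exact: measurable_funM.
  + by move=> xi; rewrite lee_fin mulr_ge0// mulr_ge0// powR_ge0.
  + exact/measurable_EFinP.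
  + by move=> xi; rewrite lee_fin mulr_ge0// powR_ge0.
apply: (hardy_radial n1 gamma0 p0 sf mW1 mW2).
- by move=> r; rewrite mulr_ge0// expR_ge0.
- by move=> r; rewrite expR_ge0.
move=> xi X0 r1.
have := @hardy1D_exp R (Q + be) p (fun r => f (dil r xi)) (fun r => Zd gamma f (dil r xi)) p1 al0
  (fun r => @is_derive_dil R n k gamma f xi r sf) (@continuous_Zd_dil R n k gamma f xi sf).
move=> H; rewrite /W1 /W2.
under eq_integral do rewrite -expRD -mulrDl.
have E r : expR ((Q - p) * r) * (c * expR ((p + be) * r)) = c * expR ((Q + be) * r).
  by rewrite mulrCA -expRD -mulrDl; congr (c * expR (_ * r)); ring.
under [leRHS]eq_integral do rewrite E.
apply: H.
- by move=> _; exact: dil_vanish_pinfty.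
- move=> h; apply: dil_vanish_ninfty => // /fO; apply: hO; by rewrite addrC.
Qed.

Lemma measurable_ln_hnorm_powR (Rad a : R) :
  measurable_fun setT (fun t : Tm R (n + k) => ln (Rad / rho (emb t)) `^ a).
Proof.
apply: (measurableT_comp (measurable_powR _)); apply: (measurableT_comp (@measurable_ln R)).
apply: measurable_funM => //.
rewrite (_ : (fun x => _) = (fun t : Tm R (n + k) => rho (emb t) `^ (-1))); first exact: measurable_hpow.
by apply/funext => t; rewrite powR_inv1// hnorm_ge0.
Qed.

Lemma ln_div_hnorm (Rad : R) (xi : pt) : 0 < Rad -> X xi != 0 -> ln (Rad / rho xi) = ln Rad - ln (rho xi).
Proof. by move=> R0 /(hnorm_gt0 gamma0) r0; rewrite ln_div ?posrE. Qed.

(** With T = ln Rad the logarithm ln (Rad / rho) is T - r. Since p = Q, the Jacobian e^(Q r) cancels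
    rho^(-p) on the left, and e^((Q - p) r) is 1 on the right, so only powers of T - r remain. *)
Lemma hardy_test2 (be p Rad : R) (f : pt -> R) : p = Q -> 1 < p -> 0 < Rad -> be < -1 ->
  let Omega := [set xi : pt | rho xi < Rad] in testfun Omega f ->
  (((`|be + 1| / p) `^ p)%:E * iint (fun xi => (`|f xi| `^ p * (psip gamma p xi / rho xi `^ p * ln (Rad / rho xi) `^ be))%:E)
   <= energy gamma p Omega (fun xi => ln (Rad / rho xi) `^ (p + be))%R f)%E.
Proof.
move=> pQ p1 R0 be1 Omega [sf [cf fO]].
have p0 : 0 < p by exact: lt_trans p1.
have na : 0 < `|be + 1| by rewrite normr_gt0 lt_eqF//; lra.
rewrite energyE//; apply: lee_pmul_div; first by rewrite powR_gt0// divr_gt0.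
rewrite invr_powRM//; set c := (p / _) `^ p; have c0 : 0 <= c by exact: powR_ge0.
pose T := ln Rad.
pose W1 (r : R) := c * (T - r) `^ (p + be).
pose W2 (r : R) := expR (- p * r) * (T - r) `^ be.
have mT (a : R) : measurable_fun setT (fun r : R => (T - r) `^ a).
  by apply: (measurableT_comp (measurable_powR _)); exact: measurable_funB.
have mW1 : measurable_fun setT W1 by apply: measurable_funM.
have mW2 : measurable_fun setT W2 by apply: measurable_funM => //; exact: measurable_expMr.
have mlnR (a : R) := @measurable_ln_hnorm_powR Rad a.
have mF1 : measurable_fun setT (fun t : Tm R (n + k) => `|f (emb t)| `^ p * (psip gamma p (emb t) / rho (emb t) `^ p * ln (Rad / rho (emb t)) `^ be)).
  apply: measurable_funM; first exact: measurable_testpow.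
  apply: measurable_funM => //; apply: measurable_funM; first exact: measurable_psip.
  by under eq_fun do rewrite -powRN; exact: measurable_hpow.
have mF2 : measurable_fun setT (fun t : Tm R (n + k) => `|f (emb t)| `^ p * psip gamma p (emb t) * W2 (ln (rho (emb t)))).
  apply: measurable_funM; last exact: (measurableT_comp mW2 (@measurable_lnrho R n k gamma)).
  by apply: measurable_funM; [exact: measurable_testpow|exact: measurable_psip].
have mG1 : measurable_fun setT (fun t : Tm R (n + k) => grad_gamma_p gamma p f (emb t) * ln (Rad / rho (emb t)) `^ (p + be)).
  by apply: measurable_funM => //; exact: measurable_grad.
have mG2 : measurable_fun setT (fun t : Tm R (n + k) => grad_gamma_p gamma p f (emb t) * W1 (ln (rho (emb t)))).
  apply: measurable_funM; first exact: measurable_grad.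
  exact: (measurableT_comp mW1 (@measurable_lnrho R n k gamma)).
have G0 xi : 0 <= grad_gamma_p gamma p f xi by exact: powR_ge0.
have lnE xi := @ln_div_hnorm Rad xi R0.
apply: (@le_trans _ _ (iint (fun xi => (`|f xi| `^ p * psip gamma p xi * W2 (ln (rho xi)))%:E))).
  apply: (iint_le_X n1).
  - by move=> xi; rewrite lee_fin mulr_ge0 ?powR_ge0// mulr_ge0 ?powR_ge0// divr_ge0 ?powR_ge0 ?psip_ge0.
  - by move=> xi; rewrite lee_fin; apply: mulr_ge0; apply: mulr_ge0; rewrite ?expR_ge0 ?powR_ge0 ?psip_ge0.
  - exact/measurable_EFinP.
  - exact/measurable_EFinP.
  - by move=> xi X0; rewrite lnE// -powRN hnorm_powR// lee_fin /W2 !mulrA.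
apply: (@le_trans _ _ (iint (fun xi => (grad_gamma_p gamma p f xi * W1 (ln (rho xi)))%:E))); last first.
  rewrite [leRHS](_ : _ = iint (fun xi => (c * (grad_gamma_p gamma p f xi * ln (Rad / rho xi) `^ (p + be)))%:E)).
    apply: (iint_le_X n1).
    - by move=> xi; rewrite lee_fin mulr_ge0// mulr_ge0// powR_ge0.
    - by move=> xi; rewrite lee_fin mulr_ge0// mulr_ge0// powR_ge0.
    - exact/measurable_EFinP.
    - by apply/measurable_EFinP; exact: measurable_funM.
    - by move=> xi X0; rewrite lnE// /W1 lee_fin mulrCA.
  rewrite !iintE//.
  + rewrite -ge0_integralZl//; [exact/measurable_EFinP|by move=> t _; rewrite lee_fin mulr_ge0// powR_ge0].
  + by apply/measurable_EFinP; exact: measurable_funM.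
  + by move=> xi; rewrite lee_fin mulr_ge0// mulr_ge0// powR_ge0.
  + exact/measurable_EFinP.
  + by move=> xi; rewrite lee_fin mulr_ge0// powR_ge0.
apply: (hardy_radial n1 gamma0 p0 sf mW1 mW2).
- by move=> r; rewrite mulr_ge0// powR_ge0.
- by move=> r; rewrite mulr_ge0 ?expR_ge0// powR_ge0.
move=> xi X0 r1.
have out r : T <= r -> ~ Defs.support f (dil r xi).
  move=> Tr /fO h; have {}h : rho (dil r xi) < Rad := h.
  move: h; rewrite hnorm_dil// r1 mulr1 => h.
  have : expR T <= expR r by rewrite ler_expR.
  by rewrite lnK ?posrE//; lra.
(* The closed support misses the point of the orbit with rho = Rad, hence also the orbit near the
   time T. This is the gap B < T required by [hardy1D_log]. *)
have [B BT HB] : exists2 B, B < T & forall r, B <= r -> f (dil r xi) = 0.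
  have := near_notin_support (out T (lexx T)).
  move=> /(@continuous_dil R n k gamma xi T) /nbhs_ballP [d /= d0 Hd].
  exists (T - d / 2); first by lra.
  move=> r rB; have [Tr|rT] := leP T r.
    by apply/eqP/negPn/negP => /support_nonzero; exact: out.
  apply: Hd; rewrite -ball_normE /= ger0_norm; lra.
have := @hardy1D_log R be T B p (fun r => f (dil r xi)) (fun r => Zd gamma f (dil r xi)) p1 be1 BT
  (fun r => @is_derive_dil R n k gamma f xi r sf) (@continuous_Zd_dil R n k gamma f xi sf) HB.
move=> H; rewrite /W1 /W2 -pQ.
have E r : expR (p * r) * (expR (- p * r) * (T - r) `^ be) = (T - r) `^ be.
  by rewrite mulrA -expRD -mulrDl subrr mul0r expR0 mul1r.
under eq_integral do rewrite E.
by under [leRHS]eq_integral do rewrite subrr mul0r expR0 mul1r.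
Qed.
End HardyPower.

(** * Smooth functions to all orders *)

Section SmoothOn.
Variables (R : realType) (V : normedModType R) (I : Type) (dir : I -> V).

(** A finite order N makes closure under sums, products and composition provable by induction on N.
    The family of directions lets one notion serve both the line and the coordinate directions of
    the whole space; the set [U] allows gluing. *)
Fixpoint smooth_on (N : nat) (U : set V) (f : V -> R) : Prop :=
  (forall x, U x -> {for x, continuous f}) /\
  match N with
  | 0 => True
  | N'.+1 => (forall i x, U x -> derivable f x (dir i)) /\ forall i, smooth_on N' U ('D_(dir i) f)
  end.

Lemma smooth_on_continuous N U f : smooth_on N U f -> forall x, U x -> {for x, continuous f}.
Proof. by case: N => [|N] []. Qed.

Lemma near_open (U : set V) (x : V) (P : set V) : open U -> U x -> (forall y, U y -> P y) -> \forall y \near x, P y.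
Proof. by move=> oU Ux UP; apply: (@filterS _ (nbhs x) _ U) => //; exact: open_nbhs_nbhs. Qed.

Lemma smooth_on_eq N U f g : open U -> (forall x, U x -> f x = g x) -> smooth_on N U f -> smooth_on N U g.
Proof.
move=> oU; elim: N f g => [|N IH] f g fg /= [cf H].
  split=> // x Ux; have nfg : \forall y \near x, f y = g y by exact: (near_open oU Ux).
  rewrite /prop_for /continuous_at -(fg _ Ux); apply: cvg_trans (cf _ Ux).
  exact: near_eq_cvg.
have nfg x : U x -> \forall y \near x, f y = g y by move=> Ux; exact: (near_open oU Ux).
have [Df Sf] := H; split=> [x Ux|].
  rewrite /prop_for /continuous_at -(fg _ Ux); apply: cvg_trans (cf _ Ux).
  by apply: near_eq_cvg; exact: nfg.
have D i x : U x -> is_derive x (dir i) g ('D_(dir i) f x).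
  by move=> Ux; apply: near_eq_is_derive (nfg x Ux) _; split => //; exact: Df.
split=> [i x /(D i)[]//|i]; apply: IH (Sf i) => x /(D i)[] _ <- //.
Qed.

Lemma smooth_on_step N U f (df : I -> V -> R) : open U -> (forall x, U x -> {for x, continuous f}) ->
  (forall i x, U x -> is_derive x (dir i) f (df i x)) -> (forall i, smooth_on N U (df i)) -> smooth_on N.+1 U f.
Proof.
move=> oU cf Df Sf; split=> //; split=> [i x /(Df i)[]//|i].
by apply: smooth_on_eq (Sf i) => // x /(Df i)[].
Qed.

Lemma smooth_on_is_derive N U f i x : smooth_on N.+1 U f -> U x -> is_derive x (dir i) f ('D_(dir i) f x).
Proof. by move=> [_ [Df _]] Ux; split => //; exact: Df. Qed.

Lemma smooth_on_pred N U f : smooth_on N.+1 U f -> smooth_on N U f.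
Proof.
elim: N f => [|N IH] f [cf [Df Sf]]; first by split.
by split=> //; split=> // i; apply: IH.
Qed.

Lemma smooth_on_union N U W f : smooth_on N U f -> smooth_on N W f -> smooth_on N (U `|` W) f.
Proof.
elim: N f => [|N IH] f [cf H] [cf' H'].
  by split=> // x [/cf|/cf'].
have [Df Sf] := H; have [Df' Sf'] := H'; split; first by move=> x [/cf|/cf'].
by split=> [i x [/(Df i)|/(Df' i)]|i] //; apply: IH; [exact: Sf|exact: Sf'].
Qed.

Lemma smooth_on_cst N U (c : R) : open U -> smooth_on N U (cst c).
Proof.
move=> oU; elim: N c => [|N IH] c; first by split=> // x _; exact: cvg_cst.
apply: (@smooth_on_step _ _ _ (fun _ => cst 0)) => // x _; exact: cvg_cst.
Qed.

Lemma smooth_on_add N U f g : open U -> smooth_on N U f -> smooth_on N U g -> smooth_on N U (fun x => f x + g x).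
Proof.
move=> oU; elim: N f g => [|N IH] f g Sf Sg.
  by split=> // x Ux; apply: cvgD; [exact: Sf.1|exact: Sg.1].
apply: (@smooth_on_step _ _ _ (fun i x => 'D_(dir i) f x + 'D_(dir i) g x)) => //.
- by move=> x Ux; apply: cvgD; [exact: Sf.1|exact: Sg.1].
- by move=> i x Ux; exact: is_deriveD (smooth_on_is_derive i Sf Ux) (smooth_on_is_derive i Sg Ux).
- by move=> i; apply: IH; [exact: Sf.2.2|exact: Sg.2.2].
Qed.

Lemma smooth_on_mul N U f g : open U -> smooth_on N U f -> smooth_on N U g -> smooth_on N U (fun x => f x * g x).
Proof.
move=> oU; elim: N f g => [|N IH] f g Sf Sg.
  by split=> // x Ux; apply: cvgM; [exact: Sf.1|exact: Sg.1].
apply: (@smooth_on_step _ _ _ (fun i x => f x * 'D_(dir i) g x + g x * 'D_(dir i) f x)) => //.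
- by move=> x Ux; apply: cvgM; [exact: Sf.1|exact: Sg.1].
- by move=> i x Ux; exact: is_deriveM (smooth_on_is_derive i Sf Ux) (smooth_on_is_derive i Sg Ux).
- move=> i; apply: smooth_on_add => //; apply: IH.
  + exact: smooth_on_pred.
  + exact: Sg.2.2.
  + exact: smooth_on_pred.
  + exact: Sf.2.2.
Qed.

Lemma smooth_on_sum N U (J : Type) (s : seq J) (f : J -> V -> R) : open U -> (forall j, smooth_on N U (f j)) ->
  smooth_on N U (fun x => \sum_(j <- s) f j x).
Proof.
move=> oU Sf; elim: s => [|j s IH].
  by under eq_fun do rewrite big_nil; exact: smooth_on_cst.
by under eq_fun do rewrite big_cons; exact: smooth_on_add.
Qed.
End SmoothOn.

Definition dir1 (R : realType) (_ : unit) : R := 1.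

Section SmoothComp.
Variable R : realType.

Lemma is_derive_comp (V : normedModType R) (f : V -> R) (g : R -> R) (x v : V) (a b : R) :
  is_derive x v f a -> is_derive (f x) 1 g b -> is_derive x v (g \o f) (b * a).
Proof.
move=> /is_derive_lineP Df Dg; apply/is_derive_lineP.
apply: (@is_derive1_comp R g (fun u : R => f (x + u *: v))) => //.
by rewrite scale0r addr0.
Qed.

Lemma smooth_on_comp (V : normedModType R) (I : Type) (dir : I -> V) N U D (f : V -> R) (g : R -> R) :
  open U -> open D -> (forall x, U x -> D (f x)) ->
  smooth_on dir N U f -> smooth_on (@dir1 R) N D g -> smooth_on dir N U (g \o f).
Proof.
move=> oU oD UD; elim: N f g UD => [|N IH] f g UD Sf Sg.
  split=> // x Ux; apply: (@continuous_comp _ _ _ f g); [exact: Sf.1|apply: Sg.1; exact: UD].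
apply: (@smooth_on_step _ _ _ _ _ _ _ (fun i x => ('D_1 g \o f) x * 'D_(dir i) f x)) => //.
- move=> x Ux; apply: (@continuous_comp _ _ _ f g); [exact: Sf.1|apply: Sg.1; exact: UD].
- move=> i x Ux; apply: is_derive_comp; first exact: (smooth_on_is_derive i Sf Ux).
  exact: (smooth_on_is_derive tt Sg (UD _ Ux)).
- move=> i; apply: smooth_on_mul => //; last exact: Sf.2.2.
  apply: IH => //; [exact: smooth_on_pred|exact: (Sg.2.2 tt)].
Qed.

Lemma smooth_on1_step N (U : set R) (f df : R -> R) : open U ->
  (forall x, U x -> is_derive x 1 f (df x)) -> smooth_on (@dir1 R) N U df -> smooth_on (@dir1 R) N.+1 U f.
Proof.
move=> oU Df Sf; apply: (@smooth_on_step _ _ _ _ _ _ _ (fun _ => df)) => //.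
by move=> x /Df /is_derive_continuous.
Qed.

Lemma smooth_on_id N (U : set R) : open U -> smooth_on (@dir1 R) N U id.
Proof.
move=> oU; case: N => [|N]; first by split=> // x _; exact: cvg_id.
by apply: (@smooth_on1_step _ _ _ (cst 1)) => //; exact: smooth_on_cst.
Qed.

Lemma smooth_on_expR N : smooth_on (@dir1 R) N setT expR.
Proof.
elim: N => [|N IH]; first by split=> // x _; exact: continuous_expR.
apply: (@smooth_on1_step _ _ _ expR) => //; exact: openT.
Qed.

Lemma smooth_on_powR N (a : R) : smooth_on (@dir1 R) N `]0, +oo[%classic (fun x => x `^ a).
Proof.
have oI : open (`]0, +oo[%classic : set R) by exact: interval_open.
elim: N a => [|N IH] a.
  by split=> // x; rewrite /= in_itv/= andbT => x0; exact: is_derive_continuous (is_derive1_powR a x0).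
apply: (@smooth_on1_step _ _ _ (fun x => cst a x * x `^ (a - 1))) => //.
  by move=> x; rewrite /= in_itv/= andbT => x0; exact: is_derive1_powR.
by apply: smooth_on_mul => //; exact: smooth_on_cst.
Qed.

Lemma smooth_on_ln N : smooth_on (@dir1 R) N `]0, +oo[%classic (@ln R).
Proof.
have oI : open (`]0, +oo[%classic : set R) by exact: interval_open.
case: N => [|N].
  by split=> // x; rewrite /= in_itv/= andbT => x0; exact: continuous_ln.
apply: (@smooth_on1_step _ _ _ (fun x => x `^ (-1))) => //; last exact: smooth_on_powR.
by move=> x; rewrite /= in_itv/= andbT => x0; rewrite powR_inv1 ?ltW//; exact: is_derive1_ln.
Qed.

(* This family, which contains the bump e^(-1/x), is closed under differentiation. *)
Definition flat (P : {poly R}) (x : R) : R := if 0 < x then P.[x^-1] * expR (- x^-1) else 0.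

(** With y = 1/x > 0, the bound e^y >= y^(i+1) / (i+1)! gives y^i e^(-y) <= (i+1)! x for every
    monomial of [P]. *)
Lemma flat_le (P : {poly R}) : exists2 C : R, 0 <= C & forall x, `|flat P x| <= C * `|x|.
Proof.
exists (\sum_(i < size P) `|P`_i| * (i.+1)`!%:R); first by rewrite sumr_ge0// => i _; rewrite mulr_ge0.
move=> x; rewrite /flat; case: ifPn => x0; last by rewrite normr0 mulr_ge0// sumr_ge0// => i _; rewrite mulr_ge0.
have y0 : 0 < x^-1 by rewrite invr_gt0.
rewrite horner_coef normrM (ger0_norm (expR_ge0 _)) (gtr0_norm x0) !mulr_suml.
apply: le_trans (ler_wpM2r (expR_ge0 _) (ler_norm_sum _ _ _)) _; rewrite mulr_suml.
apply: ler_sum => i _; rewrite normrM normrX (gtr0_norm y0) -!mulrA; apply: ler_wpM2l => //.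
rewrite expRN ler_pdivrMr ?expR_gt0// -ler_pdivrMl ?invr_gt0 ?mulr_gt0 ?ltr0n ?fact_gt0//.
have := expR_ge1Dxn i (ltW y0); apply: le_trans.
rewrite exprS (_ : (_ * x)^-1 * _ = x^-1 * x^-1 ^+ i / (i.+1)`!%:R); first by rewrite lerDr.
by rewrite invfM; ring.
Qed.

(** With y = 1/x one has dy/dx = - y^2, so P(y) e^(-y) has derivative y^2 (P - P')(y) e^(-y), again
    of the same form. The delicate point is x = 0. *)
Lemma is_derive_flat (P : {poly R}) (x : R) : is_derive x 1 (flat P) (flat ('X^2 * (P - P^`())) x).
Proof.
have [x0|x0|->] := ltgtP x 0.
- rewrite {2}/flat ltNge (ltW x0) /=.
  have H : \forall y \near x, cst (0 : R) y = flat P y.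
    near=> y; rewrite /flat; case: ifPn => // y0; have : y < 0 by near: y; exact: lt_nbhsl.
    by rewrite ltNge (ltW y0).
  exact: (near_eq_is_derive H (is_derive_cst (0 : R) x (1 : R))).
- have xn : x != 0 by rewrite gt_eqF.
  rewrite {2}/flat x0.
  have H : \forall y \near x, P.[y^-1] * expR (- y^-1) = flat P y.
    near=> y; rewrite /flat; have -> // : 0 < y by near: y; exact: lt_nbhsr.
  apply: (near_eq_is_derive H).
  have Dv : is_derive x 1 (fun y : R => y^-1) (- x ^- 2).
    by have := is_deriveV xn (is_derive_id x (1 : R)); rewrite [_ *: (1 : R)]mulr1.
  have Dp := is_derive1_comp (@is_derive_poly R P x^-1) Dv.
  have De := @is_derive1_comp R expR (fun y : R => - y^-1) x _ _ (is_derive_expR (- x^-1)) (is_deriveN Dv).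
  have := is_deriveM Dp De.
  have -> // : ('X^2 * (P - P^`())).[x^-1] * expR (- x^-1) =
    P.[x^-1] * (expR (- x^-1) * - - x ^- 2) + expR (- x^-1) * (P^`().[x^-1] * - x ^- 2).
  by rewrite hornerM hornerXn hornerD hornerN exprVn opprK; ring.
- rewrite {2}/flat ltxx.
  (* At 0 the difference quotient of [flat P] is [flat ('X * P)], because 1/h is the value of X; the
     linear bound makes it tend to 0. *)
  have [C C0 HC] := flat_le ('X * P).
  have H : (fun h : R => h^-1 *: (flat P (h *: (1 : R) + (0 : R)) - flat P 0)) @ 0^' --> (0 : R).
    apply/cvgrPdist_le => e e0; near=> h.
    have h0 : h != 0 by near: h; exact: nbhs_dnbhs_neq.
    rewrite [h *: (1 : R)]mulr1 addr0 {2}/flat ltxx subr0 sub0r normrN.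
    apply: (@le_trans _ _ (`|flat ('X * P) h|)).
      rewrite /flat; case: ifP => _; last by rewrite [_ *: _]mulr0.
      by rewrite hornerM hornerX -mulrA; exact: lexx.
    apply: le_trans (HC h) _.
    have hd : `|h| <= e / (C + 1).
      near: h; apply: dnbhs0_le; rewrite divr_gt0// ltr_wpDl//.
    apply: (@le_trans _ _ ((C + 1) * `|h|)); first by apply: ler_wpM2r => //; lra.
    by rewrite mulrC -ler_pdivlMr// ltr_wpDl.
  split; first exact: cvgP H.
  exact: cvg_lim H.
Unshelve. all: by end_near. Qed.

Lemma smooth_on_flat N (P : {poly R}) : smooth_on (@dir1 R) N setT (flat P).
Proof.
elim: N P => [|N IH] P; first by split=> // x _; exact: is_derive_continuous (is_derive_flat P x).
apply: (@smooth_on1_step _ _ _ (flat ('X^2 * (P - P^`())))) => //; first exact: openT.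
by move=> x _; exact: is_derive_flat.
Qed.

Lemma flat_le0 (P : {poly R}) (x : R) : x <= 0 -> flat P x = 0.
Proof. by move=> x0; rewrite /flat ltNge x0. Qed.
End SmoothComp.

(** * Regularized radial functions *)

Section Regularized.
Variables (R : realType) (n k : nat) (gamma : R).
Hypothesis (n1 : (1 <= n)%N) (gamma0 : 0 <= gamma).
Local Notation pt := 'rV[R]_(n + k).
Local Notation X xi := (eunorm (@xpart R n k xi)).
Local Notation Y xi := (eunorm (@ypart R n k xi)).
Local Notation rho := (@hnorm R n k gamma).
Local Notation Q := (Qdim n k gamma).
Local Notation kap := (2 + 2 * gamma).

Let g1 : 0 < 1 + gamma. Proof. by rewrite ltr_pwDl. Qed.
Let kap0 : 0 < kap. Proof. by move: gamma0; lra. Qed.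

Definition dirN (i : 'I_(n + k)) : pt := delta_mx 0 i.

Lemma smooth_of_smooth_on (f : pt -> R) : (forall N, smooth_on dirN N setT f) -> smooth f.
Proof.
move=> Sf.
have H s N : smooth_on dirN N setT (dpart s f).
  by elim: s N => [|i s IH] N //=; exact: (IH N.+1).2.2.
by move=> s; split=> [x|i x]; [exact: (H s 0).1|exact: (H s 1).2.1].
Qed.

Lemma is_derive_coord (i j : 'I_(n + k)) (xi : pt) :
  is_derive xi (dirN j) (fun x : pt => x ord0 i) (i == j)%:R.
Proof.
apply/is_derive_lineP.
rewrite (_ : (fun u : R => _) = (fun u : R => xi ord0 i + u * (i == j)%:R)); last first.
  by apply/funext => u; rewrite !mxE eqxx.
have := is_deriveD (is_derive_cst (xi ord0 i) (0 : R) (1 : R)) (is_deriveZ (i == j)%:R (is_derive_id (0 : R) (1 : R))).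
rewrite add0r [_ *: (1 : R)]mulr1.
rewrite (_ : cst _ + _ = (fun u : R => xi ord0 i + u * (i == j)%:R))//.
apply/funext => u; change (xi ord0 i + (i == j)%:R * u = xi ord0 i + u * (i == j)%:R); by rewrite [u * _]mulrC.
Qed.

Lemma smooth_on_coord N i : smooth_on dirN N setT (fun x : pt => x ord0 i).
Proof.
case: N => [|N]; first by split=> // x _; exact: coord_continuous.
apply: (@smooth_on_step _ _ _ _ _ _ _ (fun j => cst (i == j)%:R)).
- exact: openT.
- by move=> x _; exact: coord_continuous.
- by move=> j x _; exact: is_derive_coord.
- by move=> j; apply: smooth_on_cst; exact: openT.
Qed.

Definition Sx (xi : pt) : R := \sum_(i < n) xi ord0 (lshift k i) ^+ 2.
Definition Sy (xi : pt) : R := \sum_(j < k) xi ord0 (rshift n j) ^+ 2.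

Lemma SxE xi : X xi ^+ 2 = Sx xi.
Proof. by rewrite sqr_eunorm; apply: eq_bigr => i _; rewrite mxE. Qed.

Lemma SyE xi : Y xi ^+ 2 = Sy xi.
Proof. by rewrite sqr_eunorm; apply: eq_bigr => i _; rewrite mxE. Qed.

Lemma Sx_ge0 xi : 0 <= Sx xi. Proof. by rewrite -SxE sqr_ge0. Qed.
Lemma Sy_ge0 xi : 0 <= Sy xi. Proof. by rewrite -SyE sqr_ge0. Qed.

Lemma is_derive_sumsq (m : nat) (s : 'I_m -> 'I_(n + k)) (xi : pt) j :
  is_derive xi (dirN j) (fun x : pt => \sum_(i < m) x ord0 (s i) ^+ 2) (2 * \sum_(i < m) xi ord0 (s i) * (s i == j)%:R).
Proof.
have H i : is_derive xi (dirN j) (fun x : pt => x ord0 (s i) ^+ 2) (2 * (xi ord0 (s i) * (s i == j)%:R)).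
  have D := is_derive_coord (s i) j xi; have := is_deriveM D D.
  rewrite (_ : _ * _ = (fun x : pt => x ord0 (s i) ^+ 2)); last by apply/funext => x; rewrite expr2.
  by rewrite (_ : _ + _ = 2 * (xi ord0 (s i) * (s i == j)%:R))// /GRing.scale /=; ring.
have := is_derive_sum H; rewrite -mulr_sumr.
rewrite (_ : \sum_(i < m) _ = (fun x : pt => \sum_(i < m) x ord0 (s i) ^+ 2))//.
by apply/funext => x; rewrite fct_sumE.
Qed.

Lemma smooth_on_sumsq N (m : nat) (s : 'I_m -> 'I_(n + k)) :
  smooth_on dirN N setT (fun x : pt => \sum_(i < m) x ord0 (s i) ^+ 2).
Proof.
apply: (@smooth_on_sum _ _ _ dirN N setT _ _ (fun i x => x ord0 (s i) ^+ 2)); first exact: openT.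
move=> i; apply: (@smooth_on_eq R _ _ dirN N setT (fun x : pt => x ord0 (s i) * x ord0 (s i))); first exact: openT.
  by move=> x _; rewrite expr2.
by apply: smooth_on_mul; [exact: openT|exact: smooth_on_coord|exact: smooth_on_coord].
Qed.

(* rho^(2 + 2 gamma) and ln rho are not smooth where x = 0; [Pe e] and [Le e] are
   smooth everywhere for e > 0 and tend to them as e -> 0. *)
Definition Pe (e : R) (xi : pt) : R := (Sx xi + e) `^ (1 + gamma) + (1 + gamma) ^+ 2 * Sy xi.
Definition Le (e : R) (xi : pt) : R := ln (Pe e xi) / kap.

Lemma Pe_gt0 e xi : 0 < e -> 0 < Pe e xi.
Proof.
move=> e0; apply: ltr_pwDl; first by rewrite powR_gt0// ltr_wpDl// Sx_ge0.
by rewrite mulr_ge0 ?sqr_ge0// Sy_ge0.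
Qed.

Lemma Pe0 xi : Pe 0 xi = hP gamma xi.
Proof.
rewrite /Pe /hP addr0 -SxE -SyE -(powR_mulrn 2 (eunorm_ge0 _)) -powRrM//.
Qed.

Lemma hP_le_Pe e xi : 0 <= e -> hP gamma xi <= Pe e xi.
Proof.
move=> e0; rewrite -Pe0 /Pe lerD2r addr0; apply: ge0_ler_powR; rewrite ?nnegrE ?Sx_ge0//.
- exact: ltW.
- by rewrite addr_ge0// Sx_ge0.
- by rewrite lerDl.
Qed.

Lemma expR_Le e xi : 0 < e -> expR (kap * Le e xi) = Pe e xi.
Proof. by move=> e0; rewrite /Le mulrC divfK ?gt_eqF// lnK// posrE Pe_gt0. Qed.

Let pos : set R := `]0, +oo[%classic.
Let posP x : pos x <-> 0 < x. Proof. by rewrite /pos /= in_itv /= andbT. Qed.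

Lemma smooth_on_Pe N e : 0 < e -> smooth_on dirN N setT (Pe e).
Proof.
move=> e0; apply: smooth_on_add; first exact: openT.
  apply: (@smooth_on_comp _ _ _ _ _ setT pos (fun x => Sx x + e) (fun z => z `^ (1 + gamma))) => //; first exact: openT.
  - by move=> x _; apply/posP; rewrite ltr_wpDl// Sx_ge0.
  - apply: smooth_on_add; [exact: openT|exact: smooth_on_sumsq|]; apply: smooth_on_cst; exact: openT.
  - exact: smooth_on_powR.
apply: smooth_on_mul; [exact: openT| |exact: smooth_on_sumsq]; apply: smooth_on_cst; exact: openT.
Qed.

Lemma smooth_on_Le N e : 0 < e -> smooth_on dirN N setT (Le e).
Proof.
move=> e0; apply: smooth_on_mul; first exact: openT.
  apply: (@smooth_on_comp _ _ _ _ _ setT pos (Pe e) (@ln R)) => //; first exact: openT.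
  - by move=> x _; apply/posP; exact: Pe_gt0.
  - exact: smooth_on_Pe.
  - exact: smooth_on_ln.
by apply: smooth_on_cst; exact: openT.
Qed.

Definition dPe (e : R) (xi : pt) (j : 'I_(n + k)) : R :=
  (1 + gamma) * (Sx xi + e) `^ gamma * (2 * \sum_(i < n) xi ord0 (lshift k i) * (lshift k i == j)%:R)
  + (1 + gamma) ^+ 2 * (2 * \sum_(i < k) xi ord0 (rshift n i) * (rshift n i == j)%:R).

Lemma is_derive_Pe e xi j : 0 < e -> is_derive xi (dirN j) (Pe e) (dPe e xi j).
Proof.
move=> e0.
have D1 := is_deriveD (@is_derive_sumsq n (lshift k) xi j) (is_derive_cst e xi (dirN j)).
have s0 : 0 < (((fun x : pt => \sum_(i < n) x ord0 (lshift k i) ^+ 2) + cst e) : pt -> R) xi.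
  by apply: ltr_wpDl => //; exact: Sx_ge0.
have D2 := is_derive_comp D1 (is_derive1_powR (1 + gamma) s0).
have D3 := is_deriveZ ((1 + gamma) ^+ 2) (@is_derive_sumsq k (@rshift n k) xi j).
have := is_deriveD D2 D3; rewrite addr0.
by rewrite (_ : 1 + gamma - 1 = gamma)//; ring.
Qed.

Lemma is_derive_Le e xi j : 0 < e -> is_derive xi (dirN j) (Le e) (dPe e xi j / (kap * Pe e xi)).
Proof.
move=> e0; have P0 := Pe_gt0 xi e0.
have := is_deriveZ (kap^-1) (is_derive_comp (is_derive_Pe xi j e0) (is_derive1_ln P0)).
rewrite (_ : kap^-1 \*: (@ln R \o Pe e) = Le e); last by apply/funext => x; rewrite /Le [RHS]mulrC.
by rewrite (_ : _ *: _ = dPe e xi j / (kap * Pe e xi))// /GRing.scale /= invfM; ring.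
Qed.

(** The square of |grad_gamma (Pe e)| divided by (2 + 2 gamma)^2. For e = 0 it becomes |x|^(2 gamma)
    hP where x is nonzero. *)
Definition Ge (e : R) (xi : pt) : R :=
  ((Sx xi + e) `^ gamma) ^+ 2 * Sx xi + (X xi `^ gamma) ^+ 2 * ((1 + gamma) ^+ 2 * Sy xi).

Lemma gradsq_comp (f df : R -> R) e xi : 0 < e -> (forall r : R, is_derive r 1 f (df r)) ->
  gradsq gamma (f \o Le e) xi = (df (Le e xi) / Pe e xi) ^+ 2 * Ge e xi.
Proof.
move=> e0 Df; have P0 := Pe_gt0 xi e0.
have pE j : partial j (f \o Le e) xi = df (Le e xi) * (dPe e xi j / (kap * Pe e xi)).
  by have [_] := is_derive_comp (is_derive_Le xi j e0) (Df (Le e xi)).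
have dl i : dPe e xi (lshift k i) = kap * ((Sx xi + e) `^ gamma * xi ord0 (lshift k i)).
  rewrite /dPe (bigD1 i)//= eqxx mulr1 big1; last first.
    by move=> i' ii'; rewrite (inj_eq (@lshift_inj _ _)) (negbTE ii') mulr0.
  rewrite big1; first by ring.
  by move=> i' _; rewrite eq_rlshift mulr0.
have dr j : dPe e xi (rshift n j) = kap * ((1 + gamma) * xi ord0 (rshift n j)).
  rewrite /dPe big1; last by move=> i' _; rewrite eq_lrshift mulr0.
  rewrite (bigD1 j)//= eqxx mulr1 big1; last first.
    by move=> i' ii'; rewrite (inj_eq (@rshift_inj _ _)) (negbTE ii') mulr0.
  by ring.
rewrite /gradsq /Ge [RHS]mulrDr; congr (_ + _).
  rewrite mulrA /Sx mulr_sumr; apply: eq_bigr => i _; rewrite pE dl.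
  by field; rewrite !gt_eqF.
rewrite mulrCA; congr (_ * _); rewrite mulrA /Sy mulr_sumr; apply: eq_bigr => i _; rewrite pE dr.
by field; rewrite !gt_eqF.
Qed.

Lemma Ge_ge0 e xi : 0 <= Ge e xi.
Proof. by rewrite addr_ge0// mulr_ge0 ?sqr_ge0 ?Sx_ge0// mulr_ge0 ?sqr_ge0 ?Sy_ge0. Qed.

(** This says |grad_gamma (Le e)| <= e^(- Le e), the regularized form of |grad_gamma ln rho| <= 1 /
    rho, with no loss depending on e; it supplies the domination as e tends to 0. With s = (|x|^2 +
    e)^gamma one has Ge <= s Pe, and s <= Pe^(gamma / (1 + gamma)). *)
Lemma Ge_le (e : R) (xi : pt) : 0 < e -> Ge e xi <= Pe e xi ^+ 2 * expR (- (2 * Le e xi)).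
Proof.
move=> e0; have P0 := Pe_gt0 xi e0.
have se0 : 0 < Sx xi + e by rewrite ltr_wpDl// Sx_ge0.
pose s := (Sx xi + e) `^ gamma.
have s1 : Ge e xi <= s * Pe e xi.
  rewrite /Ge /Pe mulrDr -/s; apply: lerD.
    rewrite expr2 -mulrA; apply: ler_wpM2l; first exact: powR_ge0.
    rewrite -[_ `^ (1 + gamma)](mulr_powRB1 (ltW se0) g1) (_ : 1 + gamma - 1 = gamma); last by ring.
    by rewrite mulrC; apply: ler_wpM2r; [exact: powR_ge0|rewrite lerDl ltW].
  apply: ler_wpM2r; first by rewrite mulr_ge0 ?sqr_ge0 ?Sy_ge0.
  rewrite -(powR_mulrn 2 (powR_ge0 _ _)) -powRrM mulrC powRrM (powR_mulrn 2 (eunorm_ge0 _)) SxE.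
  by apply: ge0_ler_powR; rewrite ?nnegrE ?Sx_ge0 ?(ltW se0)// lerDl ltW.
apply: le_trans s1 _; rewrite expr2 -mulrA mulrC; apply: ler_wpM2l; first exact: ltW.
have -> : expR (- (2 * Le e xi)) = (Pe e xi) `^ (- (1 + gamma)^-1).
  by rewrite -expR_Le// expR_powR; congr expR; field; rewrite gt_eqF.
apply: (@le_trans _ _ (Pe e xi `^ (gamma / (1 + gamma)))).
  have -> : s = (Sx xi + e) `^ (1 + gamma) `^ (gamma / (1 + gamma)).
    by rewrite -powRrM /s mulrCA divff ?gt_eqF// mulr1.
  apply: ge0_ler_powR.
  - by rewrite divr_ge0// ltW.
  - by rewrite nnegrE powR_ge0.
  - by rewrite nnegrE ltW.
  - by rewrite lerDl mulr_ge0 ?sqr_ge0 ?Sy_ge0.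
rewrite -[V in V * _ `^ _](powRr1 (ltW P0)) -powRD ?(lt0r_neq0 P0) ?implybT//.
by rewrite (_ : gamma / (1 + gamma) = 1 - (1 + gamma)^-1)//; field; rewrite gt_eqF.
Qed.

Lemma grad_comp_le (p : R) (f df : R -> R) (e : R) (xi : pt) : 0 < p -> 0 < e -> (forall r : R, is_derive r 1 f (df r)) ->
  grad_gamma_p gamma p (f \o Le e) xi <= `|df (Le e xi)| `^ p * expR (- p * Le e xi).
Proof.
move=> p0 e0 Df; have P0 := Pe_gt0 xi e0.
rewrite /grad_gamma_p -/(gradsq gamma (f \o Le e) xi) (gradsq_comp _ e0 Df).
apply: (@le_trans _ _ (((df (Le e xi) * expR (- Le e xi)) ^+ 2) `^ (p / 2))).
  apply: ge0_ler_powR.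
  - by rewrite divr_ge0// ltW.
  - by rewrite nnegrE mulr_ge0 ?Ge_ge0// sqr_ge0.
  - by rewrite nnegrE sqr_ge0.
  rewrite !exprMn exprVn -mulrA; apply: ler_wpM2l; first exact: sqr_ge0.
  rewrite ler_pdivrMl ?exprn_gt0//; apply: le_trans (Ge_le xi e0) _.
  by rewrite -expRM_natl mulrN.
rewrite sqr_powR normrM powRM// (ger0_norm (expR_ge0 _)) expR_powR.
by rewrite (_ : - Le e xi * p = - p * Le e xi)//; ring.
Qed.

Lemma cvg_Sxe xi (e : nat -> R) : e @ \oo --> (0 : R) -> (fun j => Sx xi + e j) @ \oo --> Sx xi.
Proof.
move=> ce; suff : (fun j => Sx xi + e j) @ \oo --> Sx xi + 0 by rewrite addr0.
by apply: cvgD => //; exact: cvg_cst.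
Qed.

Lemma continuous_powR_pos (a x : R) : 0 < x -> {for x, continuous (fun y : R => y `^ a)}.
Proof. by move=> x0; exact: is_derive_continuous (is_derive1_powR a x0). Qed.

Lemma Sx_gt0 xi : X xi != 0 -> 0 < Sx xi.
Proof. by move=> h; rewrite -SxE exprn_gt0// lt_neqAle eq_sym h eunorm_ge0. Qed.

Lemma cvg_Pe xi (e : nat -> R) : X xi != 0 -> e @ \oo --> (0 : R) -> (fun j => Pe (e j) xi) @ \oo --> hP gamma xi.
Proof.
move=> h ce; rewrite -Pe0 /Pe addr0; apply: cvgD; last exact: cvg_cst.
apply: (@cvg_comp _ _ _ (fun j => Sx xi + e j) (fun y : R => y `^ (1 + gamma)) _ (nbhs (Sx xi))); first exact: cvg_Sxe.
by apply: continuous_powR_pos; exact: Sx_gt0.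
Qed.

Lemma hP_gt0 xi : X xi != 0 -> 0 < hP gamma xi.
Proof. by move=> h; rewrite -(hnorm_powR_kap gamma0) powR_gt0// (hnorm_gt0 gamma0). Qed.

Lemma ln_hP xi : X xi != 0 -> ln (hP gamma xi) / kap = ln (rho xi).
Proof. by move=> h; rewrite -(hnorm_powR_kap gamma0) ln_powR mulrC mulKf// gt_eqF. Qed.

Lemma cvg_Le xi (e : nat -> R) : X xi != 0 -> e @ \oo --> (0 : R) -> (fun j => Le (e j) xi) @ \oo --> ln (rho xi).
Proof.
move=> h ce; rewrite -ln_hP//; apply: cvgM; last exact: cvg_cst.
apply: (@cvg_comp _ _ _ (fun j => Pe (e j) xi) (@ln R) _ (nbhs (hP gamma xi))); first exact: cvg_Pe.
by apply: continuous_ln; exact: hP_gt0.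
Qed.

Lemma cvg_grad_comp (p : R) (f df : R -> R) xi (e : nat -> R) : 0 < p -> X xi != 0 -> (forall j, 0 < e j) -> e @ \oo --> (0 : R) ->
  (forall r : R, is_derive r 1 f (df r)) -> continuous df ->
  (fun j => grad_gamma_p gamma p (f \o Le (e j)) xi) @ \oo -->
    `|df (ln (rho xi))| `^ p * (psip gamma p xi * expR (- p * ln (rho xi))).
Proof.
move=> p0 h e0 ce Df cdf; have r0 := hnorm_gt0 gamma0 h; have P0 := hP_gt0 h.
have S0 := Sx_gt0 h.
have -> : (fun j => grad_gamma_p gamma p (f \o Le (e j)) xi) = (fun j => `|(df (Le (e j) xi) / Pe (e j) xi) ^+ 2 * Ge (e j) xi| `^ (p / 2)).
  apply/funext => j; rewrite /grad_gamma_p -/(gradsq gamma (f \o Le (e j)) xi) (gradsq_comp _ (e0 j) Df).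
  by rewrite ger0_norm// mulr_ge0 ?sqr_ge0 ?Ge_ge0.
have -> : `|df (ln (rho xi))| `^ p * (psip gamma p xi * expR (- p * ln (rho xi))) =
  `|(df (ln (rho xi)) / hP gamma xi) ^+ 2 * Ge 0 xi| `^ (p / 2).
  (* At e = 0 both blocks contain the same factor |x|^(2 gamma), and what remains is [hP]. Dividing
     by hP^2 leaves |x|^(2 gamma) / rho^(2 + 2 gamma), the square of |grad_gamma ln rho|. *)
  have -> : Ge 0 xi = (X xi `^ gamma) ^+ 2 * hP gamma xi.
    rewrite /Ge addr0 -SxE -SyE /hP mulrDr; congr (_ + _).
    rewrite -!(powR_mulrn 2 (powR_ge0 _ _)) -(powR_mulrn 2 (eunorm_ge0 _)) -!powRrM -!powRD ?h ?implybT//.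
    by congr (_ `^ _); ring.
  have -> : (df (ln (rho xi)) / hP gamma xi) ^+ 2 * ((X xi `^ gamma) ^+ 2 * hP gamma xi) =
    (df (ln (rho xi)) * X xi `^ gamma) ^+ 2 / hP gamma xi by field; rewrite gt_eqF.
  rewrite [V in _ = V `^ _]ger0_norm; last by rewrite divr_ge0 ?sqr_ge0// ltW.
  rewrite powRM ?sqr_ge0 ?invr_ge0 ?(ltW P0)// sqr_powR normrM (ger0_norm (powR_ge0 _ _)) powRM ?powR_ge0//.
  rewrite -powRrM -[(hP gamma xi)^-1]powR_inv1 ?(ltW P0)// -powRrM -(hnorm_powR_kap gamma0) -powRrM.
  rewrite /psip -hnorm_powR// -!mulrA; congr (_ * (_ * _)).
  rewrite -powRN -powRD ?(lt0r_neq0 r0) ?implybT//; congr (_ `^ _); by field.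
apply: (@cvg_comp _ _ _ (fun j => (df (Le (e j) xi) / Pe (e j) xi) ^+ 2 * Ge (e j) xi) (fun y : R => `|y| `^ (p / 2)) _ (nbhs ((df (ln (rho xi)) / hP gamma xi) ^+ 2 * Ge 0 xi))); last first.
  by apply: continuous_normpow; rewrite divr_gt0.
have c1 : (fun j => df (Le (e j) xi) / Pe (e j) xi) @ \oo --> df (ln (rho xi)) / hP gamma xi.
  apply: cvgM.
    apply: (@cvg_comp _ _ _ (fun j => Le (e j) xi) df _ (nbhs (ln (rho xi)))); [exact: cvg_Le|exact: cdf].
  by apply: cvgV; [rewrite gt_eqF|exact: cvg_Pe].
apply: cvgM; first by under eq_fun do rewrite expr2; rewrite expr2; exact: cvgM.
rewrite /Ge addr0; apply: cvgD; last exact: cvg_cst.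
apply: cvgM; last exact: cvg_cst.
have c2 : (fun j => (Sx xi + e j) `^ gamma) @ \oo --> Sx xi `^ gamma.
  apply: (@cvg_comp _ _ _ (fun j => Sx xi + e j) (fun y : R => y `^ gamma) _ (nbhs (Sx xi))); first exact: cvg_Sxe.
  exact: continuous_powR_pos.
by under eq_fun do rewrite expr2; rewrite expr2; exact: cvgM.
Qed.
End Regularized.

(** * Strict inequalities and bounded convergence in the limit *)

Section Limits.
Variables (R : realType).

Lemma cvg_lt_near (u v : nat -> \bar R) (x y : \bar R) : u @ \oo --> x -> v @ \oo --> y -> (x < y)%E ->
  exists j, (u j < v j)%E.
Proof.
move=> cu cv xy.
have [d xd dy] : exists2 d : \bar R, (x < d)%E & (d < y)%E.
  move: x y xy {cu cv} => [x| |] [y| |]//=.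
  - rewrite lte_fin => xy; exists ((x + y) / 2)%:E; rewrite lte_fin; lra.
  - by move=> _; exists (x + 1)%:E; rewrite ?lte_fin ?ltry// ltrDl.
  - by move=> _; exists (y - 1)%:E; rewrite ?lte_fin ?ltNyr// ltrBlDr ltrDl.
  - by move=> _; exists 0%E; rewrite ?ltNyr ?ltry.
have Hu : \forall j \near \oo, (u j < d)%E by exact: (cu _ (open_ereal_lt' xd)).
have Hv : \forall j \near \oo, (d < v j)%E by exact: (cv _ (open_ereal_gt' dy)).
near (\oo : set_system nat) => j; exists j; apply: (@lt_trans _ _ d); near: j => //.
Unshelve. all: by end_near. Qed.

Lemma dct_bounded d (T : measurableType d) (m : {measure set T -> \bar R}) (N B : set T)
    (f : nat -> T -> R) (g : T -> R) (K : R) :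
  measurable N -> m N = 0%E -> measurable B -> (m B < +oo)%E ->
  (forall j, measurable_fun setT (f j)) -> measurable_fun setT g ->
  (forall j t, ~ N t -> 0 <= f j t <= K * \1_B t) ->
  (forall t, ~ N t -> f ^~ t @ \oo --> g t) ->
  (fun j => (\int[m]_t (f j t)%:E)%E) @ \oo --> (\int[m]_t (g t)%:E)%E
  /\ (\int[m]_t (g t)%:E \is a fin_num)%E.
Proof.
move=> mN N0 mB Bfin mf mg bf cf.
have iK : m.-integrable setT (fun t => (K * \1_B t)%:E).
  apply/integrableP; split; first by apply/measurable_EFinP; apply: measurable_funM => //; exact: measurable_indic.
  have H t : `|(K * \1_B t)%:E|%E = (`|K|%:E * (\1_B t)%:E)%E.
    by rewrite abse_EFin normrM [`|\1_B t|]ger0_norm.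
  under eq_integral do rewrite H.
  rewrite ge0_integralZl//; last by apply/measurable_EFinP; exact: measurable_indic.
  by rewrite integral_indic// setIT; apply: lte_mul_pinfty; rewrite ?lee_fin.
have aeN (P : T -> Prop) : (forall t, ~ N t -> P t) -> {ae m, forall t, P t}.
  move=> NP; exists N; split=> // t /= h; apply: contrapT => Nt; exact: h (NP _ Nt).
have mF (h : T -> R) : measurable_fun setT h -> measurable_fun setT (EFin \o h) by move=> mh; exact/measurable_EFinP.
have cE t : ~ N t -> (fun j => (f j t)%:E) @ \oo --> (g t)%:E.
  by move=> /cf cft; apply: cvg_EFin => //; exact: nearW.
have fb : {ae m, forall t (j : nat), setT t -> (`|(EFin \o f j) t| <= (K * \1_B t)%:E)%E}.
  apply: aeN => t Nt j _; have /andP[f0 fK] := bf j t Nt; by rewrite /= ger0_norm// lee_fin.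
have [ig _ cv] := @dominated_convergence _ T R m setT measurableT (fun j => EFin \o f j) (EFin \o g)
  (fun t => (K * \1_B t)%:E) (fun j => mF _ (mf j)) (mF _ mg) (aeN _ (fun t Nt _ => cE t Nt)) iK fb.
by split=> //; exact: integrable_fin_num.
Qed.
End Limits.

(** * Reduction of sharpness to one dimension *)

Section Sharp.
Variables (R : realType) (n k : nat) (gamma : R).
Hypothesis (n1 : (1 <= n)%N) (gamma0 : 0 <= gamma).
Local Notation pt := 'rV[R]_(n + k).
Local Notation X xi := (eunorm (@xpart R n k xi)).
Local Notation Y xi := (eunorm (@ypart R n k xi)).
Local Notation rho := (@hnorm R n k gamma).
Local Notation Q := (Qdim n k gamma).
Local Notation kap := (2 + 2 * gamma).
Local Notation Le := (@Le R n k gamma).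
Local Notation Tm := (Tm R (n + k)).
Local Notation mu := (mu R (n + k)).

Let g1 : 0 < 1 + gamma. Proof. by rewrite ltr_pwDl. Qed.
Let kap0 : 0 < kap. Proof. by move: gamma0; lra. Qed.

Definition cubeT (M : R) : set Tm := [set t : Tm | forall i, (i < n + k)%N -> - M <= nth 0 (seqof t) i <= M].

Let sym_le (M : R) : 0 <= M -> - M <= M. Proof. by lra. Qed.

Lemma measurable_cubeT M : 0 <= M -> measurable (cubeT M).
Proof. by move=> M0; have [] := @mu_box R (n + k) (fun _ => - M) (fun _ => M) (fun _ => sym_le M0). Qed.

Lemma mu_cubeT_fin M : 0 <= M -> (mu (cubeT M) < +oo)%E.
Proof.
move=> M0; have [_ ] := @mu_box R (n + k) (fun _ => - M) (fun _ => M) (fun _ => sym_le M0).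
by rewrite /cubeT => ->; rewrite ltry.
Qed.

Lemma eunorm_coord_le m (v : 'rV[R]_m) (i : 'I_m) : `|v ord0 i| <= eunorm v.
Proof.
rewrite -ler_sqr ?nnegrE ?eunorm_ge0// sqr_eunorm real_normK ?num_real// (bigD1 i)//= lerDl.
by apply: sumr_ge0 => j _; exact: sqr_ge0.
Qed.

Lemma coord_le_hP (b : R) (xi : pt) i : hP gamma xi <= expR (kap * b) ->
  `|xi ord0 i| <= expR b + expR ((1 + gamma) * b).
Proof.
move=> h; have kp : 0 <= 1 / kap by rewrite divr_ge0// ltW.
have X0 : X xi <= expR b.
  apply: le_trans (X_le_hnorm gamma0 xi) _; rewrite hnormE.
  have -> : expR b = expR (kap * b) `^ (1 / kap) by rewrite expR_powR; congr expR; field; rewrite gt_eqF.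
  by apply: ge0_ler_powR; rewrite ?nnegrE ?hP_ge0 ?expR_ge0.
have Y0 : Y xi <= expR ((1 + gamma) * b).
  rewrite -ler_sqr ?nnegrE ?eunorm_ge0 ?expR_ge0// -expRM_natl.
  have -> : 2%:R * ((1 + gamma) * b) = kap * b by ring.
  apply: le_trans h; rewrite /hP ler_wpDl ?powR_ge0//.
  by apply: ler_peMl; rewrite ?sqr_ge0// expr_ge1//; move: gamma0; lra.
have [j ->|j ->] := split_ordP i.
  rewrite (_ : xi ord0 (lshift k j) = xpart xi ord0 j); last by rewrite mxE.
  apply: le_trans (eunorm_coord_le _ _) _; apply: le_trans X0 _; by rewrite lerDl expR_ge0.
rewrite (_ : xi ord0 (rshift n j) = ypart xi ord0 j); last by rewrite mxE.
apply: le_trans (eunorm_coord_le _ _) _; apply: le_trans Y0 _; by rewrite lerDr expR_ge0.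
Qed.

Lemma cubeT_hP (b : R) (t : Tm) : hP gamma (emb t) <= expR (kap * b) -> cubeT (expR b + expR ((1 + gamma) * b)) t.
Proof.
move=> h i ik; have := coord_le_hP (Ordinal ik) h.
by rewrite mxE /= ler_norml.
Qed.

Lemma hP_expR (xi : pt) : X xi != 0 -> hP gamma xi = expR (kap * ln (rho xi)).
Proof. by move=> h; rewrite -(hnorm_powR_kap gamma0) hnorm_powR. Qed.

(** Regularizing raises ln rho, so a lower bound on [Le] does not bound rho below unless e is small.
    The price is one unit in a. Put h = e^(kap (a - 1)) and s = e^(1 + gamma) >= 2. If hP < h, then
    |x|^2 + e <= 2 z <= e^1 z and Pe <= (s + 1) h, whereas a <= Le forces Pe >= s^2 h; this is
    impossible as s^2 > s + 1. *)
Lemma Le_lower (a e : R) (xi : pt) : 0 < e -> e <= expR (2 * (a - 1)) -> a <= Le e xi ->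
  expR (kap * (a - 1)) <= hP gamma xi.
Proof.
move=> e0 ez aL; rewrite leNgt; apply/negP => hlt.
set z := expR (2 * (a - 1)) in ez *; set h := expR _ in hlt.
have hz : h = z `^ (1 + gamma) by rewrite /z expR_powR; congr expR; ring.
have hPE : hP gamma xi = Sx xi `^ (1 + gamma) + (1 + gamma) ^+ 2 * Sy xi by rewrite -Pe0// /Pe addr0.
have Sz : Sx xi <= z.
  rewrite leNgt; apply/negP => zS; move: hlt; apply/negP; rewrite -leNgt hPE hz.
  apply: le_trans (_ : Sx xi `^ (1 + gamma) <= _); last by rewrite lerDl mulr_ge0 ?sqr_ge0 ?Sy_ge0.
  by apply: ge0_ler_powR; rewrite ?nnegrE ?Sx_ge0 ?expR_ge0// ltW.
pose s : R := expR (1 + gamma).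
have s2 : 2 <= s by have := expR_ge1Dx (1 + gamma); rewrite /s; move: gamma0; lra.
have P1 : Pe gamma e xi <= s * h + h.
  rewrite /Pe; apply: lerD; last first.
    apply: ltW; apply: le_lt_trans hlt; rewrite hPE lerDr powR_ge0//.
  apply: (@le_trans _ _ ((expR 1 * z) `^ (1 + gamma))).
    apply: ge0_ler_powR; rewrite ?nnegrE; [exact: ltW| |by rewrite mulr_ge0 ?expR_ge0|].
      by rewrite addr_ge0 ?Sx_ge0// ltW.
    have e2 : 2 <= expR 1 :> R by have := expR_ge1Dx (1 : R); lra.
    apply: le_trans (lerD Sz ez) _; rewrite -mulr2n -mulr_natl; apply: ler_wpM2r => //; exact: expR_ge0.
  by rewrite powRM ?expR_ge0// hz expR_powR mul1r.
have : expR (kap * a) <= Pe gamma e xi by rewrite -expR_Le// ler_expR ler_pM2l.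
have -> : expR (kap * a) = s * s * h by rewrite /s /h -!expRD; congr expR; ring.
have h0 : 0 < h by exact: expR_gt0.
move: P1; generalize (Pe gamma e xi) => P P1 P2.
have : (s * s - s - 1) * h <= 0 by lra.
apply/negP; rewrite -ltNge mulr_gt0//; nra.
Qed.

Lemma psip_le1 (p : R) (xi : pt) : 0 < p -> psip gamma p xi <= 1.
Proof.
move=> p0; rewrite /psip; have [r0|r0] := eqVneq (rho xi `^ (gamma * p)) 0; first by rewrite r0 invr0 mulr0.
rewrite ler_pdivrMr ?mul1r; last by rewrite lt_neqAle eq_sym r0 powR_ge0.
by apply: ge0_ler_powR; rewrite ?nnegrE ?eunorm_ge0 ?hnorm_ge0 ?mulr_ge0 ?(ltW p0)//; exact: X_le_hnorm.
Qed.

(** The shell 1 <= rho < e lies in a bounded cube, and there rho^(-Q) and [psip] are at most 1. *)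
Lemma Mconst_fin (p : R) : 0 < p -> (Mconst n k gamma p < +oo)%E.
Proof.
move=> p0; rewrite /Mconst; pose M : R := expR 1 + expR ((1 + gamma) * 1).
have M0 : 0 <= M by rewrite addr_ge0 ?expR_ge0.
apply: le_lt_trans (mu_cubeT_fin M0); rewrite -[cubeT M]setIT -integral_indic//; last exact: measurable_cubeT.
apply: ge0_le_integral => //.
- by move=> t _; rewrite lee_fin; apply: mulr_ge0; [exact: polarw_ge0|exact: psip_ge0].
- by apply/measurable_EFinP; apply: measurable_funM; [exact: measurable_polarw|exact: measurable_psip].
- by apply/measurable_EFinP; apply: measurable_indic; exact: measurable_cubeT.
move=> t _; rewrite lee_fin /polarw !indicE; have [|h] := pselect ((@Xne0 R n k `&` (fun t => ln (rho (emb t))) @^-1` `[0%R, 1%R[%classic) t); last first.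
  by rewrite memNset// !mul0r ler0n.
move=> /[dup] HH [h]; rewrite (mem_set HH) mul1r {HH}; rewrite /= in_itv /= => /andP[r0 r1].
rewrite mem_set; last by apply: cubeT_hP; rewrite hP_expR// ler_expR ler_pM2l// ltW.
apply: le_trans (_ : 1 * 1 <= _); last by rewrite mulr1.
apply: ler_pM; [exact: expR_ge0|exact: psip_ge0| |exact: psip_le1].
rewrite -expR0 ler_expR mulNr oppr_le0 mulr_ge0// /Qdim addr_ge0// mulr_ge0// ltW//.
Qed.

(** If it were 0, the radial formula with the constant function 1 would make the integral of [psip]
    vanish. But [psip] is positive off the null set x = 0, so the unit cube would be null. *)
Lemma Mconst_gt0 (p : R) : 0 < p -> (0 < Mconst n k gamma p)%E.
Proof.
move=> p0; rewrite lt_neqAle eq_sym; apply/andP; split; last first.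
  by apply: integral_ge0 => t _; rewrite lee_fin; apply: mulr_ge0; [exact: polarw_ge0|exact: psip_ge0].
apply/eqP => M0.
have := @iint_radial R n k gamma n1 gamma0 p (fun _ => 1%E) (measurable_cst _) (fun _ => lee01).
rewrite M0 mul0e iintE; last 2 first.
- by apply: emeasurable_funM => //; apply/measurable_EFinP; exact: measurable_psip.
- by move=> xi; rewrite mule1 lee_fin psip_ge0.
under eq_integral do rewrite mule1.
move=> I0.
have mp : measurable_fun setT (fun t : Tm => (psip gamma p (emb t))%:E) by apply/measurable_EFinP; exact: measurable_psip.
have [+ _] := @ae_eq_integral_abs _ Tm R mu setT measurableT _ mp.
under eq_integral do rewrite gee0_abs ?lee_fin ?psip_ge0//.
move=> /(_ I0) [N [mN N0 sN]].
have [mB] := @mu_box R (n + k) (fun _ => 0) (fun _ => 1) (fun _ => ler01).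
rewrite big1 => [B1|i _]; last by rewrite subr0.
have : (mu [set t : Tm | forall i, (i < n + k)%N -> (0 <= nth 0 (seqof t) i <= 1)%R] <= mu (N `|` ~` @Xne0 R n k))%E.
  apply: le_measure; rewrite ?inE//; first by apply: measurableU => //; apply: measurableC; exact: measurable_Xne0.
  move=> t _; have [h|/eqP h] := pselect (X (emb t) = 0); first by right => /=; rewrite /Xne0 /= h eqxx.
  left; apply: sN => /= /(_ Logic.I)[]; apply/eqP; rewrite gt_eqF//.
  have X0 : 0 < X (emb t) by rewrite lt_neqAle eq_sym h eunorm_ge0.
  by apply: divr_gt0; rewrite powR_gt0// (hnorm_gt0 gamma0).
rewrite B1 => /le_trans/(_ (measureU2 _ _ _)) => /(_ mN (measurableC (measurable_Xne0 _ _ _))).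
have hz : (mu N + mu (~` @Xne0 R n k) <= 0)%E by rewrite N0 (mu_Xeq0 R k n1) adde0.
by move=> /le_trans/(_ hz); rewrite lee_fin ler10.
Qed.

Lemma bounded_of_vanish (g : R -> R) (a b : R) : a <= b -> continuous g ->
  (forall r, ~~ (a <= r <= b) -> g r = 0) -> exists2 K, 0 <= K & forall r, `|g r| <= K.
Proof.
move=> ab cg g0.
have [|c _ H] := @EVT_max R (fun x => `|g x|) a b ab.
  by apply: continuous_subspaceT => x; apply: continuous_comp; [exact: cg|exact: norm_continuous].
exists `|g c| => // r; have [h|/g0 ->] := boolP (a <= r <= b); last by rewrite normr0.
by apply: H; rewrite in_itv.
Qed.

Lemma testfun_comp_Le (Omega : set pt) (f : R -> R) (a b e : R) :
  (forall N, smooth_on (@dir1 R) N setT f) -> (forall r, ~~ (a <= r <= b) -> f r = 0) ->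
  (forall xi, expR (kap * (a - 1)) <= hP gamma xi <= expR (kap * b) -> Omega xi) ->
  0 < e -> e <= expR (2 * (a - 1)) -> testfun Omega (f \o Le e).
Proof.
move=> Sf f0 HO e0 ez.
have cL : continuous (Le e).
  by move=> x; exact: (smooth_on_continuous (@smooth_on_Le R n k gamma 0 e e0)).
have sub : Defs.support (f \o Le e) `<=` [set xi | a <= Le e xi <= b].
  rewrite [V in _ `<=` V](_ : _ = closure [set xi | a <= Le e xi <= b]).
    by apply: closure_subset => x /= fx; apply: contraNT fx => /f0 ->.
  apply/closure_id; rewrite (_ : mkset _ = Le e @^-1` `[a, b]%classic); last by apply/seteqP; split => x /=; rewrite in_itv.
  by apply: preimage_closed => //; exact: interval_closed.
have hPb xi : a <= Le e xi <= b -> expR (kap * (a - 1)) <= hP gamma xi <= expR (kap * b).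
  move=> /andP[aL Lb]; rewrite (Le_lower e0 ez aL) /=.
  by apply: le_trans (hP_le_Pe gamma0 xi (ltW e0)) _; rewrite -expR_Le// ler_expR ler_pM2l.
split; [|split].
- apply: smooth_of_smooth_on => N; apply: (@smooth_on_comp _ _ _ _ N setT setT) => //; try exact: openT.
  exact: smooth_on_Le.
- apply: bounded_closed_compact; last exact: closed_closure.
  pose M := expR b + expR ((1 + gamma) * b).
  exists M; split; first by rewrite num_real.
  move=> K MK xi /= /sub /hPb /andP[_ h]; apply: le_trans (ltW MK).
  apply: rV_norm_le => [|i]; first by rewrite addr_ge0 ?expR_ge0.
  exact: coord_le_hP.
- by move=> xi /sub /hPb /HO.
Qed.

(** The test functions are f(Le (e j)). By [Le_lower] their supports stay, off x = 0, in one shell a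
    - 1 <= ln rho <= b for all j; hence the bound on the weights over [a - 1, b] and a dominating
    constant on a cube. In the limit both sides carry the positive finite factor [Mconst], so a
    strict inequality on the line is inherited by some e j. *)
Lemma sharp_radial (p C K a b : R) (Omega : set pt) (w1 w2 : pt -> R) (f df W1 W2 : R -> R) :
  0 < p -> 0 < C -> a <= b -> (forall N, smooth_on (@dir1 R) N setT f) ->
  (forall r : R, is_derive r 1 f (df r)) -> continuous df ->
  (forall r, ~~ (a <= r <= b) -> f r = 0) -> (forall r, ~~ (a <= r <= b) -> df r = 0) ->
  measurable_fun setT W1 -> measurable_fun setT W2 ->
  (forall r, 0 <= W1 r) -> (forall r, 0 <= W2 r) ->
  (forall r, a - 1 <= r <= b -> W1 r <= K /\ W2 r <= K) ->
  measurable_fun setT (fun t : Tm => w1 (emb t)) -> measurable_fun setT (fun t : Tm => w2 (emb t)) ->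
  (forall xi, 0 <= w1 xi) -> (forall xi, 0 <= w2 xi) ->
  (forall xi, X xi != 0 -> w1 xi = W1 (ln (rho xi))) ->
  (forall xi, X xi != 0 -> w2 xi = psip gamma p xi * W2 (ln (rho xi))) ->
  (forall xi, expR (kap * (a - 1)) <= hP gamma xi <= expR (kap * b) -> Omega xi) ->
  (\int[leb R]_r (`|df r| `^ p * (expR ((Q - p) * r) * W1 r))%:E <
    C%:E * \int[leb R]_r (`|f r| `^ p * (expR (Q * r) * W2 r))%:E)%E ->
  exists2 u, testfun Omega u & (energy gamma p Omega w1 u < C%:E * iint (fun xi => (`|u xi| `^ p * w2 xi)%:E))%E.
Proof.
move=> p0 C0 ab Sf Df cdf f0 df0 mW1 mW2 W10 W20 WK mw1 mw2 w10 w20 w1E w2E HO Hlt.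
have cf : continuous f by move=> r; exact: is_derive_continuous (Df r).
have [Kf Kf0 fK] := bounded_of_vanish ab cf f0.
have [Kd Kd0 dfK] := bounded_of_vanish ab cdf df0.
have K0 : 0 <= K by apply: le_trans (W10 b) _; apply: (WK b _).1; lra.
pose z : R := expR (2 * (a - 1)).
have z0 : 0 < z by exact: expR_gt0.
(* The parameters stay below the threshold z = e^(2 (a - 1)) of [Le_lower], so every f(Le (e j)) is
   a test function in Omega. *)
have [e [e0 ez ce]] : exists e : nat -> R, [/\ forall j, 0 < e j, forall j, e j <= z & e @ \oo --> (0 : R)].
  exists (fun j => z * j.+1%:R^-1); split=> [j|j|].
  - by rewrite mulr_gt0// invr_gt0.
  - by rewrite ger_pMr// invf_le1// ler1n.
  - by rewrite -(mulr0 z); apply: cvgM; [exact: cvg_cst|exact: cvg_harmonic].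
pose u j := f \o Le (e j).
have tu j : testfun Omega (u j) by apply: (testfun_comp_Le Sf f0 HO (e0 j)); exact: ez.
pose M := expR b + expR ((1 + gamma) * b).
have M0 : 0 <= M by rewrite addr_ge0 ?expR_ge0.
have supp j (xi : pt) : X xi != 0 -> a <= Le (e j) xi <= b ->
    hP gamma xi <= expR (kap * b) /\ a - 1 <= ln (rho xi) <= b.
  move=> X0 /andP[aL Lb].
  have h2 : hP gamma xi <= expR (kap * b).
    by apply: le_trans (hP_le_Pe gamma0 xi (ltW (e0 j))) _; rewrite -expR_Le// ler_expR ler_pM2l.
  have h1 := Le_lower (e0 j) (ez j) aL.
  by move: h1 h2; rewrite hP_expR// !ler_expR !ler_pM2l// => -> ->.
have mN : measurable (~` @Xne0 R n k) by apply: measurableC; exact: measurable_Xne0.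
have N0 := mu_Xeq0 R k n1.
have mB := measurable_cubeT M0; have Bfin := mu_cubeT_fin M0.
have mL := @measurable_lnrho R n k gamma.
pose h1 r := `|df r| `^ p * expR (- p * r) * W1 r.
pose h2 r := `|f r| `^ p * W2 r.
have mh1 : measurable_fun setT h1.
  apply: measurable_funM => //; apply: measurable_funM; last exact: measurable_expMr.
  apply: (measurableT_comp (measurable_powR _)); apply: measurableT_comp => //; exact: continuous_measurable_fun.
have mh2 : measurable_fun setT h2.
  apply: measurable_funM => //.
  apply: (measurableT_comp (measurable_powR _)); apply: measurableT_comp => //; exact: continuous_measurable_fun.
have h10 r : 0 <= h1 r by rewrite mulr_ge0// mulr_ge0 ?powR_ge0 ?expR_ge0.
have h20 r : 0 <= h2 r by rewrite mulr_ge0// powR_ge0.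
have mpsi := @measurable_psip R n k gamma p.
have mgr j := @measurable_grad R n k gamma (u j) p (tu j).1.
have muj j := @measurable_testpow R n k p (u j) (tu j).1.
pose gA (t : Tm) := psip gamma p (emb t) * h1 (ln (rho (emb t))).
pose gB (t : Tm) := psip gamma p (emb t) * h2 (ln (rho (emb t))).
have mgA : measurable_fun setT gA by apply: measurable_funM => //; exact: (measurableT_comp mh1).
have mgB : measurable_fun setT gB by apply: measurable_funM => //; exact: (measurableT_comp mh2).
have [||c1 fin1] := @dct_bounded R _ Tm mu (~` @Xne0 R n k) (cubeT M)
  (fun j t => grad_gamma_p gamma p (u j) (emb t) * w1 (emb t)) gA (Kd `^ p * expR (- p * a) * K) mN N0 mB Bfin
  (fun j => measurable_funM (mgr j) mw1) mgA.
- move=> j t /contrapT X0; rewrite mulr_ge0 ?powR_ge0 ?w10//= w1E//.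
  have := @grad_comp_le R n k gamma gamma0 p f df (e j) (emb t) p0 (e0 j) Df; rewrite -/(u j).
  have gr0 : 0 <= grad_gamma_p gamma p (u j) (emb t) by exact: powR_ge0.
  have [LL|/df0 ->] := boolP (a <= Le (e j) (emb t) <= b); last first.
    rewrite normr0 powR0 ?gt_eqF// mul0r => gr1.
    have -> : grad_gamma_p gamma p (u j) (emb t) = 0 by apply/eqP; rewrite eq_le gr0 gr1.
    by rewrite mul0r !mulr_ge0 ?powR_ge0 ?expR_ge0// indicE ler0n.
  have [hb lb] := supp j _ X0 LL.
  rewrite indicE mem_set ?mulr1; last exact: cubeT_hP.
  move=> gr1; apply: ler_pM => //; last exact: (WK _ lb).1.
  apply: le_trans gr1 _; apply: ler_pM; rewrite ?powR_ge0 ?expR_ge0//.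
    by apply: ge0_ler_powR; rewrite ?nnegrE// ltW.
  by rewrite ler_expR !mulNr lerN2 ler_pM2l//; case/andP: LL.
- move=> t /contrapT X0; rewrite /gA /h1.
  have -> : psip gamma p (emb t) * (`|df (ln (rho (emb t)))| `^ p * expR (- p * ln (rho (emb t))) * W1 (ln (rho (emb t)))) =
    (`|df (ln (rho (emb t)))| `^ p * (psip gamma p (emb t) * expR (- p * ln (rho (emb t))))) * w1 (emb t).
    rewrite w1E//; move: (W1 _) (psip _ _ _) (expR _) (_ `^ p) => *; ring.
  by apply: cvgM; [exact: cvg_grad_comp|exact: cvg_cst].
have [||c2 fin2] := @dct_bounded R _ Tm mu (~` @Xne0 R n k) (cubeT M)
  (fun j t => `|u j (emb t)| `^ p * w2 (emb t)) gB (Kf `^ p * K) mN N0 mB Bfin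
  (fun j => measurable_funM (muj j) mw2) mgB.
- move=> j t /contrapT X0; rewrite mulr_ge0 ?powR_ge0 ?w20//= w2E//.
  have [LL|/f0 h] := boolP (a <= Le (e j) (emb t) <= b); last first.
    rewrite /u /= h normr0 powR0 ?gt_eqF// mul0r.
    by rewrite !mulr_ge0 ?powR_ge0// indicE ler0n.
  have [hb lb] := supp j _ X0 LL.
  rewrite indicE mem_set ?mulr1; last exact: cubeT_hP.
  apply: ler_pM; rewrite ?powR_ge0//; first by apply: mulr_ge0; [exact: psip_ge0|exact: W20].
    by apply: ge0_ler_powR; rewrite ?nnegrE// ?(ltW p0)//; exact: fK.
  rewrite -[leRHS]mul1r; apply: ler_pM; [exact: psip_ge0|exact: W20|exact: psip_le1|exact: (WK _ lb).2].
- move=> t /contrapT X0; rewrite /gB /h2.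
  have -> : psip gamma p (emb t) * (`|f (ln (rho (emb t)))| `^ p * W2 (ln (rho (emb t)))) =
    `|f (ln (rho (emb t)))| `^ p * w2 (emb t).
    rewrite w2E//; move: (W2 _) (psip _ _ _) (_ `^ p) => *; ring.
  apply: cvgM; last exact: cvg_cst.
  apply: (@cvg_comp _ _ _ (fun j => Le (e j) (emb t)) (fun y : R => `|f y| `^ p) _ (nbhs (ln (rho (emb t))))); first exact: cvg_Le.
  by apply: (@continuous_comp _ _ _ f (fun y : R => `|y| `^ p)); [exact: cf|exact: continuous_normpow].
have gE (g : R -> R) : measurable_fun setT g -> (forall r, 0 <= g r) ->
    (\int[mu]_t (psip gamma p (emb t) * g (ln (rho (emb t))))%:E =
     Mconst n k gamma p * \int[leb R]_r (expR (Q * r) * g r)%:E)%E.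
  move=> mg g0; have gm : measurable_fun setT (EFin \o g) by exact/measurable_EFinP.
  have := @iint_radial R n k gamma n1 gamma0 p (EFin \o g) gm (fun r => g0 r).
  rewrite iintE.
  - by move=> ->.
  - by apply/measurable_EFinP; apply: measurable_funM => //; exact: (measurableT_comp mg).
  - by move=> xi; rewrite -EFinM lee_fin; apply: mulr_ge0; [exact: psip_ge0|exact: g0].
have E1 : (\int[mu]_t (gA t)%:E = Mconst n k gamma p * \int[leb R]_r (`|df r| `^ p * (expR ((Q - p) * r) * W1 r))%:E)%E.
  rewrite gE//; congr (_ * _)%E; apply: eq_integral => r _; congr EFin.
  rewrite /h1 mulrBl expRB mulNr expRN; move: (expR _) (expR _)^-1 (_ `^ p) => *; ring.
have E2 : (\int[mu]_t (gB t)%:E = Mconst n k gamma p * \int[leb R]_r (`|f r| `^ p * (expR (Q * r) * W2 r))%:E)%E.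
  rewrite gE//; congr (_ * _)%E; apply: eq_integral => r _; congr EFin.
  by rewrite /h2 mulrCA.
have Mf : (Mconst n k gamma p \is a fin_num)%E by rewrite ge0_fin_numE ?(ltW (Mconst_gt0 p0))// Mconst_fin.
have c2' : (fun j => C%:E * \int[mu]_t (`|u j (emb t)| `^ p * w2 (emb t))%:E)%E @ \oo --> (C%:E * \int[mu]_t (gB t)%:E)%E.
  exact: cvgeZl.
have [|j jlt] := cvg_lt_near c1 c2'.
  by rewrite E1 E2 muleCA lte_pmul2l// Mconst_gt0.
exists (u j) => //; rewrite energyE//; last exact: (tu j).2.2.
rewrite !iintE//.
- by apply/measurable_EFinP; apply: measurable_funM.
- by move=> xi; rewrite lee_fin mulr_ge0 ?powR_ge0.
- by apply/measurable_EFinP; apply: measurable_funM.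
- by move=> xi; rewrite lee_fin mulr_ge0 ?powR_ge0.
Qed.
End Sharp.

(** * Almost extremal profiles *)

Section Profile.
Variable R : realType.

Lemma smooth_on1_derive (f : R -> R) : (forall N, smooth_on (@dir1 R) N setT f) ->
  (forall r : R, is_derive r 1 f ('D_1 f r)) /\ continuous ('D_1 f).
Proof.
move=> Sf; split=> r; first exact: (@smooth_on_is_derive _ _ _ (@dir1 R) 0 setT f tt r (Sf 1%N)).
exact: (((Sf 1%N).2.2 tt).1 r).
Qed.

Lemma derive_vanish (f : R -> R) (a b : R) : (forall r, ~~ (a <= r <= b) -> f r = 0) ->
  forall r, ~~ (a <= r <= b) -> 'D_1 f r = 0.
Proof.
move=> f0 r rab.
have H : \forall y \near r, cst (0 : R) y = f y.
  have [ra|br] : r < a \/ b < r.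
    move: rab; rewrite negb_and -!ltNge => /orP[]; by [left|right].
  - near=> y; rewrite f0// negb_and -!ltNge; apply/orP; left; near: y; exact: lt_nbhsl.
  - near=> y; rewrite f0// negb_and -!ltNge; apply/orP; right; near: y; exact: lt_nbhsr.
by have [_ ->] := near_eq_is_derive H (is_derive_cst (0 : R) r (1 : R)).
Unshelve. all: by end_near. Qed.

(** Supported in [-2, -1] rather than around 0, so that the support [-2 T, - T] of its stretched
    copies recedes to -oo: towards the origin for q = ln rho, towards rho = Rad for q = ln (ln (Rad
    / rho)). *)
Definition bump (s : R) : R := flat 1 (s + 2) * flat 1 (- 1 - s).

Lemma smooth_on_affine N (c d : R) : smooth_on (@dir1 R) N setT (fun x => c * x + d).
Proof.
apply: smooth_on_add; [exact: openT| |apply: smooth_on_cst; exact: openT].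
apply: smooth_on_mul; [exact: openT|apply: smooth_on_cst; exact: openT|apply: smooth_on_id; exact: openT].
Qed.

Lemma smooth_on_comp_affine N (g : R -> R) (c d : R) : smooth_on (@dir1 R) N setT g ->
  smooth_on (@dir1 R) N setT (fun x => g (c * x + d)).
Proof.
move=> Sg; apply: (@smooth_on_comp _ _ _ _ N setT setT (fun x : R => c * x + d) g) => //; try exact: openT.
exact: smooth_on_affine.
Qed.

Lemma smooth_on_bump N : smooth_on (@dir1 R) N setT bump.
Proof.
apply: smooth_on_mul; first exact: openT.
  by have := smooth_on_comp_affine 1 2 (@smooth_on_flat R N 1); under eq_fun do rewrite mul1r.
by have := smooth_on_comp_affine (- 1) (- 1) (@smooth_on_flat R N 1); under eq_fun do rewrite mulN1r addrC//.
Qed.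

Lemma bump0 s : ~~ (- 2 <= s <= - 1) -> bump s = 0.
Proof.
rewrite negb_and -!ltNge => /orP[h|h]; rewrite /bump.
  by rewrite [flat 1 (s + 2)]flat_le0 ?mul0r//; lra.
by rewrite [flat 1 (- 1 - s)]flat_le0 ?mulr0//; lra.
Qed.

Lemma bump_ge0 s : 0 <= bump s.
Proof.
by rewrite /bump mulr_ge0// /flat; case: ifP => // _; rewrite mulr_ge0 ?expR_ge0// hornerC.
Qed.

Lemma bump_ge s : - (7 / 4) <= s <= - (5 / 4) -> expR (- 8) <= bump s.
Proof.
move=> /andP[h1 h2].
have F x : 1 / 4 <= x -> expR (- 4) <= flat 1 x :> R.
  move=> hx; rewrite /flat; have -> : 0 < x by lra.
  rewrite hornerC mul1r ler_expR lerN2 -[leRHS]invrK lef_pV2 ?posrE; lra.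
rewrite (_ : - 8 = - 4 + - 4); last by ring.
by rewrite expRD /bump; apply: ler_pM; rewrite ?expR_ge0//; apply: F; lra.
Qed.

Local Notation dbump := ('D_1 bump).

Lemma leb_itv_fin (a b : R) : (leb R `[a, b]%classic < +oo)%E.
Proof. by rewrite -[leb R _]/(@lebesgue_measure R `[a, b]%classic) lebesgue_measure_itv /=; case: ifP => _; rewrite ?ltry// -EFinB ltry. Qed.

Lemma bump_integral (p : R) : 0 < p ->
  ((\int[leb R]_x (`|bump x| `^ p)%:E)%E \is a fin_num /\ 0 < \int[leb R]_x (`|bump x| `^ p)%:E)%E.
Proof.
move=> p0; have [Db _] := smooth_on1_derive smooth_on_bump.
have cb : continuous bump by move=> r; exact: is_derive_continuous (Db r).
have [K K0 bK] : exists2 K, 0 <= K & forall r, `|bump r| <= K.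
  by apply: (@bounded_of_vanish R bump (-2) (-1)) => //; [lra|exact: bump0].
have mb : measurable_fun setT (fun x => `|bump x| `^ p).
  apply: (measurableT_comp (measurable_powR _)); apply: measurableT_comp => //; exact: continuous_measurable_fun.
split.
  (* A constant sequence is used, for the sake of the integrability conclusion. *)
  have [||_] := @dct_bounded R _ _ (leb R) set0 `[- 2, - 1]%classic (fun _ x => `|bump x| `^ p) (fun x => `|bump x| `^ p) (K `^ p)
    measurable0 (measure0 _) (measurable_itv _) (leb_itv_fin _ _) (fun _ => mb) mb.
  - move=> _ t _; rewrite powR_ge0 /= indicE; have [h|/bump0 ->] := boolP (- 2 <= t <= - 1).
      by rewrite mem_set/= ?in_itv//= mulr1; apply: ge0_ler_powR; rewrite ?nnegrE// ltW.
    by rewrite normr0 powR0 ?gt_eqF// mulr_ge0 ?powR_ge0// ler0n.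
  - by move=> t _; exact: cvg_cst.
  - by [].
pose c : R := expR (- 8) `^ p.
have c0 : 0 < c by rewrite powR_gt0 ?expR_gt0.
apply: (@lt_le_trans _ _ (\int[leb R]_x (c * \1_(`[- (7 / 4), - (5 / 4)]%classic) x)%:E)%E).
  under eq_integral do rewrite EFinM.
  rewrite ge0_integralZl//; last 2 first.
  - by apply/measurable_EFinP; apply: measurable_indic.
  - by rewrite lee_fin ltW.
  rewrite integral_indic// setIT mule_gt0 ?lte_fin//.
  have H : (0 < leb R `[(- (7 / 4))%R, (- (5 / 4))%R]%classic)%E.
    rewrite -[leb R _]/(@lebesgue_measure R `[(- (7 / 4))%R, (- (5 / 4))%R]%classic) lebesgue_measure_itv /= lte_fin ifT; last by lra.
    rewrite -EFinB lte_fin; lra.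
  exact: H.
apply: ge0_le_integral => //.
- by move=> x _; rewrite lee_fin mulr_ge0 ?(ltW c0)// indicE ler0n.
- by apply/measurable_EFinP; apply: measurable_funM => //; exact: measurable_indic.
- exact/measurable_EFinP.
move=> x _; rewrite lee_fin indicE; have [h|h] := boolP (x \in _); last by rewrite mulr0 powR_ge0.
rewrite mulr1 /c; apply: ge0_ler_powR; rewrite ?nnegrE ?expR_ge0 ?(ltW p0)// ger0_norm ?bump_ge0//.
by apply: bump_ge; move: h; rewrite inE /= in_itv.
Qed.

(** After q = T x both integrals gain the same factor T, and the derivative of the cutoff is divided
    by T. As T grows, the left integral tends to |b|^p times the integral of |bump|^p, which is
    strictly below C times it. [J] lets the support be pushed as far out as needed. *)
Lemma bump_profile (p b C J : R) : 0 < p -> `|b| `^ p < C -> exists T, [/\ 0 < T, J <= T &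
  (\int[leb R]_q (`|b * bump (q / T) + dbump (q / T) / T| `^ p)%:E <
   C%:E * \int[leb R]_q (`|bump (q / T)| `^ p)%:E)%E].
Proof.
move=> p0 bC; have [Db cdb] := smooth_on1_derive smooth_on_bump.
have cb : continuous bump by move=> r; exact: is_derive_continuous (Db r).
have db0 := derive_vanish bump0.
have [K K0 bK] : exists2 K, 0 <= K & forall r, `|bump r| <= K.
  by apply: (@bounded_of_vanish R bump (-2) (-1)) => //; [lra|exact: bump0].
have [K' K'0 dbK] : exists2 K, 0 <= K & forall r, `|dbump r| <= K.
  by apply: (@bounded_of_vanish R dbump (-2) (-1)) => //; lra.
have [Ifin I0] := bump_integral p0.
pose T j : R := `|J| + j.+1%:R.
have T0 j : 0 < T j by rewrite ltr_wpDl.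
have T1 j : 1 <= T j by rewrite ler_wpDl// ler1n.
have mn (g : R -> R) : continuous g -> measurable_fun setT (fun x => `|g x| `^ p).
  move=> cg; apply: (measurableT_comp (measurable_powR _)); apply: measurableT_comp => //.
  exact: continuous_measurable_fun.
have cj j : continuous (fun x => b * bump x + dbump x / T j).
  move=> x; apply: cvgD; first by apply: cvgM; [exact: cvg_cst|exact: cb].
  by apply: cvgM; [exact: cdb|exact: cvg_cst].
have mj j := mn _ (cj j).
have cbb : continuous (fun x => b * bump x) by move=> x; apply: cvgM; [exact: cvg_cst|exact: cb].
have Tinv : (fun j => (T j)^-1) @ \oo --> (0 : R).
  apply/cvgrPdist_le => e e0; near=> j; rewrite sub0r normrN normfV gtr0_norm// invf_ple ?posrE//.
  apply: (@le_trans _ _ j%:R); first by near: j; exact: near_nat_ge.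
  by apply: ler_wpDl => //; rewrite ler_nat.
have cT (t : R) : (fun j => b * bump t + dbump t / T j) @ \oo --> b * bump t.
  have := cvgD (cvg_cst (b * bump t)) (cvgM (cvg_cst (dbump t)) Tinv); rewrite mulr0 addr0; exact.
have bnd j (t : R) : `|b * bump t + dbump t / T j| <= `|b| * K + K'.
  apply: le_trans (ler_normD _ _) _; apply: lerD; first by rewrite normrM; apply: ler_wpM2l.
  rewrite normrM normfV (gtr0_norm (T0 j)) ler_pdivrMr//; apply: le_trans (dbK t) _.
  by rewrite ler_peMr.
have [||c1 _] := @dct_bounded R _ _ (leb R) set0 `[- 2, - 1]%classic (fun j x => `|b * bump x + dbump x / T j| `^ p)
  (fun x => `|b * bump x| `^ p) ((`|b| * K + K') `^ p) measurable0 (measure0 _) (measurable_itv _) (leb_itv_fin _ _) mj (mn _ cbb).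
- move=> j t _; rewrite powR_ge0 /= indicE; have [h|h] := boolP (- 2 <= t <= - 1).
    rewrite mem_set/= ?in_itv//= mulr1; apply: ge0_ler_powR; rewrite ?nnegrE ?addr_ge0 ?mulr_ge0 ?(ltW p0)//.
  by rewrite bump0// db0// mulr0 mul0r addr0 normr0 powR0 ?gt_eqF// mulr_ge0 ?powR_ge0// ler0n.
- move=> t _; apply: (@cvg_comp _ _ _ (fun j => b * bump t + dbump t / T j) (fun y : R => `|y| `^ p) _ (nbhs (b * bump t))).
    exact: cT.
  exact: continuous_normpow.
have E1 : (\int[leb R]_x (`|(b * bump x)%R| `^ p)%:E = (`|b| `^ p)%:E * \int[leb R]_x (`|bump x| `^ p)%:E)%E.
  rewrite -ge0_integralZl//.
  - by apply: eq_integral => x _; rewrite normrM powRM// EFinM.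
  - by apply/measurable_EFinP; exact: mn.
have [|j jlt] := cvg_lt_near c1 (cvg_cst (C%:E * \int[leb R]_x (`|bump x| `^ p)%:E)%E).
  by rewrite E1 lte_pmul2r.
have TJ : J <= T j by apply: le_trans (ler_norm J) _; rewrite lerDl.
move: (T j) (T0 j) TJ jlt (mj j) => S S0 JS jlt mS; exists S; split; [exact: S0|exact: JS|].
have mdiv : measurable_fun setT (fun q : R => q / S) by exact: measurable_funM.
rewrite (@leb_affine R S 0 (fun q => (`|b * bump (q / S) + dbump (q / S) / S| `^ p)%:E)); last first.
- by move=> x; rewrite lee_fin powR_ge0.
- by apply/measurable_EFinP; exact: (measurableT_comp mS mdiv).
- exact: S0.
rewrite (@leb_affine R S 0 (fun q => (`|bump (q / S)| `^ p)%:E)); last first.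
- by move=> x; rewrite lee_fin powR_ge0.
- by apply/measurable_EFinP; exact: (measurableT_comp (mn _ cb) mdiv).
- exact: S0.
have SE x : (S * x + 0) / S = x by rewrite addr0 [S * x]mulrC mulfK// gt_eqF.
have -> : (\int[leb R]_x (`|b * bump ((S * x + 0) / S) + dbump ((S * x + 0) / S) / S| `^ p)%:E =
    \int[leb R]_x (`|b * bump x + dbump x / S| `^ p)%:E)%E by apply: eq_integral => x _; rewrite SE.
have -> : (\int[leb R]_x (`|bump ((S * x + 0) / S)| `^ p)%:E = \int[leb R]_x (`|bump x| `^ p)%:E)%E.
  by apply: eq_integral => x _; rewrite SE.
have S0e : (0 < S%:E)%E by rewrite lte_fin.
have Sf : S%:E \is a fin_num by [].
by rewrite muleCA (lte_pmul2l Sf S0e); exact: jlt.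
Unshelve. all: by end_near. Qed.

(** Substitution r = T - e^q, which reverses orientation and satisfies - dr / (T - r) = dq. The cut
    at r < T discards the points where [ln (T - r)] is only a convention. *)
Lemma integral_ln_subst (G : R -> R) (T u v : R) : u <= v -> continuous G -> (forall q, 0 <= G q) ->
  (forall q, ~~ (u <= q <= v) -> G q = 0) ->
  (\int[leb R]_r (if (r < T)%R then (G (ln (T - r)) / (T - r))%R else 0%R)%:E = \int[leb R]_q (G q)%:E)%E.
Proof.
move=> uv cG G0 Gv.
pose F (q : R) := T - expR q.
pose H (r : R) := G (ln (T - r)) / (T - r).
have DF (q : R) : is_derive q 1 F (- expR q).
  by have := is_deriveB (is_derive_cst T q (1 : R)) (is_derive_expR q); rewrite sub0r.
have dF : F^`()%classic = (fun q => - expR q) by apply/funext => q; rewrite derive1E; case: (DF q).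
have cdF : continuous F^`()%classic by rewrite dF => q; apply: cvgN; exact: continuous_expR.
have cF : continuous F by move=> q; exact: is_derive_continuous (DF q).
have Fuv : F v <= F u by rewrite lerD2l lerN2 ler_expR.
have FT q : F q < T by rewrite ltrBlDr ltrDl expR_gt0.
transitivity (\int[leb R]_(r in `[F v, F u]) (H r)%:E)%E.
  rewrite [RHS]integral_mkcond; apply: eq_integral => r _; rewrite patchE.
  have [|h] := boolP (r \in _).
    by rewrite inE /= in_itv /= => /andP[_ h]; rewrite (le_lt_trans h (FT u)).
  case: ifPn => // rT; rewrite Gv ?mul0r//; apply: contra h => /andP[h1 h2].
  have t0 : 0 < T - r by rewrite subr_gt0.
  rewrite inE /= in_itv /= /F; move: h1 h2; rewrite -ler_expR -(ler_expR _ v) lnK ?posrE// => h1 h2.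
  by apply/andP; split; lra.
rewrite [RHS](_ : _ = \int[leb R]_(q in `[u, v]) (G q)%:E)%E; last first.
  rewrite [RHS]integral_mkcond; apply: eq_integral => q _; rewrite patchE.
  by case: ifPn => // h; rewrite Gv//; apply: contra h => h; rewrite inE /= in_itv.
rewrite (@integration_by_substitution_decreasing R F H u v uv).
- apply: eq_integral => q _; congr EFin; change (H (F q) * - (F^`()%classic q) = G q).
  have tE : T - F q = expR q by rewrite /F subKr.
  rewrite dF /H tE opprK expRK.
  by rewrite divfK// gt_eqF ?expR_gt0.
- by move=> x y _ _ xy; rewrite /F ltrD2l ltrN2 ltr_expR.
- by move=> x _; exact: cdF.
- by apply: cvgP; apply: cvg_at_right_filter; exact: cdF.
- by apply: cvgP; apply: cvg_at_left_filter; exact: cdF.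
- split.
  + by move=> x _; case: (DF x).
  + by apply: cvg_at_right_filter; exact: cF.
  + by apply: cvg_at_left_filter; exact: cF.
- apply: continuous_in_subspaceT => r; rewrite inE /= in_itv /= => /andP[_ h].
  have t0 : 0 < T - r by rewrite subr_gt0 (le_lt_trans h (FT u)).
  have ct : (fun r : R => T - r) @ r --> T - r by apply: cvgB; [exact: cvg_cst|exact: cvg_id].
  apply: cvgM; last by apply: cvgV => //; rewrite gt_eqF.
  apply: (@cvg_comp _ _ _ (fun r => ln (T - r)) G _ (nbhs (ln (T - r)))); last exact: cG.
  by apply: (@cvg_comp _ _ _ (fun r => T - r) (@ln R) _ (nbhs (T - r))); [exact: ct|exact: continuous_ln].
Qed.
End Profile.

(** * Sharpness *)

Section Optimal.
Variables (R : realType) (n k : nat) (gamma : R).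
Hypothesis (n1 : (1 <= n)%N) (gamma0 : 0 <= gamma).
Local Notation pt := 'rV[R]_(n + k).
Local Notation X xi := (eunorm (@xpart R n k xi)).
Local Notation rho := (@hnorm R n k gamma).
Local Notation Q := (Qdim n k gamma).
Local Notation kap := (2 + 2 * gamma).
Local Notation dbump := ('D_1 (@bump R)).

Let kap0 : 0 < kap. Proof. by move: gamma0; lra. Qed.

Lemma iint0 : iint (fun _ : pt => 0%E) = 0%E :> \bar R.
Proof. by rewrite iintE; [exact: integral0|exact: measurable_cst|]. Qed.

Lemma iint_ge0 (f : pt -> \bar R) : (forall xi, 0 <= f xi)%E -> (0 <= iint f)%E.
Proof. by move=> f0; apply: iint_seq_ge0 => s. Qed.

Lemma energy_ge0 (p : R) (Omega : set pt) (w f : pt -> R) : (forall xi, 0 <= w xi) ->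
  (0 <= energy gamma p Omega w f)%E.
Proof.
by move=> w0; apply: iint_ge0 => xi; case: ifP => // _; rewrite lee_fin mulr_ge0 ?powR_ge0.
Qed.

Lemma inD_cst (p : R) (Omega : set pt) (w u : pt -> R) : 0 < p -> testfun Omega u ->
  inD gamma p Omega w u (fun _ => u).
Proof.
move=> p0 tu; split=> //; split.
  move=> e e0; exists 0%N => _ _ _ _; rewrite /energy /iint_on.
  rewrite (_ : (fun xi : pt => _) = (fun _ : pt => 0%E)); first by rewrite iint0 lte_fin.
  apply/funext => xi; case: ifP => // _; congr EFin.
  have -> : (fun xi => u xi - u xi) = cst (0 : R) by apply/funext => x; rewrite subrr.
  have d0 i : partial i (cst (0 : R) : pt -> R) xi = 0 by rewrite /partial derive_cst.
  rewrite /grad_gamma_p !big1 => [|i _|i _]; rewrite ?d0 ?expr0n//.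
  by rewrite mulr0 addr0 powR0 ?mul0r// gt_eqF// divr_gt0.
exists set0; split; last by move=> xi _ _; exact: cvg_cst.
move=> e e0; exists (fun _ => 0), (fun _ => 0); split; first by [].
split; first by move=> x [].
rewrite eseries0 ?lee_fin ?ltW// => j _ _.
(* Since n >= 1 there is a coordinate, so the boxes reduced to a point have a zero side; an empty
   product would give volume 1. *)
have i0 : 'I_(n + k) by case: n n1 => // m _; rewrite addSn; exact: ord0.
by rewrite (bigD1 i0)//= subrr mul0r.
Qed.

Lemma hnorm_hP_lt (xi : pt) (b : R) : hP gamma xi <= expR (kap * b) -> rho xi <= expR b.
Proof.
move=> h; rewrite hnormE.
have -> : expR b = expR (kap * b) `^ (1 / kap) by rewrite expR_powR; congr expR; field; rewrite gt_eqF.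
by apply: ge0_ler_powR; rewrite ?nnegrE ?hP_ge0 ?expR_ge0// divr_ge0// ltW.
Qed.

Lemma hP0 : hP gamma (0 : pt) = 0.
Proof.
rewrite -Pe0 /Pe /Sx /Sy !big1 => [|i _|i _]; rewrite ?mxE ?expr0n//.
by rewrite addr0 powR0 ?add0r ?mulr0// gt_eqF// ltr_pwDl.
Qed.

(** For T >= 4 / d both e^(-T) and e^(-(1 + gamma) T) are at most d / 4, using e^T >= T; they bound
    the coordinates of a point with hP <= e^(- kap T), whose norm is then below d. *)
Lemma punctured_nbhs (Omega : set pt) : nbhs (0 : pt) (Omega `|` [set 0]) ->
  exists J : R, forall T : R, J <= T -> forall xi, 0 < hP gamma xi -> hP gamma xi <= expR (kap * - T) -> Omega xi.
Proof.
move=> /nbhs_normP [d /= d0 Hd]; exists (Num.max 0 (4 / d)) => T; rewrite ge_max => /andP[T0 Td] xi h0 hT.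
have [//|/= x0] : (Omega `|` [set 0]) xi; last by move: h0; rewrite x0 hP0 ltxx.
apply: Hd; rewrite /= sub0r normrN.
have eT : expR (- T) <= d / 4.
  rewrite expRN -[leRHS]invf_div lef_pV2 ?posrE ?expR_gt0 ?divr_gt0//.
  by apply: le_trans Td _; apply: le_trans (expR_ge1Dx T); rewrite lerDr.
have eT' : expR ((1 + gamma) * - T) <= d / 4.
  apply: le_trans eT; rewrite ler_expR mulrN lerN2 ler_peMl// lerDl//.
apply: (@le_lt_trans _ _ (d / 2)); last by lra.
apply: rV_norm_le => [|i]; first by lra.
apply: le_trans (coord_le_hP gamma0 i hT) _; lra.
Qed.

Lemma sharp_power (be p C : R) (Omega : set pt) : 1 < p -> (`|Q + be| / p) `^ p < C ->
  nbhs (0 : pt) (Omega `|` [set 0]) ->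
  exists2 u, testfun Omega u & (energy gamma p Omega (fun xi => rho xi `^ (p + be))%R u <
    C%:E * iint (fun xi => (`|u xi| `^ p * (psip gamma p xi * rho xi `^ be))%:E))%E.
Proof.
move=> p1 cC nb; have p0 : 0 < p by exact: lt_trans p1.
have C0 : 0 < C by apply: le_lt_trans cC; exact: powR_ge0.
have [J HJ] := punctured_nbhs nb.
(* The formal extremal is e^(b r) = rho^b: with this exponent |f|^p e^((Q + be) r) is exactly |bump
   (r / T)|^p. Differentiating produces b bump + dbump / T, so both sides become the integrals of
   [bump_profile]. *)
pose b := - ((Q + be) / p).
have bC : `|b| `^ p < C by rewrite /b normrN normrM normfV (gtr0_norm p0).
have [T [T0 JT prof]] := bump_profile J p0 bC.
have [Db cdb] := smooth_on1_derive (@smooth_on_bump R).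
pose f (r : R) : R := expR (b * r + 0) * bump (T^-1 * r + 0).
have Sf N : smooth_on (@dir1 R) N setT f.
  apply: smooth_on_mul; first exact: openT.
    exact: (smooth_on_comp_affine b 0 (@smooth_on_expR R N)).
  exact: (smooth_on_comp_affine T^-1 0 (@smooth_on_bump R N)).
have [Df cdf] := smooth_on1_derive Sf.
have fE r : f r = expR (b * r) * bump (r / T) by rewrite /f !addr0 [T^-1 * r]mulrC.
have dfE r : 'D_1 f r = expR (b * r) * (b * bump (r / T) + dbump (r / T) / T).
  have Dl (c : R) : is_derive r 1 (fun s : R => c * s + 0) c.
    have := is_deriveD (is_deriveZ c (is_derive_id r (1 : R))) (is_derive_cst (0 : R) r (1 : R)).
    by rewrite (_ : c *: (1 : R) + 0 = c); [exact|rewrite addr0 [LHS]mulr1].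
  have D1 := @is_derive1_comp R expR _ r _ _ (is_derive_expR (b * r + 0)) (Dl b).
  have D2 := @is_derive1_comp R (@bump R) _ r _ _ (Db (T^-1 * r + 0)) (Dl T^-1).
  have [_] := is_deriveM D1 D2.
  rewrite [LHS](_ : _ = 'D_1 f r)// => ->; rewrite /GRing.scale /= !addr0 [T^-1 * r]mulrC.
  by move: (expR _) (bump _) (dbump _) => *; ring.
have f0 r : ~~ (- 2 * T <= r <= - T) -> f r = 0.
  move=> h; rewrite fE bump0 ?mulr0//; apply: contra h.
  by rewrite ler_pdivlMr// ler_pdivrMr// mulN1r.
have df0 := derive_vanish f0.
pose M := 2 * T + 1.
(* One bound serves the two exponents p + be and be at once; for these the right alternative is
   void. The constant M = 2 T + 1 is the largest |r| on [-2 T - 1, - T]. *)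
have bnd (c r : R) : - 2 * T - 1 <= r <= - T -> expR (c * r) <= expR (`|p + be| * M) + expR (`|be| * M) \/ (c != p + be /\ c != be).
  move=> h; have rM : `|r| <= M by clear -h T0; rewrite ler_norml /M; lra.
  have F (a : R) : expR (a * r) <= expR (`|a| * M).
    rewrite ler_expR; apply: le_trans (ler_norm _) _; rewrite normrM; exact: ler_wpM2l.
  have [->|c1] := eqVneq c (p + be); first by left; apply: le_trans (F _) _; rewrite lerDl expR_ge0.
  have [->|c2] := eqVneq c be; first by left; apply: le_trans (F _) _; rewrite lerDr expR_ge0.
  by right.
apply: (@sharp_radial R n k gamma n1 gamma0 p C (expR (`|p + be| * M) + expR (`|be| * M)) (- 2 * T) (- T) Omega _ _ f ('D_1 f)
  (fun r => expR ((p + be) * r)) (fun r => expR (be * r))) => //.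
- by lra.
- exact: measurable_expMr.
- exact: measurable_expMr.
- move=> r h; have [H1|[/eqP//]] := bnd (p + be) r h; have [H2|[_ /eqP//]] := bnd be r h; by split.
- exact: measurable_hpow.
- by apply: measurable_funM; [exact: measurable_psip|exact: measurable_hpow].
- by move=> xi; exact: powR_ge0.
- by move=> xi; apply: mulr_ge0; [exact: psip_ge0|exact: powR_ge0].
- by move=> xi X0; rewrite hnorm_powR.
- by move=> xi X0; rewrite hnorm_powR.
- move=> xi /andP[h1 h2]; apply: (HJ T) => //; exact: lt_le_trans (expR_gt0 _) h1.
have E1 r : `|'D_1 f r| `^ p * (expR ((Q - p) * r) * expR ((p + be) * r)) = `|b * bump (r / T) + dbump (r / T) / T| `^ p.
  rewrite dfE normrM powRM// (ger0_norm (expR_ge0 _)) expR_powR -expRD mulrAC -expRD.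
  rewrite (_ : b * r * p + _ = 0) ?expR0 ?mul1r//; rewrite /b; move: Q => q; field; rewrite gt_eqF//.
have E2 r : `|f r| `^ p * (expR (Q * r) * expR (be * r)) = `|bump (r / T)| `^ p.
  rewrite fE normrM powRM// (ger0_norm (expR_ge0 _)) expR_powR -expRD mulrAC -expRD.
  rewrite (_ : b * r * p + _ = 0) ?expR0 ?mul1r//; rewrite /b; move: Q => q; field; rewrite gt_eqF//.
under eq_integral do rewrite E1.
by under [V in (_ < _ * V)%E]eq_integral do rewrite E2.
Qed.

Lemma sharp_log (be p Rad C : R) : p = Q -> 1 < p -> 0 < Rad -> be < -1 -> (`|be + 1| / p) `^ p < C ->
  let Omega := [set xi : pt | rho xi < Rad] in
  exists2 u, testfun Omega u & (energy gamma p Omega (fun xi => ln (Rad / rho xi) `^ (p + be))%R u <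
    C%:E * iint (fun xi => (`|u xi| `^ p * (psip gamma p xi / rho xi `^ p * ln (Rad / rho xi) `^ be))%:E))%E.
Proof.
move=> pQ p1 R0 be1 cC Omega; have p0 : 0 < p by exact: lt_trans p1.
have C0 : 0 < C by apply: le_lt_trans cC; exact: powR_ge0.
(* The formal extremal is ln (Rad / rho)^b. In the variable q = ln (L - r), with L = ln Rad, it is
   e^(b q), and the power case is repeated in q. *)
pose b := - ((be + 1) / p).
have bC : `|b| `^ p < C by rewrite /b normrN normrM normfV (gtr0_norm p0).
have [T [T0 _ prof]] := bump_profile 0 p0 bC.
have [Db cdb] := smooth_on1_derive (@smooth_on_bump R).
have cb : continuous (@bump R) by move=> r; exact: is_derive_continuous (Db r).
pose L := ln Rad.
pose g (t : R) : R := t `^ b * bump (T^-1 * ln t + 0).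
pose f (r : R) : R := if r < L then g (L - r) else 0.
(* These endpoints correspond to q = - T and q = - 2 T, exchanged because q decreases in r; both lie
   below L, so the support avoids rho = Rad. *)
pose lo := L - expR (- T); pose hi := L - expR (- 2 * T).
have T2 : - 2 * T < - T by lra.
have lohi : lo < hi by rewrite ltrD2l ltrN2 ltr_expR.
have hiL : hi < L by rewrite ltrBlDr ltrDl expR_gt0.
have lnP r : r < L -> expR (ln (L - r)) = L - r by move=> h; rewrite lnK// posrE subr_gt0.
have f0 r : ~~ (lo <= r <= hi) -> f r = 0.
  move=> h; rewrite /f; case: ifPn => // rL; rewrite /g bump0 ?mulr0//; apply: contra h.
  rewrite addr0 mulrC ler_pdivlMr// ler_pdivrMr// mulN1r => /andP[].
  rewrite -ler_expR -(ler_expR _ (- T)) lnP// /lo /hi => h1 h2; apply/andP; split; lra.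
have oL : open [set r : R | r < L] by exact: open_lt.
have oH : open [set r : R | hi < r] by exact: open_gt.
(* The case distinction at L is smooth because [f] already vanishes for r > hi, and hi < L: the open
   sets r < L and r > hi cover the line, and smoothness is checked on each. *)
have Sf N : smooth_on (@dir1 R) N setT f.
  rewrite (_ : setT = [set r : R | r < L] `|` [set r : R | hi < r]); last first.
    apply/seteqP; split=> // r _ /=; have [rL|Lr] := ltP r L; first by left.
    by right; exact: lt_le_trans Lr.
  apply: smooth_on_union; last first.
    apply: (@smooth_on_eq _ _ _ _ _ _ (cst 0)) => //; last exact: smooth_on_cst.
    by move=> r /= hr; rewrite f0// negb_and -!ltNge hr orbT.
  apply: (@smooth_on_eq _ _ _ _ _ _ (g \o (fun r => (- 1) * r + L))) => //.
    by move=> r /= rL; rewrite /f rL mulN1r addrC.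
  apply: (@smooth_on_comp _ _ _ _ N _ `]0, +oo[%classic (fun r : R => - 1 * r + L) g) => //.
  - by move=> r /= rL; rewrite in_itv /= andbT mulN1r; lra.
  - apply: smooth_on_add => //; [|exact: smooth_on_cst].
    by apply: smooth_on_mul => //; [exact: smooth_on_cst|exact: smooth_on_id].
  apply: smooth_on_mul; [exact: interval_open|exact: smooth_on_powR|].
  apply: (@smooth_on_comp _ _ _ _ N _ setT (@ln R) (fun x => bump (T^-1 * x + 0))) => //.
  - exact: openT.
  - exact: smooth_on_ln.
  - exact: (smooth_on_comp_affine T^-1 0 (@smooth_on_bump R N)).
have [Df cdf] := smooth_on1_derive Sf.
have df0 := derive_vanish f0.
have dfE r : r < L -> 'D_1 f r =
    - ((L - r) `^ (b - 1) * (b * bump (ln (L - r) / T) + dbump (ln (L - r) / T) / T)).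
  move=> rL; have t0 : 0 < L - r by rewrite subr_gt0.
  have H : \forall y \near r, (g \o (fun r => L - r)) y = f y.
    near=> y; have yL : y < L by near: y; exact: lt_nbhsl.
    by rewrite /f yL.
  have Dt : is_derive r 1 (fun s : R => L - s) (- 1).
    by have := is_deriveB (is_derive_cst L r (1 : R)) (is_derive_id r (1 : R)); rewrite sub0r.
  have Dl (x : R) : is_derive x 1 (fun s : R => T^-1 * s + 0) T^-1.
    have := is_deriveD (is_deriveZ T^-1 (is_derive_id x (1 : R))) (is_derive_cst (0 : R) x (1 : R)).
    by rewrite (_ : T^-1 *: (1 : R) + 0 = T^-1); [exact|rewrite addr0 [LHS]mulr1].
  have D1 := is_derive1_powR b t0.
  have D2 := @is_derive1_comp R _ _ _ _ _ (Dl (ln (L - r))) (is_derive1_ln t0).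
  have D3 := @is_derive1_comp R (@bump R) _ _ _ _ (Db _) D2.
  have D4 := @is_derive1_comp R g _ r _ _ (is_deriveM D1 D3) Dt.
  have [_ ->] := near_eq_is_derive H D4.
  rewrite /GRing.scale /= !addr0 [T^-1 * _]mulrC mulrN1.
  have -> : (L - r) `^ b = (L - r) `^ (b - 1) * (L - r).
    rewrite -{3}[L - r]powRr1 ?(ltW t0)// -powRD; first by rewrite subrK.
    by rewrite (gt_eqF t0) implybT.
  move: t0; move: (L - r) => t t0; move: (bump _) (dbump _) (t `^ _) => x y z.
  by field; rewrite !gt_eqF.
pose W1 (r : R) := (L - r) `^ (p + be).
pose W2 (r : R) := expR (- p * r) * (L - r) `^ be.
have mT (a : R) : measurable_fun setT (fun r : R => (L - r) `^ a).
  by apply: (measurableT_comp (measurable_powR _)); exact: measurable_funB.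
pose M := 2 * T + 1.
have e0 : expR (- T) <= 1 by rewrite -expR0 ler_expR oppr_le0 ltW.
have lnb r : lo - 1 <= r <= hi -> `|ln (L - r)| <= M.
  move=> /andP[h1 h2]; have rL : r < L by exact: le_lt_trans hiL.
  rewrite ler_norml; apply/andP; split; rewrite -ler_expR lnP//.
    apply: (@le_trans _ _ (expR (- 2 * T))); first by rewrite ler_expR /M; lra.
    by move: h2; rewrite /hi; lra.
  apply: (@le_trans _ _ (expR 1)); last by rewrite ler_expR /M; lra.
  have := expR_ge1Dx (1 : R); move: h1; rewrite /lo; lra.
have powb (a r : R) : lo - 1 <= r <= hi -> (L - r) `^ a <= expR (`|a| * M).
  move=> h; have rL : r < L by case/andP: h => _ h; exact: le_lt_trans hiL.
  rewrite -lnP// expR_powR ler_expR; apply: le_trans (ler_norm _) _; rewrite normrM mulrC.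
  by apply: ler_wpM2l => //; exact: lnb.
have expb r : lo - 1 <= r <= hi -> expR (- p * r) <= expR (p * (`|L| + 2)).
  move=> h; rewrite ler_expR mulNr -mulrN; apply: ler_wpM2l; first exact: ltW.
  have := ler_norm (- L); rewrite normrN; move: h; rewrite /lo; lra.
apply: (@sharp_radial R n k gamma n1 gamma0 p C (expR (`|p + be| * M) + expR (p * (`|L| + 2)) * expR (`|be| * M))
  lo hi Omega _ _ f ('D_1 f) W1 W2) => //.
- exact: ltW.
- exact: mT.
- by apply: measurable_funM; [exact: measurable_expMr|exact: mT].
- by move=> r; exact: powR_ge0.
- by move=> r; apply: mulr_ge0; [exact: expR_ge0|exact: powR_ge0].
- move=> r h; split.
    by apply: le_trans (powb _ _ h) _; rewrite lerDl mulr_ge0 ?expR_ge0.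
  apply: (@le_trans _ _ (expR (p * (`|L| + 2)) * expR (`|be| * M))); last by rewrite lerDr expR_ge0.
  by apply: ler_pM; [exact: expR_ge0|exact: powR_ge0|exact: expb|exact: powb].
- exact: measurable_ln_hnorm_powR.
- apply: measurable_funM; last exact: measurable_ln_hnorm_powR.
  apply: measurable_funM; first exact: measurable_psip.
  by under eq_fun do rewrite -powRN; exact: measurable_hpow.
- by move=> xi; exact: powR_ge0.
- move=> xi; apply: mulr_ge0; last exact: powR_ge0.
  by apply: mulr_ge0; [exact: psip_ge0|rewrite invr_ge0 powR_ge0].
- by move=> xi X0; rewrite (ln_div_hnorm gamma0).
- by move=> xi X0; rewrite (ln_div_hnorm gamma0)// -powRN hnorm_powR// /W2 mulrA.
- move=> xi /andP[_ h]; rewrite /Omega /=; apply: le_lt_trans (hnorm_hP_lt h) _.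
  by rewrite -[Rad]lnK ?posrE// ltr_expR.
pose G1 (q : R) := `|b * bump (q / T) + dbump (q / T) / T| `^ p.
pose G2 (q : R) := `|bump (q / T)| `^ p.
have cdiv : continuous (fun q : R => q / T) by move=> q; apply: cvgM; [exact: cvg_id|exact: cvg_cst].
have cbT : continuous (fun q : R => bump (q / T)).
  by move=> q; apply: (@continuous_comp _ _ _ (fun q : R => q / T) (@bump R)); [exact: cdiv|exact: cb].
have cdbT : continuous (fun q : R => dbump (q / T)).
  by move=> q; apply: (@continuous_comp _ _ _ (fun q : R => q / T) dbump); [exact: cdiv|exact: cdb].
have cG1 : continuous G1.
  move=> q; apply: (@continuous_comp _ _ _ (fun q : R => b * bump (q / T) + dbump (q / T) / T) (fun y => `|y| `^ p)).
    apply: cvgD; first by apply: cvgM; [exact: cvg_cst|exact: cbT].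
    by apply: cvgM; [exact: cdbT|exact: cvg_cst].
  exact: continuous_normpow.
have cG2 : continuous G2.
  move=> q; apply: (@continuous_comp _ _ _ (fun q : R => bump (q / T)) (fun y => `|y| `^ p)); first exact: cbT.
  exact: continuous_normpow.
have qT q : ~~ (- 2 * T <= q <= - T) -> ~~ (- 2 <= q / T <= - 1).
  by apply: contra; rewrite ler_pdivlMr// ler_pdivrMr// mulN1r.
have G10 q : ~~ (- 2 * T <= q <= - T) -> G1 q = 0.
  move=> /qT h; rewrite /G1 bump0// (derive_vanish (@bump0 R))// mulr0 mul0r addr0 normr0 powR0// gt_eqF//.
have G20 q : ~~ (- 2 * T <= q <= - T) -> G2 q = 0.
  by move=> /qT h; rewrite /G2 bump0// normr0 powR0// gt_eqF.
have out r : L <= r -> ~~ (lo <= r <= hi).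
  by move=> Lr; rewrite negb_and -!ltNge (lt_le_trans hiL Lr) orbT.
(* With this relation the powers of L - r on both sides combine to (L - r)^(-1), exactly the
   Jacobian of q = ln (L - r). *)
have bp1 : b * p + be = -1 by rewrite /b mulNr divfK ?gt_eqF//; ring.
have E1 r : `|'D_1 f r| `^ p * (expR ((Q - p) * r) * W1 r) = if r < L then G1 (ln (L - r)) / (L - r) else 0.
  rewrite -pQ subrr mul0r expR0 mul1r /W1; case: ifPn => [rL|]; last first.
    by rewrite -leNgt => /out /df0 ->; rewrite normr0 powR0 ?mul0r// gt_eqF.
  have t0 : 0 < L - r by rewrite subr_gt0.
  rewrite dfE// normrN normrM powRM// (ger0_norm (powR_ge0 _ _)) -/(G1 (ln (L - r))) -powRrM.
  rewrite mulrAC -powRD ?(gt_eqF t0) ?implybT// mulrC; congr (_ * _).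
  rewrite -[RHS]powR_inv1 ?(ltW t0)//; congr (_ `^ _); move: bp1; rewrite mulrBl mul1r; lra.
have E2 r : `|f r| `^ p * (expR (Q * r) * W2 r) = if r < L then G2 (ln (L - r)) / (L - r) else 0.
  rewrite -pQ /W2 [expR _ * (_ * _)]mulrA -expRD -mulrDl subrr mul0r expR0 mul1r /f; case: ifPn => [rL|_]; last first.
    by rewrite normr0 powR0 ?mul0r// gt_eqF.
  have t0 : 0 < L - r by rewrite subr_gt0.
  rewrite /g addr0 [T^-1 * _]mulrC normrM powRM// (ger0_norm (powR_ge0 _ _)) -/(G2 (ln (L - r))) -powRrM.
  rewrite mulrAC -powRD ?(gt_eqF t0) ?implybT// mulrC; congr (_ * _).
  by rewrite -[RHS]powR_inv1 ?(ltW t0)//; congr (_ `^ _).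
under eq_integral do rewrite E1.
under [V in (_ < _ * V)%E]eq_integral do rewrite E2.
rewrite (integral_ln_subst L (ltW T2) cG1 (fun q => powR_ge0 _ _) G10).
by rewrite (integral_ln_subst L (ltW T2) cG2 (fun q => powR_ge0 _ _) G20).
Unshelve. all: by end_near. Qed.
End Optimal.

(** * Matching the integrands of the theorem *)

Section Integrands.
Variables (R : realType) (n k : nat) (gamma : R).
Local Notation pt := 'rV[R]_(n + k).
Local Notation rho := (@hnorm R n k gamma).

Lemma iint_on_vanish (p : R) (Omega : set pt) (u : pt -> R) (W : pt -> R) : 0 < p ->
  (forall xi, ~ Omega xi -> u xi = 0) ->
  iint_on Omega (fun xi => (`|u xi| `^ p * W xi)%:E) = iint (fun xi => (`|u xi| `^ p * W xi)%:E).
Proof.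
move=> p0 u0; congr iint; apply/funext => xi; case: asboolP => // /u0 ->.
by rewrite normr0 powR0 ?gt_eqF// mul0r.
Qed.

Lemma lhs_powerE (p be : R) (u : pt -> R) (xi : pt) :
  `|u xi| `^ p * rho xi `^ be * eunorm (xpart xi) `^ (gamma * p) / rho xi `^ (gamma * p) =
  `|u xi| `^ p * (psip gamma p xi * rho xi `^ be).
Proof. by rewrite /psip; move: (_ `^ (gamma * p)) (_ `^ (gamma * p)) (_ `^ p) (_ `^ be) => *; ring. Qed.

Lemma lhs_logE (p be Rad : R) (u : pt -> R) (xi : pt) :
  `|u xi| `^ p / rho xi `^ p * ln (Rad / rho xi) `^ be * eunorm (xpart xi) `^ (gamma * p) / rho xi `^ (gamma * p) =
  `|u xi| `^ p * (psip gamma p xi / rho xi `^ p * ln (Rad / rho xi) `^ be).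
Proof.
by rewrite /psip; move: (_ `^ (gamma * p)) (_ `^ (gamma * p)) (`|u xi| `^ p) (rho xi `^ p) (ln _ `^ be) => *; ring.
Qed.

Lemma testfun_off (Omega : set pt) (u : pt -> R) : testfun Omega u -> forall xi, ~ Omega xi -> u xi = 0.
Proof. by move=> [_ [_ sO]] xi; apply: contra_notP => /eqP /support_nonzero /sO. Qed.
End Integrands.

Theorem mainTheorem9 (R : realType) (n k : nat) (gamma : R) :
  (1 <= n)%N -> (1 <= k)%N -> 0 <= gamma ->
  (* Part (1) *)
  (forall (beta p : R) (Omega : set 'rV[R]_(n + k)),
    1 < p -> open Omega -> (beta + Qdim n k gamma < 0 -> ~ Omega 0) ->
    let w := fun xi => hnorm gamma xi `^ (p + beta) in
    let c := (`|Qdim n k gamma + beta| / p) `^ p in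
    let lhs := fun u : 'rV[R]_(n + k) -> R =>
      iint_on Omega (fun xi => (`|u xi| `^ p * hnorm gamma xi `^ beta
        * eunorm (xpart xi) `^ (gamma * p) / hnorm gamma xi `^ (gamma * p))%:E) in
    (forall u phi (L : \bar R), inD gamma p Omega w u phi ->
       (fun j => energy gamma p Omega w (phi j)) @ \oo --> L ->
       (c%:E * lhs u <= L)%E) /\
    (nbhs (0 : 'rV[R]_(n + k)) (Omega `|` [set 0]) ->
      forall C : R, c < C -> exists u phi (L : \bar R), inD gamma p Omega w u phi /\
       (fun j => energy gamma p Omega w (phi j)) @ \oo --> L /\
       (L < C%:E * lhs u)%E)) /\
  (* Part (2) *)
  (forall (beta p Rad : R),
    p = Qdim n k gamma -> 1 < p -> 0 < Rad -> beta < -1 ->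
    let Omega := [set xi : 'rV[R]_(n + k) | hnorm gamma xi < Rad] in
    let w := fun xi => ln (Rad / hnorm gamma xi) `^ (p + beta) in
    let c := (`|beta + 1| / p) `^ p in
    let lhs := fun u : 'rV[R]_(n + k) -> R =>
      iint_on Omega (fun xi => (`|u xi| `^ p / hnorm gamma xi `^ p
        * ln (Rad / hnorm gamma xi) `^ beta
        * eunorm (xpart xi) `^ (gamma * p) / hnorm gamma xi `^ (gamma * p))%:E) in
    (forall u phi (L : \bar R), inD gamma p Omega w u phi ->
       (fun j => energy gamma p Omega w (phi j)) @ \oo --> L ->
       (c%:E * lhs u <= L)%E) /\
    (forall C : R, c < C -> exists u phi (L : \bar R), inD gamma p Omega w u phi /\
       (fun j => energy gamma p Omega w (phi j)) @ \oo --> L /\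
       (L < C%:E * lhs u)%E)).
Proof.
move=> n1 k1 gamma0; split.
  move=> be p Omega p1 oO hO w c lhs; have p0 : 0 < p by exact: lt_trans p1.
  have w0 xi : 0 <= w xi by exact: powR_ge0.
  have lhsE u : lhs u = iint_on Omega (fun xi => (`|u xi| `^ p * (psip gamma p xi * hnorm gamma xi `^ be))%:E).
    by rewrite /lhs; congr iint_on; apply/funext => xi; rewrite lhs_powerE.
  split=> [u phi L iD cL|nb C cC].
    have L0 : (0 <= L)%E.
      rewrite -(cvg_lim _ cL)//; apply: lime_ge; first exact: cvgP cL.
      by apply: nearW => j; exact: energy_ge0.
    (* If Q + beta = 0 there is no weight primitive to divide by, but the constant is 0 and only 0
       <= L remains. *)
    have [al0|al0] := eqVneq (Qdim n k gamma + be) 0.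
      by rewrite /c al0 normr0 mul0r powR0 ?gt_eqF// mul0e.
    rewrite lhsE; apply: (fatou_iint p0 _ _ _ _ iD cL).
    - by rewrite powR_gt0// divr_gt0// normr_gt0.
    - by move=> xi; apply: mulr_ge0; [exact: psip_ge0|exact: powR_ge0].
    - by apply: measurable_funM; [exact: measurable_psip|exact: measurable_hpow].
    - by move=> f; exact: hardy_test1.
  (* A test function is its own approximating sequence, so a constant sequence, with [L] its energy,
     violates the inequality for any larger constant. *)
  have [u tu lt] := sharp_power n1 gamma0 p1 cC nb.
  exists u, (fun _ => u), (energy gamma p Omega w u); split; first exact: inD_cst.
  split; first exact: cvg_cst.
  by rewrite lhsE (iint_on_vanish _ p0 (testfun_off tu)).
move=> be p Rad pQ p1 R0 be1 Omega w c lhs; have p0 : 0 < p by exact: lt_trans p1.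
have w0 xi : 0 <= w xi by exact: powR_ge0.
have lhsE u : lhs u = iint_on Omega (fun xi => (`|u xi| `^ p *
    (psip gamma p xi / hnorm gamma xi `^ p * ln (Rad / hnorm gamma xi) `^ be))%:E).
  by rewrite /lhs; congr iint_on; apply/funext => xi; rewrite lhs_logE.
split=> [u phi L iD cL|C cC].
  rewrite lhsE; apply: (fatou_iint p0 _ _ _ _ iD cL).
  - by rewrite powR_gt0// divr_gt0// normr_gt0 lt_eqF//; lra.
  - move=> xi; apply: mulr_ge0; last exact: powR_ge0.
    by apply: mulr_ge0; [exact: psip_ge0|rewrite invr_ge0 powR_ge0].
  - apply: measurable_funM; last exact: measurable_ln_hnorm_powR.
    apply: measurable_funM; first exact: measurable_psip.
    by under eq_fun do rewrite -powRN; exact: measurable_hpow.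
  - by move=> f; exact: hardy_test2.
have [u tu lt] := sharp_log n1 gamma0 pQ p1 R0 be1 cC.
exists u, (fun _ => u), (energy gamma p Omega w u); split; first exact: inD_cst.
split; first exact: cvg_cst.
by rewrite lhsE (iint_on_vanish _ p0 (testfun_off tu)).
Qed.
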